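(* Consider the stochastic Allen--Cahn problem, the assumptions on $f$ and $u_0$, and the noise types (MN1) and (MN2) described in the context. Let $f$ and $u_0$ satisfy those assumptions and let the noise $\xi^\varepsilon$ be of type (MN1) or (MN2). Let $u^\varepsilon(x,t)$ be the solution of $$\partial_t u=\Delta u+\frac1{\varepsilon^2}f(u)+\frac1\varepsilon\xi^\varepsilon(t)\ \ (t>0,\ x\in\Omega),\qquad \frac{\partial u}{\partial\nu}=0\ \ (t>0,\ x\in\partial\Omega),\qquad u(x,0)=u_0(x)\ \ (x\in\Omega).$$ Let $\eta\in(0,\eta_0)$ be arbitrary, where $\eta_0:=\min(a-a_-,a_+-a)$. Then there exist positive constants $\varepsilon_0$ and $M_0$ such that, for all $\varepsilon\in(0,\varepsilon_0)$: (i) for all $x\in\Omega$, $$a_--\eta\le u^\varepsilon(x,\mu_\varepsilon^{-1}\varepsilon^2|\ln\varepsilon|)\le a_++\eta;$$ (ii) for all $x\in\Omega$ such that $|u_0(x)-a^\varepsilon|\ge M_0\varepsilon$, $$\text{if } u_0(x)\ge a^\varepsilon+M_0\varepsilon\ \text{ then }\ u^\varepsilon(x,\mu_\varepsilon^{-1}\varepsilon^2|\ln\varepsilon|)\ge a_+-\eta,$$ $$\text{if } u_0(x)\le a^\varepsilon-M_0\varepsilon\ \text{ then }\ u^\varepsilon(x,\mu_\varepsilon^{-1}\varepsilon^2|\ln\varepsilon|)\le a_-+\eta.$$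
   Context: **Domain and data.** $\Omega\subset\mathbb R^n$ ($n\ge2$) is a smooth bounded open domain with outward unit normal $\nu$; $\varepsilon>0$ is a small parameter. $f\in C^2$ has exactly three zeros $a_-<a<a_+$, with $f'(a_\pm)<0$, $f'(a)>0$, and $\int_{a_-}^{a_+}f(u)\,du=0$. The initial datum $u_0\in C^2(\overline\Omega)$ does not depend on $\varepsilon$; $\Gamma_0:=\{x\in\Omega:u_0(x)=a\}\subset\subset\Omega$ is a $C^{2,\alpha}$ ($0<\alpha<1$) hypersurface without boundary enclosing a region $\Omega_0$; with $n(x)$ the outward unit normal to $\Gamma_0$, $\nabla u_0(x)\cdot n(x)\ne0$ on $\Gamma_0$; $u_0<a$ in $\Omega_0$ and $u_0>a$ in $\Omega\setminus\overline{\Omega_0}$. **Noise (MN1).** $\xi^\varepsilon(t):=\varepsilon^{-\gamma_1}\xi(\varepsilon^{-2\gamma_1}t)$ with $0<\gamma_1<1/3$, where $\xi(t)=\xi_t$, $t\ge0$, is a stationary stochastic process on $(\Omega_{prob},\mathcal F,\mathbb P)$, $\mathcal F=\sigma(\xi_r:0\le r<\infty)$, which is strongly mixing: with $\mathcal F_{s,t}:=\sigma(\xi_r:s\le r\le t)$ and $$\rho(t):=\sup_{s\ge0}\ \sup_{A\in\mathcal F_{s+t,\infty},\,B\in\mathcal F_{0,s}}\frac{|\mathbb P(A\cap B)-\mathbb P(A)\mathbb P(B)|}{\mathbb P(B)},$$ one has $\int_0^\infty\rho(t)^{1/p}dt<\infty$ for some $p>3/2$. Moreover $t\mapsto\xi(t)$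 is $C^1$ a.s., $|\xi(t)|\le M$, $|\dot\xi(t)|\le M$ for a deterministic constant $M$, and $E[\xi(t)]=0$. In particular $|\xi^\varepsilon(t)|\le M\varepsilon^{-\gamma_1}$, $|\dot\xi^\varepsilon(t)|\le M\varepsilon^{-3\gamma_1}$. **Noise (MN2).** $\xi^\varepsilon(t):=\dot W^\varepsilon(t)$, where $W^\varepsilon(t)=\int_{\mathbb R}\rho^\varepsilon(t-s)W(s)\,ds$, $W(t)$, $t\in\mathbb R$, is a two-sided Brownian motion with $W(0)=0$ ($W(t)=\widetilde W(-t)$ for $t<0$, $\widetilde W$ an independent Brownian motion), $\rho^\varepsilon(\tau)=\varepsilon^{-\gamma_2}\rho(\varepsilon^{-\gamma_2}\tau)$, $0<\gamma_2<2/3$, and $\rho:\mathbb R\to\mathbb R_+$ is a smooth symmetric kernel vanishing outside $[-1,1]$ with $\int_{\mathbb R}\rho=1$. It is known that for any $T>0$ there are a non-random $M=M(T)$ and a random $\varepsilon_0>0$ with $|\xi^\varepsilon(t)|\le M\varepsilon^{-\gamma_2/2}|\log\varepsilon|^{1/2}$ and $|\dot\xi^\varepsilon(t)|\le M\varepsilon^{-3\gamma_2/2}|\log\varepsilon|^{1/2}$ for $0<\varepsilon\le\varepsilon_0$, $0\le t\le T$. **Notation.** $f^\varepsilon(u):=f(u)+\varepsilon\xi^\varepsilon(0)$. Since $\varepsilon\xi^\varepsilon(0)\to0$, for small $\varepsilon$ the function $f^\varepsilon$ has exactly three zeros $a_-^\varepsilon<a^\varepsilon<a_+^\varepsilon$,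 converging to $a_-,a,a_+$. $\mu_\varepsilon:=\frac{d}{du}f^\varepsilon(a^\varepsilon)$, so $\mu_\varepsilon\to f'(a)>0$. **Randomness.** The statement is pathwise, for almost every realization; $\varepsilon_0$ and $M_0$ may depend on the realization.
   Formalization: The condition u_0 > a is required on the closure of Ω minus the closure of Ω_0, i.e. also on ∂Ω; if u_0 equals a at a point of ∂Ω with negative normal derivative, (ii) can fail, since the Neumann flow raises u there by about ε|ln ε|^{1/2}. *)

(* Defs.v *)
From HB Require Import structures.
From mathcomp Require Import all_boot all_order all_algebra.
From mathcomp Require Import all_classical all_reals all_analysis.

Set Implicit Arguments.
Unset Strict Implicit.
Unset Printing Implicit Defensive.
Import Order.TTheory GRing.Theory Num.Theory numFieldNormedType.Exports.
Local Open Scope classical_set_scope.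
Local Open Scope ring_scope.

Section Calculus.
Variables (R : realType) (n : nat).
Implicit Types (U A : set 'rV[R]_n) (f : 'rV[R]_n -> R).

(* The norm of the normed module 'rV[R]_n is the sup norm, hence a separate
   Euclidean norm for unit normals. *)
Definition dot (v w : 'rV[R]_n) : R := \sum_(i < n) v 0 i * w 0 i.

Definition enorm (v : 'rV[R]_n) : R := Num.sqrt (dot v v).

Definition boundary A : set 'rV[R]_n := closure A `\` interior A.

Definition compactly_contained A U : Prop :=
  compact (closure A) /\ closure A `<=` U.

(* iterated partial derivative; the head of the list is the last one taken *)
Fixpoint pder (s : seq 'I_n) f : 'rV[R]_n -> R :=
  if s is i :: s' then fun x => 'D_('e_i) (pder s' f) x else f.

Definition grad f (x : 'rV[R]_n) : 'rV[R]_n := \row_i pder [:: i] f x.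

Definition laplacian f (x : 'rV[R]_n) : R := \sum_(i < n) pder [:: i; i] f x.

Definition Ck_on (k : nat) U f : Prop :=
  forall s : seq 'I_n, (size s <= k)%N -> forall x, U x ->
    {for x, continuous (pder s f)} /\
    ((size s < k)%N -> forall i, derivable (pder s f) x 'e_i).

Definition smooth_on U f : Prop := forall k, Ck_on k U f.

Definition Ck_hoelder_on (k : nat) (alpha : R) U f : Prop :=
  Ck_on k U f /\
  forall s : seq 'I_n, size s = k -> exists K : R,
    forall x y, U x -> U y ->
      `|pder s f x - pder s f y| <= K * `|x - y| `^ alpha.

(* C^k up to the boundary of the open set U: all partial derivatives of order
   at most k extend continuously to the closure of U. *)
Definition Ck_closure (k : nat) U f : Prop :=
  Ck_on k U f /\
  exists g : seq 'I_n -> 'rV[R]_n -> R,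
    (forall x, closure U x -> g [::] x = f x) /\
    forall s : seq 'I_n, (size s <= k)%N ->
      {within closure U, continuous (g s)} /\
      forall x, U x -> g s x = pder s f x.

(* Near p, A is the strict sublevel set {phi < 0} of a function of the
   regularity class C without critical points. *)
Definition defining_function (C : set 'rV[R]_n -> ('rV[R]_n -> R) -> Prop)
    A (p : 'rV[R]_n) U (phi : 'rV[R]_n -> R) : Prop :=
  [/\ open U, U p, C U phi, forall x, U x -> grad phi x != 0 &
      A `&` U = [set x | U x /\ phi x < 0]].

Definition boundary_of_class (C : set 'rV[R]_n -> ('rV[R]_n -> R) -> Prop)
    A : Prop :=
  forall p, boundary A p -> exists U phi, defining_function C A p U phi.

(* The vector does not depend on the choice of the defining function. *)
Definition outward_unit_normal A (p v : 'rV[R]_n) : Prop :=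
  boundary A p /\
  exists U phi, defining_function (Ck_on 1) A p U phi /\
    v = (enorm (grad phi p))^-1 *: grad phi p.

Definition smooth_bounded_domain A : Prop :=
  [/\ A !=set0, open A, connected A, bounded_set A &
      boundary_of_class smooth_on A].

End Calculus.

Section Problem.
Variables (R : realType) (n : nat).

Definition three_zeros (g : R -> R) (zm z zp : R) : Prop :=
  [/\ zm < z, z < zp &
      forall v, g v = 0 <-> [\/ v = zm, v = z | v = zp]].

Record bistable (f : R -> R) (am a ap : R) : Prop := Bistable {
  bistable_derivable : forall v, derivable f v 1 /\ derivable (derive1 f) v 1;
  bistable_C2 : continuous (derive1 (derive1 f));
  bistable_zeros : three_zeros f am a ap;
  bistable_am : derive1 f am < 0;
  bistable_ap : derive1 f ap < 0;
  bistable_a : 0 < derive1 f a;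
  bistable_balanced :
    (\int[@lebesgue_measure R]_(v in `[am, ap]%classic) f v = 0)%R }.

(* O0 is the region enclosed by the level set {u0 = a}. That u0 > a outside O0
   is required up to the boundary of O: contact of the level a with that
   boundary would be incompatible with generation of interface at distance e,
   as u0 is not assumed to satisfy the Neumann condition. *)
Record initial_datum (O : set 'rV[R]_n) (a alpha : R)
    (u0 : 'rV[R]_n -> R) (O0 : set 'rV[R]_n) : Prop := InitialDatum {
  datum_C2 : Ck_closure 2 O u0;
  datum_level : compactly_contained [set x | O x /\ u0 x = a] O;
  datum_O0 : [/\ O0 !=set0, open O0 & O0 `<=` O];
  datum_encloses : boundary O0 = [set x | O x /\ u0 x = a];
  datum_hypersurface : boundary_of_class (Ck_hoelder_on 2 alpha) O0;
  datum_transversal : forall x v, outward_unit_normal O0 x v ->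
    dot (grad u0 x) v != 0;
  datum_inside : forall x, O0 x -> u0 x < a;
  datum_outside : forall x, closure O x -> ~ closure O0 x -> a < u0 x }.

(* Classical solution of
     u_t = Lap u + f(u) / e^2 + h(t) / e,  du/dnu = 0,  u(., 0) = u0,
   where h is a path of the noise: C^{2,1} in O x (0, oo), with spatial
   gradient extending continuously to the closure of O for t > 0, and
   continuous on the closure of O down to t = 0. *)
Record classical_solution (O : set 'rV[R]_n) (f : R -> R) (e : R)
    (h : R -> R) (u0 : 'rV[R]_n -> R) (u : 'rV[R]_n -> R -> R) : Prop :=
    ClassicalSolution {
  sol_continuous :
    {within closure O `*` `[0, +oo[%classic,
      continuous (fun z : 'rV[R]_n * R => u z.1 z.2)};
  sol_space_derivable : forall (t : R) (s : seq 'I_n) (i : 'I_n) x,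
    0 < t -> (size s < 2)%N -> O x ->
    derivable (pder s (u ^~ t)) x 'e_i;
  sol_space_C2 : forall (t : R) (s : seq 'I_n) x,
    0 < t -> (size s <= 2)%N -> O x ->
    {for (x, t), continuous
      (fun z : 'rV[R]_n * R => pder s (u ^~ z.2) z.1)};
  sol_time_derivable : forall (t : R) x, 0 < t -> O x -> derivable (u x) t 1;
  sol_time_C1 : forall (t : R) x, 0 < t -> O x ->
    {for (x, t), continuous (fun z : 'rV[R]_n * R => derive1 (u z.1) z.2)};
  sol_equation : forall (t : R) x, 0 < t -> O x ->
    derive1 (u x) t =
      laplacian (u ^~ t) x + (e ^+ 2)^-1 * f (u x t) + e^-1 * h t;
  sol_neumann : exists Du : 'rV[R]_n * R -> 'rV[R]_n,
    [/\ {within closure O `*` `]0, +oo[%classic, continuous Du},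
        forall (t : R) x, 0 < t -> O x -> Du (x, t) = grad (u ^~ t) x &
        forall (t : R) x v, 0 < t -> outward_unit_normal O x v ->
          dot (Du (x, t)) v = 0];
  sol_initial : forall x, O x -> u x 0 = u0 x }.

(* f + e * xi^e(0), where xi0 e stands for xi^e(0) *)
Definition feps (f : R -> R) (xi0 : R -> R) (e : R) : R -> R :=
  fun v => f v + e * xi0 e.

(* The three branches of zeros of f + e * xi^e(0), which converge to the zeros
   of f. As f' does not vanish at am, a, ap, the branches are unique for small
   e. Zeros of f + e * xi^e(0) away from [am, ap] are not excluded: an f that
   tends to 0 at infinity produces such zeros for every small e. *)
Definition zero_branches (f : R -> R) (am a ap : R) (xi0 : R -> R)
    (aem ae aep : R -> R) : Prop :=
  (\forall e \near 0^'+,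
     [/\ aem e < ae e < aep e, feps f xi0 e (aem e) = 0,
         feps f xi0 e (ae e) = 0 & feps f xi0 e (aep e) = 0]) /\
  [/\ aem @ 0^'+ --> am, ae @ 0^'+ --> a & aep @ 0^'+ --> ap].

End Problem.

Section Noise.
Context (R : realType) (d : measure_display) (T : measurableType d).
Variable P : probability T R.
Implicit Types X W : R -> {RV P >-> R}.

Definition sigma_of X (I : set R) : set (set T) :=
  <<s \bigcup_(r in I) preimage_set_system setT (X r) measurable >>.

Definition stationary X : Prop :=
  forall (m : nat) (t : 'I_m -> R) (A : 'I_m -> set R) (h : R),
    0 <= h -> (forall i, 0 <= t i) -> (forall i, measurable (A i)) ->
    P (\bigcap_(i in setT) (X (t i + h) @^-1` A i)) =
    P (\bigcap_(i in setT) (X (t i) @^-1` A i)).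

Definition mixing_coef X (t : R) : R :=
  sup [set r : R | exists (s : R) (A B : set T),
    [/\ 0 <= s, sigma_of X `[s + t, +oo[%classic A,
        sigma_of X `[0, s]%classic B, (0 < P B)%E &
        r = `|fine (P (A `&` B)) - fine (P A) * fine (P B)| / fine (P B)]].

Definition C1_halfline (g : R -> R) : Prop :=
  [/\ {within `[0, +oo[%classic, continuous g},
      forall t, 0 < t -> derivable g t 1 &
      exists g' : R -> R, {within `[0, +oo[%classic, continuous g'} /\
        forall t, 0 < t -> g' t = derive1 g t].

Record mixing_process X (p M : R) : Prop := MixingProcess {
  mixing_stationary : stationary X;
  mixing_generates : sigma_of X `[0, +oo[%classic = measurable;
  mixing_exponent : 3 / 2 < p;
  mixing_strong :
    (\int[@lebesgue_measure R]_(t in `[0%R, +oo[%classic)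
       (mixing_coef X t `^ p^-1)%:E < +oo)%E;
  mixing_path : {ae P, forall w,
    C1_halfline (fun t => X t w) /\
    (forall t, 0 <= t -> `|X t w| <= M) /\
    (forall t, 0 < t -> `|derive1 (fun s => X s w) t| <= M)};
  mixing_centered : forall t, 0 <= t -> ('E_P[X t] = 0)%E }.

(* In both noise types, xi e t w is the value at time t and sample point w of
   the noise with parameter e. *)
Definition MN1 (xi : R -> R -> T -> R) : Prop :=
  exists (X : R -> {RV P >-> R}) (g1 p M : R),
    [/\ 0 < g1 < 1 / 3, mixing_process X p M &
        forall e t w, 0 < e -> 0 <= t ->
          xi e t w = e `^ (- g1) * X (e `^ (- (2 * g1)) * t) w].

Definition independent_sigma (F G : set (set T)) : Prop :=
  forall A B, F A -> G B -> P (A `&` B) = (P A * P B)%E.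

Definition increment (B : R -> {RV P >-> R}) (s t : R) : T -> R := fun w => B t w - B s w.

(* one-sided Brownian motion; only the times t >= 0 matter *)
Record brownian (B : R -> {RV P >-> R}) : Prop := Brownian {
  brownian_start : {ae P, forall w, B 0 w = 0};
  brownian_continuous :
    {ae P, forall w, {within `[0, +oo[%classic, continuous (fun t => B t w)}};
  brownian_gaussian : forall s t, 0 <= s < t ->
    forall A : set R, measurable A ->
      P (increment B s t @^-1` A) = normal_prob 0 (Num.sqrt (t - s)) A;
  brownian_independent : forall s t, 0 <= s < t ->
    independent_sigma (sigma_of B `[0, s]%classic)
      <<s preimage_set_system setT (increment B s t) measurable >> }.

Definition two_sided_brownian W : Prop :=
  [/\ brownian W, brownian (fun t => W (- t)) &
      independent_sigma (sigma_of W `[0, +oo[%classic)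
                        (sigma_of W `]-oo, 0]%classic)].

Record mollifier (rho : R -> R) : Prop := Mollifier {
  mollifier_smooth : forall k x, derivable (derive1n k rho) x 1;
  mollifier_even : forall x, rho (- x) = rho x;
  mollifier_ge0 : forall x, 0 <= rho x;
  mollifier_support : forall x, 1 < `|x| -> rho x = 0;
  mollifier_mass : (\int[@lebesgue_measure R]_(x in setT) rho x = 1)%R }.

Definition rescaled (rho : R -> R) (g2 e : R) : R -> R :=
  fun tau => e `^ (- g2) * rho (e `^ (- g2) * tau).

Definition mollified W (rho : R -> R) (g2 e : R) (w : T) : R -> R :=
  fun t => (\int[@lebesgue_measure R]_(s in setT)
              (rescaled rho g2 e (t - s) * W s w))%R.

Definition MN2 (xi : R -> R -> T -> R) : Prop :=
  exists (W : R -> {RV P >-> R}) (rho : R -> R) (g2 : R),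
    [/\ 0 < g2 < 2 / 3, two_sided_brownian W, mollifier rho &
        forall e t w, 0 < e -> 0 <= t ->
          xi e t w = derive1 (mollified W rho g2 e w) t].

End Noise.

(* Main.v *)
(* In the rescaled time tau = t / e^2 the solution follows the flow of the
   reaction f, perturbed by diffusion and noise.  Up to the time |ln e| / mu the
   noise moves by at most 1, hence changes the reaction by O(e) only; this is
   harmless for data at distance at least M0 e from the unstable zero b = a^e.

   Lower bounds come from the comparison principle.  A spatially constant
   function decreasing exponentially fast to am - eta / 2 gives (i).  For (ii)
   take w = b + Phi (z), with
     z = E (v0 - r e^2 E - k e) + k e,   E = exp (mu tau),
   where v0 is u0 - b, capped so as to be constant near the boundary, and Phi is
   an explicit increasing function with Phi (z) <= z, Phi (+oo) < ap - a and
   mu z Phi' (z) <= f (b + Phi (z)) - f b.  At the final time E = 1 / e, hence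
   z >= M0 / 3 - r - k wherever u0 >= b + M0 e.  The upper bounds follow by
   applying this to - u; there v0 is very negative at the boundary, where w then
   lies below the first barrier and no cap is needed.

   The comparison principle itself is proved at a first contact point; if this
   lies on the boundary, a barrier built from a local defining function of the
   domain contradicts the Neumann condition. *)

(* With y = Z z / (z + Z), the function Phi is ln (1 + B y) / B. Without saturation (y = z) it would
   follow, along z' = mu z, the exact flow of the reaction mu (1 - exp (- B y)) / B. For large B
   this lies below f (b + y) - f b on the range needed and has the same slope mu at 0. That slope
   must not be lowered: a smaller rate would change E = 1 / e at the final time by a power of e, and
   data at distance M0 e would no longer suffice. The saturation keeps Phi below ap - a and leaves a
   gap of order z^2; since the gap vanishes at z = 0, the shift k e has to pay for the noise there.
   The closed form also bounds Phi'' / Phi' away from the singularity of Phi, by constants fixed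
   before e and b = a^e are known. The comparison principle asks for the differential inequality at
   contact points only. Hence w may be cut off near the singularity, at a level that the first
   barrier keeps below u. As u0 need not satisfy the Neumann condition, the comparison functions are
   made independent of x near any boundary contact. *)
Require Import Defs.
From HB Require Import structures.
From mathcomp Require Import all_boot all_order all_algebra.
From mathcomp Require Import all_classical all_reals all_analysis.
From mathcomp Require Import ring lra.
Import Order.TTheory GRing.Theory Num.Theory numFieldNormedType.Exports.
Local Open Scope classical_set_scope.
Local Open Scope ring_scope.

Set Implicit Arguments.
Unset Strict Implicit.
Unset Printing Implicit Defensive.

(** * Comparison principle *)

Section Calculus.
Context {R : realType}.

Lemma pos_lt2 (a b : R) : 0 < a -> 0 < b -> exists s, [/\ 0 < s, s < a & s < b].
Proof.
move=> a0 b0; have m0 : 0 < Num.min a b by rewrite lt_min a0.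
have := ge_min a a b; have := ge_min b a b; rewrite !lexx orbT /=.
exists (Num.min a b / 2); split; lra.
Qed.

Lemma pos_lt_seq (s : seq R) : all (fun a => 0 < a) s ->
  exists2 r, 0 < r & all (fun a => r < a) s.
Proof.
elim: s => [_|a s IH /= /andP[a0 /IH[r r0 rs]]]; first by exists 1.
have [b [b0 ba br]] := pos_lt2 a0 r0; exists b => //.
by rewrite ba; apply: sub_all rs => c; exact: lt_trans.
Qed.

Lemma within_continuousP {V W : normedModType R} (A : set V) (f : V -> W) :
  {within A, continuous f} <->
  forall x, A x -> forall e : R, 0 < e -> exists2 r, 0 < r &
    forall y, A y -> `|x - y| < r -> `|f x - f y| < e.
Proof.
split=> [/subspace_continuousP cf x Ax e e0|H].
  have /cvgrPdist_lt/(_ _ e0) := cf x Ax.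
  rewrite near_withinE => /nbhs_ballP[r /= r0 H]; exists r => // y Ay xy.
  by apply: H => //; rewrite -ball_normE.
apply/subspace_continuousP => x Ax; apply/cvgrPdist_lt => e e0.
have [r r0 H'] := H x Ax e e0.
rewrite near_withinE; apply/nbhs_ballP; exists r => // y.
by rewrite -ball_normE => xy Ay; exact: H'.
Qed.

Lemma nearP {V : normedModType R} (x : V) (P : set V) :
  (\forall y \near x, P y) <->
  exists2 r : R, 0 < r & forall y, `|x - y| < r -> P y.
Proof.
split=> [/nbhs_ballP[r /= r0 H]|[r r0 H]].
  by exists r => // y xy; apply: H; rewrite -ball_normE.
by apply/nbhs_ballP; exists r => // y; rewrite -ball_normE; exact: H.
Qed.

Lemma continuous_forP {V W : normedModType R} (f : V -> W) (x : V) :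
  {for x, continuous f} -> forall e : R, 0 < e ->
  exists2 r, 0 < r & forall y, `|x - y| < r -> `|f x - f y| < e.
Proof. by move=> /cvgrPdist_lt cf e /cf /nearP. Qed.

Lemma continuous_bigsum {V : normedModType R} I (s : seq I) (F : I -> V -> R)
    (x : V) : (forall i, {for x, continuous (F i)}) ->
  {for x, continuous (fun y => \sum_(i <- s) F i y)}.
Proof.
move=> cF; elim: s => [|i s IH].
  have -> : (fun y => \sum_(i <- [::]) F i y) = cst 0.
    by apply/funext => y; rewrite big_nil.
  exact: cst_continuous.
have -> : (fun y => \sum_(i <- i :: s) F i y) = F i + (fun y => \sum_(i <- s) F i y).
  by apply/funext => y; rewrite big_cons.
by apply: continuousD; [exact: cF|exact: IH].
Qed.

Lemma line_is_derive {V : normedModType R} (f : V -> R) x v (s : R) :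
  derivable f (s *: v + x) v ->
  is_derive s 1 (fun h : R => f (h *: v + x)) ('D_v f (s *: v + x)).
Proof.
move=> df.
have E : (fun h : R => h^-1 *: (((fun h : R => f (h *: v + x)) \o shift s) (h *: 1) -
     f (s *: v + x))) = (fun h : R => h^-1 *: ((f \o shift (s *: v + x)) (h *: v) -
     f (s *: v + x))).
  by apply/funext => h /=; rewrite addrA scalerDl [h *: 1]mulr1.
by apply: DeriveDef; rewrite ?/derivable ?/derive E.
Qed.

Lemma is_derive_cvg (g : R -> R) (t q e : R) : is_derive t 1 g q -> 0 < e ->
  exists2 r, 0 < r & forall h, h != 0 -> `|h| < r ->
    `|q - h^-1 * (g (h + t) - g t)| < e.
Proof.
move=> [dg <-] e0; have /cvgrPdist_lt/(_ _ e0) := dg.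
rewrite near_withinE => /nearP[r r0 H]; exists r => // h h0 hr.
have := H h; rewrite sub0r normrN => /(_ hr h0); rewrite /derive /=.
by rewrite [h *: 1]mulr1.
Qed.

(** If [q < 0], then [g1], which vanishes at 0, is negative just to the right of 0, and the mean
    value theorem puts [g] below [g 0] there. *)
Lemma min_second_derive (g g1 : R -> R) (q : R) :
  (\forall s \near (0 : R), is_derive (s : R) 1 g (g1 s)) -> is_derive (0 : R) 1 g1 q ->
  (\forall s \near (0 : R), g 0 <= g s) -> 0 <= q.
Proof.
move=> /nearP[r1 r10 H1] dq /nearP[r2 r20 H2].
pose r := Num.min r1 r2.
have r0 : 0 < r by rewrite lt_min r10.
have D (s : R) : `|s| < r -> is_derive s 1 g (g1 s).
  by rewrite lt_min => /andP[sr _]; apply: H1; rewrite sub0r normrN.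
have M s : `|s| < r -> g 0 <= g s.
  by rewrite lt_min => /andP[_ sr]; apply: H2; rewrite sub0r normrN.
have g10 : g1 0 = 0.
  have [] := @derive1_at_min _ g (- r) r 0.
  - lra.
  - by move=> t; rewrite in_itv /= => tr; case: (D t) => //; rewrite ltr_norml.
  - by rewrite in_itv /=; lra.
  - by move=> t; rewrite in_itv /= => tr; apply: M; rewrite ltr_norml.
  by move=> _ E; case: (D 0) => [|_ <-]; rewrite ?normr0.
rewrite leNgt; apply/negP => q0.
have nq : 0 < - q by lra.
have [r3 r30 H3] := is_derive_cvg dq nq.
have [s [s0 sr sr3]] := pos_lt2 r0 r30.
have [||c] := @MVT R g g1 0 s s0.
- move=> x; rewrite in_itv /= => xs; apply: D.
  by rewrite gtr0_norm; lra.
- apply: derivable_within_continuous => x; rewrite in_itv /= => xs.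
  by case: (D x) => //; rewrite ger0_norm; lra.
rewrite in_itv /= subr0 => /andP[c0 cs] E.
have Hc : g1 c < 0.
  have := H3 c; rewrite gt_eqF // gtr0_norm // => /(_ isT).
  have cr3 : c < r3 by lra.
  move/(_ cr3); rewrite addr0 g10 subr0 ltr_norml => /andP[+ _].
  have : g1 c = c * (c^-1 * g1 c) by rewrite mulrA divff ?gt_eqF // mul1r.
  set z := c^-1 * g1 c => -> ?; have : z < 0 by lra.
  by move=> ?; rewrite pmulr_rlt0.
have := M s; rewrite gtr0_norm // => /(_ sr).
suff : g1 c * s < 0 by lra.
by rewrite pmulr_llt0.
Qed.

Lemma min_left_derive (g : R -> R) (t q r : R) : 0 < r -> is_derive t 1 g q ->
  (forall s, t - r < s -> s <= t -> g t <= g s) -> q <= 0.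
Proof.
move=> r0 dg H; rewrite leNgt; apply/negP => q0.
have [r1 r10 H1] := is_derive_cvg dg q0.
have [h [h0 hr hr1]] := pos_lt2 r0 r10.
have := H1 (- h); rewrite oppr_eq0 gt_eqF // normrN gtr0_norm // => /(_ isT hr1).
rewrite ltr_norml => /andP[_].
have : g t <= g (- h + t) by apply: H; lra.
rewrite invrN mulNr => A B.
suff : 0 <= h^-1 * (g (- h + t) - g t) by lra.
by rewrite mulr_ge0 ?invr_ge0 ?subr_ge0 // ltW.
Qed.

End Calculus.

Section Jets.
Context {R : realType} {n : nat}.
Implicit Types (x y v : 'rV[R]_n) (O U : set 'rV[R]_n).

Lemma rV_norm_le v (r : R) : 0 <= r -> (forall i, `|v 0 i| <= r) -> `|v| <= r.
Proof.
move=> r0 H; rewrite /Num.norm /=.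
have [->//|/mx_norm_neq0[[i j] ->]] := eqVneq (mx_norm v) 0.
by rewrite /= ord1.
Qed.

Lemma rV_coord_le v i : `|v 0 i| <= `|v|.
Proof.
rewrite /Num.norm /= mx_normrE.
exact: (le_bigmax _ (fun i : 'I_1 * 'I_n => `|v i.1 i.2|) (0, i)).
Qed.

Lemma norm_scale_e (s : R) (i : 'I_n) : `|s *: ('e_i : 'rV[R]_n)| <= `|s|.
Proof.
apply: rV_norm_le => // j; rewrite !mxE eqxx /=.
by case: (_ == _); rewrite ?mulr1 ?mulr0 ?normr0.
Qed.

(** The time derivative and the pure second derivatives are all that the equation and the test at a
    minimum use. Taken along coordinate lines, they are computed by one-variable calculus, without
    total differentiability. *)
Definition jet (w : 'rV[R]_n -> R -> R) x (t wt : R) (q : 'I_n -> R) : Prop :=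
  is_derive t 1 (w x) wt /\ forall i, exists2 w1 : R -> R,
    (\forall s \near (0 : R), is_derive (s : R) 1
       (fun s : R => w (s *: 'e_i + x) t) (w1 s)) & is_derive (0 : R) 1 w1 (q i).

Lemma jetD w1 w2 x t a1 a2 q1 q2 : jet w1 x t a1 q1 -> jet w2 x t a2 q2 ->
  jet (fun x t => w1 x t + w2 x t) x t (a1 + a2) (fun i => q1 i + q2 i).
Proof.
move=> [t1 x1] [t2 x2]; split; first exact: is_deriveD.
move=> i; have [g1 g1P g1D] := x1 i; have [g2 g2P g2D] := x2 i.
exists (fun s => g1 s + g2 s); last exact: is_deriveD.
by near=> s; apply: is_deriveD; near: s.
Unshelve. all: end_near. Qed.

Lemma jetZ w x t a q (k : R) : jet w x t a q ->
  jet (fun x t => k * w x t) x t (k * a) (fun i => k * q i).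
Proof.
move=> [t1 x1]; split; first exact: is_deriveZ.
move=> i; have [g1 g1P g1D] := x1 i.
exists (fun s => k * g1 s); last exact: is_deriveZ.
by near=> s; apply: is_deriveZ; near: s.
Unshelve. all: end_near. Qed.

Lemma jetB w1 w2 x t a1 a2 q1 q2 : jet w1 x t a1 q1 -> jet w2 x t a2 q2 ->
  jet (fun x t => w1 x t - w2 x t) x t (a1 - a2) (fun i => q1 i - q2 i).
Proof.
move=> j1 /(jetZ (-1)) /(jetD j1) [jt jx]; split.
  rewrite mulN1r in jt.
  by under eq_fun do rewrite -[X in _ + X]mulN1r.
move=> i; have [g gP gD] := jx i; exists g; last by rewrite mulN1r in gD.
apply: (filterS _ gP) => s.
by under [X in is_derive _ _ X]eq_fun do rewrite mulN1r.
Qed.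

Lemma jet_time (w : R -> R) x (t a : R) : is_derive t 1 w a ->
  jet (fun _ t => w t) x t a (fun=> 0).
Proof.
move=> wt; split=> // i; exists (fun=> 0); last exact: is_derive_cst.
by apply: (@nearW _ (nbhs (0 : R))) => s; exact: is_derive_cst.
Qed.

Lemma line_jet (g : 'rV[R]_n -> R) O x i : open O -> O x ->
  (forall (s : seq 'I_n) j y, (size s < 2)%N -> O y ->
    derivable (pder s g) y 'e_j) ->
  (\forall s \near (0 : R), is_derive (s : R) 1 (fun s : R => g (s *: 'e_i + x))
     (pder [:: i] g (s *: 'e_i + x))) /\
  is_derive (0 : R) 1 (fun s : R => pder [:: i] g (s *: 'e_i + x)) (pder [:: i; i] g x).
Proof.
move=> oO Ox H.
have /nearP[r r0 Hr] : \forall y \near x, O y by exact: open_nbhs_nbhs.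
split.
  apply/nearP; exists r => // s; rewrite sub0r normrN => sr.
  apply: line_is_derive; apply: (H [::]) => //; apply: Hr.
  by rewrite -normrN opprB addrK; apply: le_lt_trans sr; exact: norm_scale_e.
have := @line_is_derive _ _ (pder [:: i] g) x 'e_i 0.
by rewrite scale0r add0r; apply; exact: (H [:: i]).
Qed.

Lemma jet_space (w : 'rV[R]_n -> R -> R) O x (t a : R) : open O -> O x ->
  is_derive t 1 (w x) a ->
  (forall (s : seq 'I_n) i y, (size s < 2)%N -> O y ->
    derivable (pder s (w ^~ t)) y 'e_i) ->
  jet w x t a (fun i => pder [:: i; i] (w ^~ t) x).
Proof.
move=> oO Ox dt H; split=> // i.
have [d1 d2] := line_jet i oO Ox H.
by exists (fun s => pder [:: i] (w ^~ t) (s *: 'e_i + x)).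
Qed.

Lemma jet_C2 (phi : 'rV[R]_n -> R) O x (t : R) : open O -> O x -> Ck_on 2 O phi ->
  jet (fun x _ => phi x) x t 0 (fun i => pder [:: i; i] phi x).
Proof.
move=> oO Ox H; apply: (@jet_space (fun x _ => phi x) O) => //.
by move=> s i y s2 Oy; have [_ ] := H s (ltnW s2) y Oy; apply.
Qed.

Lemma jet_sqnorm x0 x (t : R) :
  jet (fun x _ => \sum_(i < n) (x 0 i - x0 0 i) ^+ 2) x t 0 (fun=> 2).
Proof.
split=> [|i]; first exact: (is_derive_cst (\sum_(i < n) (x 0 i - x0 0 i) ^+ 2)).
pose c := \sum_(j < n | j != i) (x 0 j - x0 0 j) ^+ 2.
have E : (fun s : R => \sum_(j < n) ((s *: 'e_i + x) 0 j - x0 0 j) ^+ 2) =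
    (fun s => (s + (x 0 i - x0 0 i)) ^+ 2 + c).
  apply/funext => s; rewrite (bigD1 i) //=; congr (_ + _).
    by rewrite !mxE !eqxx mulr1 -addrA.
  apply: eq_bigr => j ji; rewrite !mxE (negbTE ji) andbF mulr0 add0r //.
exists (fun s => 2 * (s + (x 0 i - x0 0 i))).
  apply: (@nearW _ (nbhs (0 : R))) => s; rewrite E; apply: is_derive_eq.
  by rewrite /GRing.scale /=; ring.
by apply: is_derive_eq; rewrite /GRing.scale /=; ring.
Qed.

Lemma jet_min w x (t a : R) q (r : R) : jet w x t a q -> 0 < r ->
  (forall y (s : R), `|x - y| < r -> t - r < s -> s <= t -> w x t <= w y s) ->
  a <= 0 /\ forall i, 0 <= q i.
Proof.
move=> [dt dx] r0 H; split.
  by apply: (min_left_derive r0 dt) => s ? ?; apply: H; rewrite ?subrr ?normr0.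
move=> i; have [w1 dw dw1] := dx i.
apply: (min_second_derive dw dw1); apply/nearP; exists r => // s.
rewrite sub0r normrN => sr; rewrite scale0r add0r; apply: H => //; last lra.
by rewrite -normrN opprB addrK; apply: le_lt_trans sr; exact: norm_scale_e.
Qed.

End Jets.

Section FirstTouch.
Context {R : realType} {V : normedModType R}.

Lemma norm_pair_lt (W : normedModType R) (a b : V * W) (r : R) :
  `|a - b| < r <-> `|a.1 - b.1| < r /\ `|a.2 - b.2| < r.
Proof.
rewrite prod_normE gt_max /=; split; first by move=> /andP.
by move=> [-> ->].
Qed.

(** The set where [D <= 0] is compact, so it has a point of least time; that point is a first
    contact. *)
Lemma first_touch (K : set V) (T : R) (D : V -> R -> R) : compact K ->
  {within K `*` `[0, T], continuous (fun z : V * R => D z.1 z.2)} ->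
  (forall x, K x -> 0 < D x 0) ->
  (forall x (t : R), K x -> 0 < t <= T -> D x t = 0 ->
    (forall y (s : R), K y -> 0 <= s <= t -> 0 <= D y s) -> False) ->
  forall x (t : R), K x -> 0 <= t <= T -> 0 < D x t.
Proof.
move=> cK cD D0 H x t Kx tT; rewrite ltNge; apply/negP => Dxt.
pose Dz (z : V * R) := D z.1 z.2.
pose A := (K `*` `[0, T]) `&` [set z | Dz z <= 0].
have cKT : compact (K `*` `[0, T]%classic).
  by apply: compact_setX => //; exact: segment_compact.
have cA : compact A.
  rewrite /A setIC; apply/compact_subspaceIP; rewrite setIC.
  apply: (@compact_closedI (subspace (K `*` `[0, T]%classic))).
    by rewrite -[X in compact X]setIid; apply/compact_subspaceIP; rewrite setIid.
  have -> : [set z | Dz z <= 0] = Dz @^-1` [set y | y <= 0] by [].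
  by apply: (@preimage_closed _ _ (Dz : subspace (K `*` `[0,T]%classic) -> R)).
have A0 : A !=set0 by exists (x, t); split => //=; split => //=; rewrite in_itv.
have sc : {within A, continuous (snd : V * R -> R)}.
  by apply: continuous_subspaceT => z; exact: cvg_snd.
have [[x0 t0]] := compact_EVT_min A0 cA sc.
rewrite inE => -[[/= Kx0]]; rewrite in_itv /= => t0T D0x0 Hmin.
have pos y s : K y -> 0 <= s < t0 -> 0 < D y s.
  move=> Ky /andP[s0 st]; rewrite ltNge; apply/negP => Dys.
  have := Hmin (y, s); rewrite inE /= => /(_ _)/wrap[|]; last by rewrite leNgt st.
  split=> //=; split=> //=; rewrite in_itv /= s0 /=.
  by apply: le_trans (ltW st) _; case/andP: t0T.
have t00 : 0 < t0.
  move: t0T => /andP[t00 _]; rewrite lt_neqAle t00 andbT; apply/eqP => E.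
  by move: D0x0; rewrite -E => /(lt_le_trans (D0 _ Kx0)); rewrite ltxx.
(* At time [t0] itself, a negative value would by continuity persist at slightly earlier times. *)
have nneg y s : K y -> 0 <= s <= t0 -> 0 <= D y s.
  move=> Ky /andP[s0]; rewrite le_eqVlt => /predU1P[->{s s0}|st]; last first.
    by apply/ltW/pos => //; rewrite s0.
  rewrite leNgt; apply/negP => neg.
  have Dn : 0 < - D y t0 by lra.
  have Kyt : (K `*` `[0, T]%classic) (y, t0) by split=> //=; rewrite in_itv.
  have [r r0 Hr] := (within_continuousP _ _).1 cD _ Kyt _ Dn.
  have [h [h0 hr ht]] := pos_lt2 r0 t00.
  have := Hr (y, t0 - h) => /(_ _ _)/wrap[||].
  - by split => //=; rewrite in_itv /=; lra.
  - apply/norm_pair_lt; rewrite /= subrr normr0; split=> //.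
    by rewrite opprB addrC subrK gtr0_norm.
  - have := pos y (t0 - h) Ky; rewrite /= ltr_norml.
    have -> : 0 <= t0 - h < t0 by lra.
    by move=> /(_ isT) ?; lra.
apply: (H x0 t0 Kx0) => //; first by rewrite t00; case/andP: t0T.
apply/eqP; rewrite eq_le D0x0 /=; apply: nneg => //; lra.
Qed.

End FirstTouch.

(** * Contact at the boundary: a Hopf-type barrier *)

Section Boundary.
Context {R : realType} {n : nat}.
Implicit Types (x y v : 'rV[R]_n) (O U : set 'rV[R]_n) (phi : 'rV[R]_n -> R).

Lemma compact_bounded_closure O : bounded_set O -> compact (closure O).
Proof.
move=> [M [_ /(_ (M + 1))]]; rewrite ltrDl ltr01 => /(_ isT) /= HM.
apply: bounded_closed_compact; last exact: closed_closure.
exists (M + 1); split; first exact: num_real.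
move=> M' /ltW MM' x cx; apply: le_trans MM'; move: x cx; move: (M + 1) HM => {}M HM.
have cB : closed [set x : 'rV[R]_n | `|x| <= M].
  rewrite (_ : [set _ | _] = (fun x : 'rV[R]_n => `|x|) @^-1` [set y | y <= M]) //.
  by apply: preimage_closed; [move=> z _; exact: norm_continuous|exact: closed_le].
by move=> x cx; have := closureS HM cx; have /closure_id <- := cB.
Qed.

Lemma boundary_open O x : open O -> boundary O x -> closure O x /\ ~ O x.
Proof. by move=> oO [cx]; have /interior_id -> := oO. Qed.

Lemma closure_le phi O U x : open U -> U x -> closure O x ->
  {for x, continuous phi} ->
  (forall y, O y -> U y -> phi y <= 0) -> phi x <= 0.
Proof.
move=> oU Ux cx cphi H; rewrite leNgt; apply/negP => p0.
have [r r0 Hr] := continuous_forP cphi p0.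
have /nearP[r' r'0 Hr'] : \forall y \near x, U y by exact: open_nbhs_nbhs.
have [s [s0 sr sr']] := pos_lt2 r0 r'0.
have [|y [Oy]] := cx (ball x s); first exact: nbhsx_ballx.
rewrite -ball_normE /= => xy.
have := Hr y (lt_trans xy sr); rewrite ltr_norml => /andP[_].
by have := H y Oy (Hr' y (lt_trans xy sr')); lra.
Qed.

Lemma laplacian_bounded phi U x : Ck_on 2 U phi -> U x ->
  exists L r, 0 < r /\ forall y, `|x - y| < r ->
   `|phi y| < L /\ `|laplacian phi y| < L.
Proof.
move=> C2 Ux.
have H (s : seq 'I_n) : (size s <= 2)%N -> exists2 r, 0 < r &
    forall y, `|x - y| < r -> `|pder s phi y| < `|pder s phi x| + 1.
  move=> s2; have [cs _] := C2 s s2 x Ux.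
  have [r r0 Hr] := continuous_forP cs ltr01.
  exists r => // y /Hr; have := lerB_dist (pder s phi y) (pder s phi x).
  by rewrite distrC; lra.
have [r1 r10 H1] := H [::] isT.
have H' (i : 'I_n) : \forall y \near x,
    `|pder [:: i; i] phi y| < `|pder [:: i; i] phi x| + 1.
  by apply/nearP; have [r r0 Hr] := H [:: i; i] isT; exists r.
have /nearP[r2 r20 H2] : \forall y \near x, forall i : 'I_n,
    `|pder [:: i; i] phi y| < `|pder [:: i; i] phi x| + 1 by apply: (@filter_forall 'rV[R]_n 'I_n _ (nbhs x) _ H').
have [r [r0 rr1 rr2]] := pos_lt2 r10 r20.
exists (\sum_i (`|pder [:: i; i] phi x| + 1) + (`|phi x| + 1)), r; split=> // y xy.
have S0 : 0 <= \sum_(i < n) (`|pder [:: i; i] phi x| + 1).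
  by apply: sumr_ge0 => i _; rewrite addr_ge0.
split.
  by have := H1 y (lt_trans xy rr1) => /=; lra.
apply: (@le_lt_trans _ _ (\sum_i (`|pder [:: i; i] phi x| + 1))).
  apply: le_trans (ler_norm_sum _ _ _) _; apply: ler_sum => i _.
  exact/ltW/H2/(lt_trans xy rr2).
by have := normr_ge0 (phi x); lra.
Qed.

Lemma not_ball_sqnorm x y (r : R) : 0 < r -> r <= `|x - y| ->
  r ^+ 2 <= \sum_(i < n) (y 0 i - x 0 i) ^+ 2.
Proof.
move=> r0 rxy; have : mx_norm (x - y) != 0.
  by rewrite gt_eqF // (lt_le_trans r0).
move=> /mx_norm_neq0[[j i]] /= E; rewrite (bigD1 i) //=.
apply: (@le_trans _ _ ((y 0 i - x 0 i) ^+ 2)); last first.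
  by rewrite lerDl; apply: sumr_ge0 => k _; exact: sqr_ge0.
rewrite -[X in _ <= X]real_normK ?num_real // ler_sqr ?nnegrE ?normr_ge0 ?(ltW r0) //.
move: rxy; rewrite distrC; have -> : `|y - x| = mx_norm (x - y).
  by rewrite distrC.
by rewrite E ord1 !mxE (distrC (x 0 i)).
Qed.

Lemma sol_jet O f e h u0 (u : 'rV[R]_n -> R -> R) x t :
  open O -> classical_solution O f e h u0 u -> 0 < t -> O x ->
  jet u x t (derive1 (u x) t) (fun i => pder [:: i; i] (u ^~ t) x).
Proof.
move=> oO sol t0 Ox; apply: (jet_space oO Ox).
  by rewrite derive1E; exact: derivableP (sol_time_derivable sol t0 Ox).
by move=> s i y s2 Oy; exact: (sol_space_derivable sol).
Qed.

(** The strict inequality at the contact point persists nearby with a margin [c], as [u], [f] and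
    [om1] are continuous. *)
Lemma source_lower_bound O f e h u0 (u : 'rV[R]_n -> R -> R) x0 (t0 H : R)
    (om om1 : R -> R) :
  continuous f -> classical_solution O f e h u0 u ->
  closure O x0 -> 0 < t0 -> {for t0, continuous om1} ->
  u x0 t0 = om t0 -> om1 t0 < (e ^+ 2)^-1 * f (om t0) + e^-1 * H ->
  exists c r, [/\ 0 < c, 0 < r & forall x (t : R), closure O x -> `|x0 - x| < r ->
    `|t0 - t| < r -> c < (e ^+ 2)^-1 * f (u x t) + e^-1 * H - om1 t].
Proof.
move=> cf sol cx0 t00 com1 ut0 lt0.
pose k := (e ^+ 2)^-1.
have k0 : 0 <= k by rewrite invr_ge0 sqr_ge0.
pose c := (k * f (om t0) + e^-1 * H - om1 t0) / 3.
have c0 : 0 < c by rewrite divr_gt0 // subr_gt0.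
have k10 : 0 < c / (k + 1) by rewrite divr_gt0 //; lra.
have [rf rf0 Hf] := continuous_forP (cf (om t0)) k10.
have Kt0 : (closure O `*` `[0, +oo[%classic) (x0, t0).
  by split => //=; rewrite in_itv /= andbT ltW.
have [ru ru0 Hu] := (within_continuousP _ _).1 (sol_continuous sol) _ Kt0 _ rf0.
have [ro ro0 Ho] := continuous_forP com1 c0.
have [r1 [r10 r1u r1o]] := pos_lt2 ru0 ro0.
have [r [r0 rr1 rt]] := pos_lt2 r10 t00.
exists c, r; split=> // x t cx xr tr.
have t0' : 0 <= t by move: tr; rewrite ltr_norml; lra.
have U : `|om t0 - u x t| < rf.
  rewrite -ut0; apply: (Hu (x, t)); first by split => //=; rewrite in_itv /= andbT.
  by apply/norm_pair_lt; split=> /=; lra.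
have {}U := Hf _ U.
have : `|t0 - t| < ro by lra.
move/Ho; rewrite ltr_norml => /andP[Ho1 _].
have E : k * f (om t0) - k * f (u x t) < c.
  apply: (@le_lt_trans _ _ (k * (c / (k + 1)))).
    rewrite -mulrBr ler_wpM2l //; apply: le_trans (ler_norm _) _; exact: ltW.
  rewrite mulrA ltr_pdivrMr ?(ltr_wpDl k0 ltr01) //.
  by rewrite mulrDr mulr1 (mulrC k) ltrDl.
have Ec : 3 * c = k * f (om t0) + e^-1 * H - om1 t0 by rewrite /c; lra.
by rewrite -/k; move: E Ho1 Ec; clearbody c k => *; lra.
Qed.

(** [A] is chosen first, so that the quadratic and time terms use at most half of the margin [c].
    Then [d] is so small that [d * phi], of size [d * L], is beaten by [A * r] at the bottom and by
    [A * r ^+ 2] on the lateral side of the cylinder, and that [d] times the Laplacian of [phi] uses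
    less than the other half of [c]. *)
Lemma barrier_constants (c L r k : R) : 0 < c -> 0 < L -> 0 < r -> 0 <= k ->
  exists A d, [/\ 0 < A, 0 < d, A * (2 * k + 1) <= c / 2 &
    [/\ d * L < A * r, d * L < A * r ^+ 2 & d * L < c / 2]].
Proof.
move=> c0 L0 r_gt0 k0; pose A := c / (4 * k + 4).
have A0 : 0 < A by rewrite divr_gt0 //; lra.
have a1 : 0 < A * r / L by rewrite divr_gt0 // mulr_gt0.
have a2 : 0 < A * r ^+ 2 / L by rewrite divr_gt0 // mulr_gt0 // exprn_gt0.
have a3 : 0 < c / 2 / L by rewrite !divr_gt0.
have [d' [d'0 d'1 d'2]] := pos_lt2 a1 a2.
have [d [d0 dd' d3]] := pos_lt2 d'0 a3.
exists A, d; split=> //; last by split; rewrite -ltr_pdivlMr //; apply: lt_trans dd' _.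
rewrite /A mulrAC ler_pdivrMr; last lra.
by nra.
Qed.

(** At such a minimum the time derivative is at most 0 and the Laplacian at least 0. Inserting the
    equation for [u] leaves [c < d * L + A * (2 * n + 1)], against the choice of the constants. *)
Lemma barrier_interior O f e h u0 (u : 'rV[R]_n -> R -> R) x0 x1 (t0 t1 H : R)
    (om om1 : R -> R) U phi (A d c L r : R) :
  open O -> open U -> Ck_on 2 U phi -> 0 < e -> classical_solution O f e h u0 u ->
  0 < t1 -> O x1 -> U x1 -> is_derive t1 1 om (om1 t1) -> H <= h t1 ->
  c < (e ^+ 2)^-1 * f (u x1 t1) + e^-1 * H - om1 t1 ->
  `|laplacian phi x1| < L -> 0 < A -> 0 < d -> A * (2 * n%:R + 1) <= c / 2 ->
  d * L < c / 2 -> 0 < r ->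
  (forall y (s : R), `|x1 - y| < r -> t1 - r < s -> s <= t1 ->
    u x1 t1 - om t1 + d * phi x1 +
      A * (\sum_(i < n) (x1 0 i - x0 0 i) ^+ 2 + (t0 - t1)) <=
    u y s - om s + d * phi y +
      A * (\sum_(i < n) (y 0 i - x0 0 i) ^+ 2 + (t0 - s))) -> False.
Proof.
move=> oO oU C2 e0 sol t10 Ox1 Ux1 dom Hh Hc lap1 A0 d0 EA dL r_gt0 Hmin.
pose m x t := u x t - om t + d * phi x +
  A * (\sum_(i < n) (x 0 i - x0 0 i) ^+ 2 + (t0 - t)).
have jm : jet m x1 t1 (derive1 (u x1) t1 - om1 t1 - A)
   (fun i => pder [:: i; i] (u ^~ t1) x1 + d * pder [:: i; i] phi x1 + A * 2).
  have jo : jet (fun _ : 'rV[R]_n => om) x1 t1 (om1 t1) (fun=> 0).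
    exact: jet_time.
  have jp := jetZ d (jet_C2 t1 oU Ux1 C2).
  have jt : jet (fun _ : 'rV[R]_n => fun t => t0 - t) x1 t1 (- 1) (fun=> 0).
    by apply: jet_time; rewrite -(sub0r 1); exact: is_deriveB.
  have := jetD (jetD (jetB (sol_jet oO sol t10 Ox1) jo) jp)
    (jetZ A (jetD (jet_sqnorm x0 x1 t1) jt)).
  congr jet.
  - by rewrite /GRing.scale /=; ring.
  - by apply/funext => i; rewrite subr0 addr0.
have [ht hx] := jet_min jm r_gt0 Hmin.
have S : 0 <= \sum_(i < n) (pder [:: i; i] (u ^~ t1) x1 +
    d * pder [:: i; i] phi x1 + A * 2) by apply: sumr_ge0.
move: S; rewrite !big_split /= -mulr_sumr sumr_const card_ord.
move=> S; have {}S : 0 <= laplacian (u ^~ t1) x1 + d * laplacian phi x1 + A * 2 * n%:R.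
  by rewrite mulr_natr; exact: S.
have dlap : d * laplacian phi x1 < d * L.
  by rewrite ltr_pM2l //; move: lap1; rewrite ltr_norml => /andP[].
have hH : e^-1 * H <= e^-1 * h t1 by rewrite ler_pM2l ?invr_gt0.
move: ht; rewrite (sol_equation sol t10 Ox1).
move: Hc S dlap; set ff := _ * f _; set lu := laplacian _ _.
set lp := d * laplacian _ _; clearbody ff lu lp; clear - hH EA dL A0.
by move=> *; lra.
Qed.

End Boundary.

Section Hopf.
Context {R : realType} {n : nat}.
Implicit Types (x y v : 'rV[R]_n) (O U : set 'rV[R]_n) (phi : 'rV[R]_n -> R).

(** The strictness of the differential inequality replaces the interior ball and the strict ordering
    inside of the classical Hopf lemma: its margin absorbs the Laplacian of [d * phi]. So [m] below
    has no negative minimum on the cylinder, and at time [t0] this is the claim. *)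
Lemma hopf_barrier O f e h u0 (u : 'rV[R]_n -> R -> R) x0 (t0 r0 H : R)
    (om om1 : R -> R) U phi :
  smooth_bounded_domain O -> continuous f -> 0 < e ->
  classical_solution O f e h u0 u ->
  closure O x0 -> 0 < t0 -> 0 < r0 ->
  defining_function (@smooth_on R n) O x0 U phi ->
  (forall t : R, t0 - r0 < t -> t <= t0 -> H <= h t) ->
  (forall x (t : R), closure O x -> `|x0 - x| < r0 -> t0 - r0 < t -> t <= t0 ->
     om t <= u x t) ->
  (forall t : R, `|t0 - t| < r0 -> is_derive t 1 om (om1 t)) ->
  {for t0, continuous om1} ->
  u x0 t0 = om t0 -> om1 t0 < (e ^+ 2)^-1 * f (om t0) + e^-1 * H ->
  exists A d r, [/\ 0 < A, 0 < d, 0 < r & forall x, closure O x -> `|x0 - x| <= r ->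
    0 <= u x t0 - om t0 + d * phi x + A * \sum_i (x 0 i - x0 0 i) ^+ 2].
Proof.
move=> [_ oO _ bO _] cf e0 sol cx0 t00 r00 [oU Ux0 Sphi _ OU] Hh Hom dom com1 ut0 lt0.
have C2 := Sphi 2%N.
have [c [r1 [c0 r10 Hc]]] := source_lower_bound cf sol cx0 t00 com1 ut0 lt0.
have [L [r2 [r20 HL]]] := laplacian_bounded C2 Ux0.
have /nearP[r3 r30 HU] : \forall y \near x0, U y by exact: open_nbhs_nbhs.
have [r [r_gt0 [rlt0 rlt1 rlt2 rlt3 rt]]] : exists r, 0 < r /\
    [/\ r < r0, r < r1, r < r2, r < r3 & r < t0].
  have : all (fun a => 0 < a) [:: r0; r1; r2; r3; t0] by rewrite /= r00 r10 r20 r30 t00.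
  by move=> /pos_lt_seq[r rP /and5P[? ? ? ? /andP[? _]]]; exists r.
have L0 : 0 < L.
  have := HL x0; rewrite subrr normr0 => /(_ r20) [+ _]; exact: le_lt_trans.
have [A [d [A0 d0 EA [dL1 dL2 dL3]]]] := barrier_constants c0 L0 r_gt0 (ler0n R n).
exists A, d, r; split=> //.
pose Q x := \sum_(i < n) (x 0 i - x0 0 i) ^+ 2.
pose m x t := u x t - om t + d * phi x + A * (Q x + (t0 - t)).
pose K := closure O `&` [set x | `|x0 - x| <= r].
suff Hm : forall x (t : R), K x -> t \in `[t0 - r, t0]%R -> 0 <= m x t.
  move=> x cx xr; have := Hm x t0; rewrite /m subrr addr0; apply => //.
  by rewrite in_itv /= lexx andbT; clear - r_gt0; lra.
have cK : compact K.
  apply: compact_closedI; first exact: compact_bounded_closure.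
  have -> : [set x | `|x0 - x| <= r] = closed_ball_ (fun x : 'rV[R]_n => `|x|) x0 r.
    by [].
  exact: closed_closed_ball_.
have cKt : compact (K `*` `[t0 - r, t0]%classic).
  by apply: compact_setX => //; exact: segment_compact.
have Kne : (K `*` `[t0 - r, t0]%classic) !=set0.
  exists (x0, t0); split; first by split=> //=; rewrite subrr normr0 ltW.
  by rewrite /= in_itv /= lexx andbT; clear - r_gt0; lra.
have cQ x : {for x, continuous Q}.
  apply: continuous_bigsum => i.
  have cc : (fun z : 'rV[R]_n => z 0 i - x0 0 i) @ x --> x 0 i - x0 0 i.
    apply: (@cvgB R R _ (nbhs x) _ (fun z : 'rV[R]_n => z 0 i) (cst (x0 0 i))).
      exact: (@coord_continuous R 1 n 0 i x).
    exact: cvg_cst.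
  apply: (@cvg_comp _ _ _ (fun z : 'rV[R]_n => z 0 i - x0 0 i) (fun z => z ^+ 2));
    [exact: cc|exact: exprn_continuous].
have cm : {within K `*` `[t0 - r, t0]%classic, continuous (fun z => m z.1 z.2)}.
  have c1 : {within K `*` `[t0 - r, t0]%classic, continuous (fun z => u z.1 z.2)}.
    apply: continuous_subspaceW (sol_continuous sol) => -[x t] [[/= cx _]].
    rewrite /= !in_itv /= => tt; split => //=; rewrite ?in_itv /= ?andbT;
      clear - tt rt; lra.
  suff c2 : {within K `*` `[t0 - r, t0]%classic,
      continuous (fun z => - om z.2 + d * phi z.1 + A * (Q z.1 + (t0 - z.2)))}.
    have -> : (fun z => m z.1 z.2) = (fun z => u z.1 z.2) +
        (fun z => - om z.2 + d * phi z.1 + A * (Q z.1 + (t0 - z.2))).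
      by apply/funext => z; rewrite fctE /m !addrA.
    by move=> z; apply: continuousD _; [exact: c1|exact: c2].
  apply: continuous_in_subspaceT => -[x t]; rewrite inE => -[[/= cx xr]].
  rewrite /= in_itv /= => tt.
  have E1 : om z.2 @[z --> (x, t)] --> om t.
    apply: (@cvg_comp _ _ _ snd om (nbhs (x, t)) (nbhs t)); first exact: cvg_snd.
    have [dt _] : is_derive t 1 om (om1 t) by apply: dom; clear - tt rlt0; rewrite ltr_norml; lra.
    by move/derivable1_diffP/differentiable_continuous: dt.
  have E2 : phi z.1 @[z --> (x, t)] --> phi x.
    apply: (@cvg_comp _ _ _ fst phi (nbhs (x, t)) (nbhs x)); first exact: cvg_fst.
    by have [] := C2 [::] isT x; [apply: HU; exact: le_lt_trans rlt3|].
  have E3 : Q z.1 @[z --> (x, t)] --> Q x.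
    apply: (@cvg_comp _ _ _ fst Q (nbhs (x, t)) (nbhs x)); first exact: cvg_fst.
    exact: cQ.
  apply: cvgD.
    by apply: cvgD; [exact: cvgN|apply: cvgM => //; exact: cvg_cst].
  apply: cvgM; first exact: cvg_cst.
  by apply: cvgD => //; apply: cvgB; [exact: cvg_cst|exact: cvg_snd].
have [[x1 t1]] := compact_EVT_min Kne cKt cm.
rewrite inE => -[[/= cx1 x1r]]; rewrite /= in_itv /= => t1r Hmin.
suff m1 : 0 <= m x1 t1.
  move=> x t Kx tt; apply: le_trans m1 _.
  by apply: (Hmin (x, t)); rewrite inE; split.
rewrite leNgt; apply/negP => m1.
have Q0 x : 0 <= Q x by apply: sumr_ge0 => i _; exact: sqr_ge0.
have [phi1 lap1] : `|phi x1| < L /\ `|laplacian phi x1| < L by apply: HL; clear - x1r rlt2; lra.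
have dphi : - (d * L) < d * phi x1.
  by rewrite -mulrN ltr_pM2l //; move: phi1; rewrite ltr_norml => /andP[].
have v0 : 0 <= u x1 t1 - om t1.
  by rewrite subr_ge0; apply: Hom => //; clear - x1r t1r rlt0; lra.
have AQ : 0 <= A * Q x1 by rewrite mulr_ge0 // ltW.
have At : 0 <= A * (t0 - t1) by rewrite mulr_ge0 ?subr_ge0 ?(ltW A0) //; case/andP: t1r.
have Em : m x1 t1 = u x1 t1 - om t1 + d * phi x1 + A * Q x1 + A * (t0 - t1).
  by rewrite /m mulrDr addrA.
(* Outside [O] one has [0 <= phi], so every term of [m] is nonnegative. *)
have Ox1 : O x1.
  apply: contrapT => nO.
  have : ~ phi x1 < 0.
    move=> p; apply: nO; suff : (O `&` U) x1 by case.
    by rewrite OU; split => //; apply: HU; exact: le_lt_trans rlt3.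
  move=> /negP; rewrite -leNgt => p0.
  by have := mulr_ge0 (ltW d0) p0; clear - v0 AQ At Em m1; lra.
(* On the lateral side, and next at the bottom, the term with [A] outweighs [d * phi]. *)
have x1lt : `|x0 - x1| < r.
  rewrite ltNge; apply/negP => rx.
  have := not_ball_sqnorm r_gt0 rx; rewrite -/(Q x1).
  by rewrite -(ler_pM2l A0); clear - v0 At Em m1 dphi dL2; lra.
have t1lt : t0 - r < t1.
  rewrite ltNge; apply/negP => tr.
  have : A * r <= A * (t0 - t1) by rewrite ler_pM2l //; clear - tr; lra.
  by clear - v0 AQ Em m1 dphi dL1; lra.
have /nearP[r4 r40 HO] : \forall y \near x1, O y by exact: open_nbhs_nbhs.
have g1 : 0 < r - `|x0 - x1| by rewrite subr_gt0.
have g2 : 0 < t1 - (t0 - r) by rewrite subr_gt0.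
have [r' [r'0 r'1 r'2]] := pos_lt2 g1 g2.
have [r5 [r50 r54 r5']] := pos_lt2 r40 r'0.
apply: (barrier_interior (r := r5) oO oU C2 e0 sol (t1 := t1) (t0 := t0) (x0 := x0) (A := A)
  (d := d) (c := c) (L := L) (H := H) (om := om) (om1 := om1) _ Ox1) => //.
- by clear - t1lt rt; lra.
- exact/HU/(le_lt_trans x1r rlt3).
- by apply: dom; clear - t1lt t1r rlt0; rewrite ltr_norml; lra.
- by apply: Hh; clear - t1lt t1r rlt0; lra.
- by apply: Hc => //; clear - x1lt t1lt t1r rlt1; rewrite ?ltr_norml; lra.
- move=> y s y5 s1 s2; apply: (Hmin (y, s)); rewrite inE; split; last first.
    by rewrite /= in_itv /=; clear - s1 s2 r'2 r5' t1r; lra.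
  split => /=; first by apply/subset_closure/HO; exact: lt_trans r54.
  by have := ler_distD x1 x0 y; clear - y5 r5' r'1; lra.
Qed.
End Hopf.

Section Neumann.
Context {R : realType} {n : nat}.
Implicit Types (x y v : 'rV[R]_n) (O U : set 'rV[R]_n) (phi : 'rV[R]_n -> R).

Lemma dot_self_gt0 v : v != 0 -> 0 < dot v v.
Proof.
move=> v0; rewrite lt_neqAle; apply/andP; split; last first.
  by apply: sumr_ge0 => i _; rewrite -expr2 sqr_ge0.
apply: contra v0; rewrite eq_sym psumr_eq0; last first.
  by move=> i _; rewrite -expr2 sqr_ge0.
move=> /allP H; apply/eqP/rowP => i; rewrite mxE.
by have := H i (mem_index_enum i) => /=; rewrite mulf_eq0 orbb => /eqP.
Qed.

Lemma sqnorm_line x0 i (s : R) :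
  \sum_(j < n) ((s *: 'e_i + x0) 0 j - x0 0 j) ^+ 2 = s ^+ 2.
Proof.
rewrite (bigD1 i) //= big1 ?addr0 => [|j ji].
  by rewrite !mxE !eqxx mulr1 addrK.
by rewrite !mxE (negbTE ji) andbF mulr0 add0r subrr expr0n.
Qed.

Lemma norm_line x0 (i : 'I_n) (s s' : R) :
  `|(s *: 'e_i + x0) - (s' *: 'e_i + x0)| <= `|s - s'|.
Proof. by rewrite opprD addrACA subrr addr0 -scalerBl norm_scale_e. Qed.

(** At a boundary point only a continuous extension of the gradient is given. The mean value theorem
    on a segment that enters [O] relates differences of [u] from [x0] to gradients inside. *)
Lemma sol_line_MVT O f e h u0 (u : 'rV[R]_n -> R -> R) x0 (t0 s q : R) i :
  classical_solution O f e h u0 u -> 0 < t0 -> 0 < s -> closure O x0 ->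
  (forall c, 0 < c <= s -> O ((c * q) *: 'e_i + x0)) ->
  exists2 c, 0 < c < s & u ((s * q) *: 'e_i + x0) t0 - u x0 t0 =
    pder [:: i] (u ^~ t0) ((c * q) *: 'e_i + x0) * q * s.
Proof.
move=> sol t00 s0 cx0 Oq.
pose g (c : R) := u ((c * q) *: 'e_i + x0) t0.
have clq c : 0 <= c <= s -> closure O ((c * q) *: 'e_i + x0).
  move=> /andP[+ cs]; rewrite le_eqVlt => /predU1P[<-|c0].
    by rewrite mul0r scale0r add0r.
  by apply/subset_closure/Oq; rewrite c0.
have [|||c] := @MVT _ g (fun c => pder [:: i] (u ^~ t0) ((c * q) *: 'e_i + x0) * q) 0 s.
- exact: s0.
- move=> c; rewrite in_itv /= => /andP[c0 cs].
  apply: (@is_derive1_comp _ (fun c : R => u (c *: 'e_i + x0) t0) (fun c => c * q)).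
    apply: (@line_is_derive _ _ (u ^~ t0)).
    apply: (@sol_space_derivable _ _ _ _ _ _ _ _ sol t0 [::]) => //.
    by apply: Oq; rewrite c0 ltW.
  by apply: is_derive_eq; rewrite /GRing.scale /= mulr0 add0r mulr1.
- apply/within_continuousP => c; rewrite /= in_itv /= => cs eps eps0.
  have Kc : (closure O `*` `[0, +oo[%classic) ((c * q) *: 'e_i + x0, t0).
    by split => /=; [exact: clq|rewrite in_itv /= andbT ltW].
  have [r r0 Hr] := (within_continuousP _ _).1 (sol_continuous sol) _ Kc _ eps0.
  have q10 : 0 < `|q| + 1 by rewrite ltr_wpDl.
  exists (r / (`|q| + 1)); first by rewrite divr_gt0.
  move=> c'; rewrite /= in_itv /= => c's cc'.
  apply: (Hr (_, t0)); first by split => /=; [exact: clq|rewrite in_itv /= andbT ltW].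
  apply/norm_pair_lt; split; last by rewrite /= subrr normr0.
  apply: le_lt_trans (norm_line _ _ _ _) _; rewrite -mulrBl normrM.
  apply: (@le_lt_trans _ _ (`|c - c'| * (`|q| + 1))); last by rewrite -ltr_pdivlMr.
  by rewrite ler_wpM2l // lerDl.
rewrite in_itv /= subr0 => cs E; exists c => //.
by rewrite -E /g mul0r scale0r add0r.
Qed.

(* Estimates along the coordinate axes suffice, as they can be summed against
   grad phi; this avoids directional derivatives in the normal direction. *)
Lemma barrier_slope O f e h u0 (u : 'rV[R]_n -> R -> R) x0 (t0 A d r : R) U phi i
    (Du : 'rV[R]_n * R -> 'rV[R]_n) :
  classical_solution O f e h u0 u -> 0 < t0 -> closure O x0 -> phi x0 <= 0 ->
  defining_function (@smooth_on R n) O x0 U phi -> 0 < A -> 0 < d -> 0 < r ->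
  (forall x, closure O x -> `|x0 - x| <= r ->
    0 <= u x t0 - u x0 t0 + d * phi x + A * \sum_i (x 0 i - x0 0 i) ^+ 2) ->
  {within closure O `*` `]0, +oo[%classic, continuous Du} ->
  (forall (t : R) x, 0 < t -> O x -> Du (x, t) = grad (u ^~ t) x) ->
  Du (x0, t0) 0 i * pder [:: i] phi x0 <= - (d / 2) * pder [:: i] phi x0 ^+ 2.
Proof.
move=> sol t00 cx0 phi0 [oU Ux0 Sphi _ OU] A0 d0 r0 Hbar cDu DuE.
set p := pder [:: i] phi x0.
have [->|p0] := eqVneq p 0; first by rewrite expr0n !mulr0.
have np : 0 < `|p| by rewrite normr_gt0.
(* The orientation of the axis along which [phi] decreases, so that the segment from [x0] enters
   [O]. *)
pose q := - Num.sg p.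
have qp : q * p = - `|p| by rewrite /q mulNr -normrEsg.
have q1 : `|q| = 1 by rewrite /q normrN normr_sg p0.
have pq : p = - q * `|p| by rewrite /q opprK -numEsg.
have dphi : is_derive (0 : R) 1 (fun h : R => phi (h *: 'e_i + x0)) p.
  have := @line_is_derive _ _ phi x0 'e_i 0; rewrite scale0r add0r; apply.
  have [_ H] := Sphi 1%N [::] isT x0 Ux0; exact: H.
(* Of the slope [d * |p|] a quarter is lost to the linearisation of [phi], an eighth to the
   variation of [Du] and an eighth to the quadratic term; one half remains. *)
have p4 : 0 < `|p| / 4 by rewrite divr_gt0.
have [r1 r10 H1] := is_derive_cvg dphi p4.
have /nearP[r2 r20 HU] : \forall y \near x0, U y by exact: open_nbhs_nbhs.
have K0 : (closure O `*` `]0, +oo[%classic) (x0, t0).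
  by split => //=; rewrite in_itv /= andbT.
have dp8 : 0 < d * `|p| / 8 by rewrite divr_gt0 // mulr_gt0.
have [r3 r30 H3] := (within_continuousP _ _).1 cDu _ K0 _ dp8.
have dpA : 0 < d * `|p| / 8 / A by rewrite divr_gt0.
have : all (fun a => 0 < a) [:: r; r1; r2; r3; d * `|p| / 8 / A].
  by rewrite /= r0 r10 r20 r30 dpA.
move=> /pos_lt_seq[s s0 /and5P[sr s1 s2 s3 /andP[sA _]]].
have yx c : 0 < c <= s -> `|x0 - ((c * q) *: 'e_i + x0)| <= c.
  move=> /andP[c0 _]; rewrite -normrN opprB addrK.
  by apply: le_trans (norm_scale_e _ _) _; rewrite normrM q1 mulr1 gtr0_norm.
have phic c : 0 < c <= s -> phi ((c * q) *: 'e_i + x0) <= - (3 / 4 * `|p| * c).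
  move=> /andP[c0 cs].
  have nq : `|c * q| = c by rewrite normrM q1 mulr1 gtr0_norm.
  have := H1 (c * q); rewrite -normr_gt0 nq c0 => /(_ isT).
  have c1 : c < r1 by exact: le_lt_trans s1.
  rewrite addr0 scale0r add0r => /(_ c1) H.
  have : `|c * q * (p - (c * q)^-1 * (phi ((c * q) *: 'e_i + x0) - phi x0))| <= c * (`|p| / 4).
    by rewrite normrM nq ler_pM2l // ltW.
  have cq0 : c * q != 0 by rewrite -normr_gt0 nq.
  rewrite mulrBr (mulVKf cq0) -(mulrA c q p) qp ler_norml => /andP[+ _].
  by clear - phi0 => ?; lra.
have Oq c : 0 < c <= s -> O ((c * q) *: 'e_i + x0).
  move=> cs; suff : (O `&` U) ((c * q) *: 'e_i + x0) by case.
  rewrite OU; split.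
    by apply: HU; apply: le_lt_trans (yx _ cs) _; case/andP: cs => _ /le_lt_trans; apply.
  apply: le_lt_trans (phic _ cs) _; rewrite oppr_lt0 !mulr_gt0 //; by case/andP: cs.
have [c cs E] := sol_line_MVT sol t00 s0 cx0 Oq.
have cs' : 0 < c <= s by case/andP: cs => -> /ltW ->.
have ss : 0 < s <= s by rewrite s0 lexx.
have := Hbar _ (subset_closure (Oq s ss)) (le_trans (yx _ ss) (ltW sr)).
rewrite sqnorm_line E exprMn -(real_normK (num_real q)) q1 expr1n mulr1 expr2.
set D1 := pder _ _ _ => HB.
have HD1 : `|Du (x0, t0) 0 i - D1| < d * `|p| / 8.
  have -> : D1 = Du ((c * q) *: 'e_i + x0, t0) 0 i.
    by rewrite DuE ?mxE //; exact: Oq.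
  have Ky : (closure O `*` `]0, +oo[%classic) ((c * q) *: 'e_i + x0, t0).
    by split => /=; [exact/subset_closure/Oq|rewrite in_itv /= andbT].
  have yr : `|(x0, t0) - ((c * q) *: 'e_i + x0, t0)| < r3.
    apply/norm_pair_lt; split; last by rewrite /= subrr normr0.
    by apply: le_lt_trans (yx _ cs') _; case/andP: cs' => _ /le_lt_trans; apply.
  apply: le_lt_trans (H3 _ Ky yr).
  by have := rV_coord_le (Du (x0, t0) - Du ((c * q) *: 'e_i + x0, t0)) i; rewrite !mxE.
have sA' : A * s < d * `|p| / 8 by rewrite mulrC -ltr_pdivlMr.
have HB2 : 0 <= D1 * q - 3 / 4 * d * `|p| + A * s.
  rewrite -(pmulr_lge0 _ s0); apply: le_trans HB _.
  have : d * phi ((s * q) *: 'e_i + x0) <= d * - (3 / 4 * `|p| * s).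
    by rewrite ler_pM2l // phic.
  by clear => ?; lra.
have HD2 : D1 * q <= Du (x0, t0) 0 i * q + d * `|p| / 8.
  have : `|(Du (x0, t0) 0 i - D1) * q| <= d * `|p| / 8 by rewrite normrM q1 mulr1 ltW.
  by rewrite mulrBl ler_norml => /andP[+ _]; clear => ?; lra.
have HD3 : d / 2 * `|p| <= Du (x0, t0) 0 i * q by clear - HD2 HB2 sA'; lra.
have -> : p ^+ 2 = `|p| * `|p| by rewrite -expr2 real_normK ?num_real.
have aux (X P q' p' : R) : p' = - q' * P -> X * p' = - (X * q') * P.
  by move=> ->; ring.
rewrite (aux _ _ _ _ pq) mulrA ler_pM2r //.
by clear - HD3; lra.
Qed.

(** Summed over the axes, the slopes make the product of [Du] with [grad phi] negative, while the
    Neumann condition makes it 0. *)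
Lemma hopf_boundary O f e h u0 (u : 'rV[R]_n -> R -> R) x0 (t0 r0 H : R)
    (om om1 : R -> R) :
  smooth_bounded_domain O -> continuous f -> 0 < e ->
  classical_solution O f e h u0 u ->
  boundary O x0 -> 0 < t0 -> 0 < r0 ->
  (forall t : R, t0 - r0 < t -> t <= t0 -> H <= h t) ->
  (forall x (t : R), closure O x -> `|x0 - x| < r0 -> t0 - r0 < t -> t <= t0 ->
     om t <= u x t) ->
  (forall t : R, `|t0 - t| < r0 -> is_derive t 1 om (om1 t)) ->
  {for t0, continuous om1} ->
  u x0 t0 = om t0 -> om1 t0 < (e ^+ 2)^-1 * f (om t0) + e^-1 * H -> False.
Proof.
move=> hO cf e0 sol bx0 t00 r00 Hh Hom dom com1 ut0 lt0.
have [_ oO _ _ smO] := hO.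
have [cx0 nOx0] := boundary_open oO bx0.
have [U [phi dphi]] := smO x0 bx0.
have [oU Ux0 Sphi gphi OU] := dphi.
have [A [d [r [A0 d0 r_gt0 Hbar]]]] :=
  hopf_barrier hO cf e0 sol cx0 t00 r00 dphi Hh Hom dom com1 ut0 lt0.
have phi0 : phi x0 <= 0.
  apply: (closure_le oU Ux0 cx0); first by have [] := Sphi 0%N [::] isT x0 Ux0.
  move=> y Oy Uy; have : (O `&` U) y by [].
  by rewrite OU => -[_ /ltW].
have nv : outward_unit_normal O x0 ((enorm (grad phi x0))^-1 *: grad phi x0).
  by split=> //; exists U, phi; split => //; split => //; exact: Sphi.
have [Du [cDu DuE /(_ _ _ _ t00 nv)]] := sol_neumann sol.
have g0 := dot_self_gt0 (gphi _ Ux0).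
have {}Hbar x : closure O x -> `|x0 - x| <= r ->
    0 <= u x t0 - u x0 t0 + d * phi x + A * \sum_i (x 0 i - x0 0 i) ^+ 2.
  by rewrite ut0; exact: Hbar.
have : dot (Du (x0, t0)) (grad phi x0) <= - (d / 2) * dot (grad phi x0) (grad phi x0).
  rewrite /dot mulr_sumr; apply: ler_sum => i _.
  have := barrier_slope i sol t00 cx0 phi0 dphi A0 d0 r_gt0 Hbar cDu DuE.
  have <- : grad phi x0 0 i = pder [:: i] phi x0 by rewrite mxE.
  by rewrite expr2.
have -> : dot (Du (x0, t0)) ((enorm (grad phi x0))^-1 *: grad phi x0) =
    (enorm (grad phi x0))^-1 * dot (Du (x0, t0)) (grad phi x0).
  by rewrite /dot mulr_sumr; apply: eq_bigr => i _; rewrite [in LHS]mxE mulrCA.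
move=> D1 /eqP; rewrite mulf_eq0 invr_eq0 gt_eqF ?sqrtr_gt0 //= => /eqP D0.
move: D1; rewrite D0 mulNr oppr_ge0 leNgt mulr_gt0 //; exact: divr_gt0.
Qed.

End Neumann.

Section Comparison.
Context {R : realType} {n : nat}.
Implicit Types (x y v : 'rV[R]_n) (O U : set 'rV[R]_n).

Definition strict_sub_jet (w : 'rV[R]_n -> R -> R) (f : R -> R) (e H : R) x t : Prop :=
  exists wt q, jet w x t wt q /\
    wt < \sum_(i < n) q i + (e ^+ 2)^-1 * f (w x t) + e^-1 * H.

(** Dependence on time alone, near the point and up to the contact time, spares any normal
    derivative of [w]. *)
Definition strict_sub_boundary O (w : 'rV[R]_n -> R -> R) (f : R -> R) (e H : R)
    x0 (t0 : R) : Prop :=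
  exists (r : R) (om om1 : R -> R), [/\ 0 < r,
    forall x (t : R), closure O x -> `|x0 - x| < r -> t0 - r < t -> t <= t0 ->
      w x t = om t,
    forall t : R, `|t0 - t| < r -> is_derive t 1 om (om1 t),
    {for t0, continuous om1} &
    om1 t0 < (e ^+ 2)^-1 * f (w x0 t0) + e^-1 * H].

(** The conditions on [w] are imposed only where [w] meets [u]; this admits truncated functions. A
    constant lower bound [H] stands in for the noise. *)
Lemma comparison O f e h u0 (u w : 'rV[R]_n -> R -> R) (T H th : R) :
  smooth_bounded_domain O -> continuous f -> 0 < e ->
  classical_solution O f e h u0 u -> 0 <= T ->
  (forall t, 0 < t <= T -> H <= h t) ->
  {within closure O `*` `[0, T]%classic, continuous (fun z => w z.1 z.2)} ->
  0 < th -> (forall x, O x -> w x 0 + th <= u0 x) ->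
  (forall x (t : R), O x -> 0 < t <= T -> w x t = u x t -> strict_sub_jet w f e H x t) ->
  (forall x (t : R), boundary O x -> 0 < t <= T -> w x t = u x t ->
    strict_sub_boundary O w f e H x t) ->
  forall x (t : R), closure O x -> 0 <= t <= T -> w x t < u x t.
Proof.
move=> hO cf e0 sol T0 Hh cw th0 w0 wint wbd.
have [_ oO _ bO _] := hO.
have cu : {within closure O `*` `[0, T]%classic, continuous (fun z => u z.1 z.2)}.
  apply: continuous_subspaceW (sol_continuous sol) => -[x t] [/= cx].
  rewrite /= ?in_itv /= => /andP[t0 _]; split => //=.
  by rewrite ?in_itv /= ?andbT.
pose D x t := u x t - w x t.
suff HD : forall x (t : R), closure O x -> 0 <= t <= T -> 0 < D x t.
  by move=> x t cx tT; rewrite -subr_gt0; exact: HD.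
have cD : {within closure O `*` `[0, T]%classic, continuous (fun z => D z.1 z.2)}.
  have -> : (fun z => D z.1 z.2) = (fun z => u z.1 z.2) - (fun z => w z.1 z.2) by [].
  by move=> z; apply: continuousB _; [exact: cu|exact: cw].
(* The initial condition is known on [O] only; the margin [th] carries strictness over to the
   closure. *)
apply: (first_touch (compact_bounded_closure bO) cD) => [x cx|x0 t0 cx0 t0T Dx0 Dpos].
  have K0 : (closure O `*` `[0, T]%classic) (x, 0).
    by split; rewrite /= ?in_itv /= ?lexx.
  have th2 : 0 < th / 2 by rewrite divr_gt0.
  have [r r0 Hr] := (within_continuousP _ _).1 cD _ K0 _ th2.
  have [|y [Oy]] := cx (ball x r); first exact: nbhsx_ballx.
  rewrite -ball_normE /= => xy.
  have Ky : (closure O `*` `[0, T]%classic) (y, 0).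
    by split; rewrite /= ?in_itv /= ?lexx //; exact: subset_closure.
  have /= := Hr (y, 0) Ky; rewrite norm_pair_lt subrr normr0 => /(_ (conj xy r0)).
  have : th <= D y 0 by rewrite /D (sol_initial sol Oy) lerBrDl w0.
  by rewrite ltr_norml => ? /andP[? ?]; lra.
have uw : w x0 t0 = u x0 t0 by apply/esym/eqP; rewrite -subr_eq0; exact/eqP.
have [t00 t0T'] := andP t0T.
have wu y s : closure O y -> 0 <= s <= t0 -> w y s <= u y s.
  by move=> cy st; rewrite -subr_ge0; exact: Dpos.
have [Ox0|nOx0] := pselect (O x0).
  have [wt [q [jw lt]]] := wint x0 t0 Ox0 t0T uw.
  have jD := jetB (sol_jet oO sol t00 Ox0) jw.
  have /nearP[r1 r10 HO] : \forall y \near x0, O y by exact: open_nbhs_nbhs.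
  have [r [r0 rr1 rt0]] := pos_lt2 r10 t00.
  have [|ht hx] := jet_min jD r0.
    move=> y s xy s1 s2; rewrite uw subrr subr_ge0; apply: wu.
      by apply/subset_closure/HO; exact: lt_trans rr1.
    by rewrite s2 andbT; clear - s1 rt0; lra.
  have : 0 <= laplacian (u ^~ t0) x0 - \sum_i q i.
    by rewrite /laplacian -sumrB; apply: sumr_ge0 => i _; exact: hx.
  have hH : e^-1 * H <= e^-1 * h t0 by rewrite ler_pM2l ?invr_gt0 //; exact: Hh.
  move: ht lt; rewrite (sol_equation sol t00 Ox0) uw.
  by clear - hH; move=> *; lra.
have bx0 : boundary O x0.
  by split => //; move: nOx0; have /interior_id -> := oO.
have [r [om [om1 [r0 Ew dom com1 lt]]]] := wbd x0 t0 bx0 t0T uw.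
have [r' [r'0 r'r r't]] := pos_lt2 r0 t00.
have Eom : w x0 t0 = om t0 by apply: Ew => //; rewrite ?subrr ?normr0 // ltrBlDr ltrDl.
apply: (hopf_boundary hO cf e0 sol bx0 t00 r'0 (H := H) (om := om) (om1 := om1)) => //.
- by move=> t t1 t2; apply: Hh; clear - t1 t2 r't t0T'; lra.
- move=> x t cx xr t1 t2; rewrite -(Ew x t) //; first by apply: wu => //; lra.
    exact: lt_trans r'r.
  by clear - t1 r'r; lra.
- by move=> t tr; apply: dom; exact: lt_trans r'r.
- by rewrite -uw.
- by rewrite -Eom.
Qed.

End Comparison.

(** * Comparison functions *)

Section Profile.
Context {R : realType}.
Implicit Types (B Z z : R).

(* Increases from -oo at z = - Z / (1 + B Z) to ln (1 + B Z) / B at +oo. *)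
Definition profile B Z z : R := (ln ((1 + B * Z) * z + Z) - ln (z + Z)) / B.
Definition profile1 B Z z : R := Z ^+ 2 / (((1 + B * Z) * z + Z) * (z + Z)).
Definition profile2 B Z z : R :=
  - profile1 B Z z * ((1 + B * Z) / ((1 + B * Z) * z + Z) + (z + Z)^-1).

Lemma profile_dom B Z z : 0 < B -> 0 < Z -> 0 < (1 + B * Z) * z + Z -> 0 < z + Z.
Proof.
move=> B0 Z0; have BZ : 0 < B * Z by rewrite mulr_gt0.
have [z0|z0] := leP 0 z; first by move=> _; lra.
have : B * Z * z < 0 by rewrite pmulr_rlt0.
by clear => ? ?; lra.
Qed.

Lemma profile_derive B Z z : 0 < B -> 0 < Z -> 0 < (1 + B * Z) * z + Z ->
  is_derive z 1 (profile B Z) (profile1 B Z z).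
Proof.
move=> B0 Z0 z1; have z2 := profile_dom B0 Z0 z1.
have l1 : is_derive z 1 (fun z => ln ((1 + B * Z) * z + Z))
    (((1 + B * Z) * z + Z)^-1 * (1 + B * Z)).
  apply: (@is_derive1_comp _ (@ln R) (fun z => (1 + B * Z) * z + Z)).
    exact: is_derive1_ln.
  by apply: is_derive_eq; rewrite /GRing.scale /=; ring.
have l2 : is_derive z 1 (fun z => ln (z + Z)) ((z + Z)^-1 * 1).
  apply: (@is_derive1_comp _ (@ln R) (fun z => z + Z)).
    exact: is_derive1_ln.
  by apply: is_derive_eq; rewrite addr0.
rewrite /profile; apply: is_derive_eq.
rewrite /GRing.scale /= /profile1; field.
by rewrite !gt_eqF.
Qed.

Lemma profile1_derive B Z z : 0 < B -> 0 < Z -> 0 < (1 + B * Z) * z + Z ->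
  is_derive z 1 (profile1 B Z) (profile2 B Z z).
Proof.
move=> B0 Z0 z1; have z2 := profile_dom B0 Z0 z1.
have nz : ((1 + B * Z) * z + Z) * (z + Z) != 0 by rewrite mulf_neq0 ?gt_eqF.
rewrite /profile1; apply: is_derive_eq.
rewrite /GRing.scale /= /profile2 /profile1; field.
by rewrite !gt_eqF.
Qed.

Lemma profile1_gt0 B Z z : 0 < B -> 0 < Z -> 0 < (1 + B * Z) * z + Z ->
  0 < profile1 B Z z.
Proof.
move=> B0 Z0 z1; have z2 := profile_dom B0 Z0 z1.
by rewrite divr_gt0 ?exprn_gt0 ?mulr_gt0.
Qed.

Lemma expR_profile B Z z : 0 < B -> 0 < Z -> 0 < (1 + B * Z) * z + Z ->
  expR (B * profile B Z z) = ((1 + B * Z) * z + Z) / (z + Z).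
Proof.
move=> B0 Z0 z1; have z2 := profile_dom B0 Z0 z1.
rewrite /profile mulrC divfK ?gt_eqF // expRB !lnK //.
Qed.

(** Exponentiated, the left side is 1 + B Z z / (z + Z), which is at most 1 + B z and hence at most
    exp (B z). *)
Lemma profile_le B Z z : 0 < B -> 0 < Z -> 0 < (1 + B * Z) * z + Z ->
  profile B Z z <= z.
Proof.
move=> B0 Z0 z1; have z2 := profile_dom B0 Z0 z1.
rewrite -(ler_pM2l B0) -ler_expR expR_profile //.
apply: le_trans (expR_ge1Dx _); rewrite ler_pdivrMr //.
have : 0 <= B * z ^+ 2 by rewrite mulr_ge0 ?sqr_ge0 // ltW.
by rewrite expr2 => ?; lra.
Qed.

(** The profile takes the value y exactly where z + Z = B Z^2 / (1 + B Z - exp (B y)). *)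
Lemma ge_profile B Z z y : 0 < B -> 0 < Z -> 0 < (1 + B * Z) * z + Z ->
  expR (B * y) < 1 + B * Z ->
  B * Z ^+ 2 / (1 + B * Z - expR (B * y)) <= z + Z -> y <= profile B Z z.
Proof.
move=> B0 Z0 z1 y1; have z2 := profile_dom B0 Z0 z1.
rewrite ler_pdivrMr ?subr_gt0 // => H.
rewrite -(ler_pM2l B0) -ler_expR expR_profile // ler_pdivlMr //.
by move: H; rewrite expr2; lra.
Qed.

Lemma profile_lt B p Z z : 0 < B -> 0 < Z -> 0 < (1 + B * Z) * z + Z ->
  expR (B * p) = 1 + B * Z -> profile B Z z < p.
Proof.
move=> B0 Z0 z1 E; have z2 := profile_dom B0 Z0 z1.
rewrite -(ltr_pM2l B0) -ltr_expR expR_profile // E ltr_pdivrMr //.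
have : 0 < B * Z * Z by rewrite !mulr_gt0.
lra.
Qed.

(* The flow z' = mu z is slower than the reaction on the graph of the profile,
   and the quadratic gap absorbs a small constant perturbation. *)
Lemma profile_subsolution B Z z (mu k e F : R) :
  0 < B -> 0 < Z -> 0 < (1 + B * Z) * z + Z ->
  0 < mu -> 0 <= e -> 2 * (1 + B * Z) * e <= mu * Z -> 2 * (1 + B * Z) <= mu * k ->
  mu * (1 - expR (- (B * profile B Z z))) / B <= F ->
  profile1 B Z z * (mu * (z - k * e)) <= F - e.
Proof.
move=> B0 Z0 z1 mu0 e0 He Hk; have z2 := profile_dom B0 Z0 z1.
rewrite expRN expR_profile // => HF.
suff : profile1 B Z z * (mu * (z - k * e)) <=
    mu * (1 - (((1 + B * Z) * z + Z) / (z + Z))^-1) / B - e by lra.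
(* Over the common denominator the gap is mu Z z^2 + mu k e Z^2, to be compared with e times that
   denominator. *)
have -> : mu * (1 - (((1 + B * Z) * z + Z) / (z + Z))^-1) / B =
    mu * (z * Z) * (z + Z) / (((1 + B * Z) * z + Z) * (z + Z)).
  by field; rewrite !gt_eqF.
rewrite /profile1 lerBrDr mulrAC -[X in _ + X <= _](@mulfK _ (((1 + B * Z) * z + Z) * (z + Z)));
  last by rewrite mulf_neq0 ?gt_eqF.
rewrite -mulrDl ler_pM2r ?invr_gt0 ?mulr_gt0 //.
set P := 1 + B * Z in z1 He Hk *.
have P1 : 1 < P by rewrite /P ltrDl mulr_gt0.
clearbody P.
(* Both sides of the comparison are now controlled by z^2 and Z^2; [He] pays for the former, [Hk]
   for the latter. *)
have q1 : (P * z + Z) * (z + Z) <= 2 * P * (z ^+ 2 + Z ^+ 2).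
  have : 0 <= P * (z - Z) ^+ 2 by rewrite mulr_ge0 ?sqr_ge0 //; lra.
  have : (P * z + Z) * (z + Z) <= P * (z + Z) ^+ 2.
    by rewrite expr2 mulrA ler_pM2r // mulrDr lerD2l; apply: ler_peMl; exact: ltW.
  by rewrite !expr2; lra.
have q2 : e * ((P * z + Z) * (z + Z)) <= e * (2 * P * (z ^+ 2 + Z ^+ 2)) by rewrite ler_wpM2l.
have q3 : 2 * P * e * z ^+ 2 <= mu * Z * z ^+ 2 by rewrite ler_wpM2r ?sqr_ge0.
have q4 : 2 * P * (e * Z ^+ 2) <= mu * k * (e * Z ^+ 2).
  by rewrite ler_wpM2r // mulr_ge0 ?sqr_ge0.
move: q1 q2 q3 q4; rewrite !expr2; clear; lra.
Qed.

End Profile.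

(** * The subsolution that generates the interface *)

Section Generation.
Context {R : realType} {n : nat}.
Implicit Types (x y : 'rV[R]_n) (O : set 'rV[R]_n).

(** In this form the regularity of the initial function passes through the cap and the profile by
    the chain rule in one variable. *)
Definition bounded_jet (G : R) (v : 'rV[R]_n -> R) x : Prop :=
  forall i, exists (v1 : R -> R) (q : R), [/\
    (\forall s \near (0 : R), is_derive (s : R) 1 (fun s => v (s *: 'e_i + x)) (v1 s)),
    is_derive (0 : R) 1 v1 q, `|v1 0| <= G & `|q| <= G].

Definition stretch (mu e : R) (t : R) : R := expR (mu * (e ^+ 2)^-1 * t).

(* The time derivative is mu (z - k e) / e^2 - mu r (stretch mu e t)^2: the term
   in r pays for the Laplacian, the term in k for the noise. *)
Definition stretched (mu e r k c : R) (t : R) : R :=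
  stretch mu e t * (c - r * e ^+ 2 * stretch mu e t - k * e) + k * e.

Lemma stretch_ge1 (mu e t : R) : 0 < mu -> 0 < e -> 0 <= t -> 1 <= stretch mu e t.
Proof.
move=> mu0 e0 t0; rewrite -expR0 ler_expR mulr_ge0 // mulr_ge0 ?invr_ge0 ?sqr_ge0 //.
exact: ltW.
Qed.

Lemma stretch_derive (mu e t : R) :
  is_derive t 1 (stretch mu e) (mu * (e ^+ 2)^-1 * stretch mu e t).
Proof.
rewrite [X in is_derive _ _ _ X]mulrC /stretch.
apply: (@is_derive1_comp _ (@expR R) (fun t => mu * (e ^+ 2)^-1 * t)).
by apply: is_derive_eq; rewrite /GRing.scale /= mulr1.
Qed.

Definition stretched1 (mu e r k c t : R) : R :=
  mu * (e ^+ 2)^-1 * (stretched mu e r k c t - k * e) - mu * r * stretch mu e t ^+ 2.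

Lemma stretched_derive (mu e r k c t : R) : 0 < e ->
  is_derive t 1 (stretched mu e r k c) (stretched1 mu e r k c t).
Proof.
move=> e0; have dS := stretch_derive mu e t.
rewrite /stretched; apply: is_derive_eq.
rewrite /stretched1 /stretched /GRing.scale /= expr2; field.
by rewrite gt_eqF.
Qed.

Lemma continuous_stretched1 (mu e r k c : R) : 0 < e ->
  continuous (stretched1 mu e r k c).
Proof.
move=> e0 t.
have c1 : stretched mu e r k c @ t --> stretched mu e r k c t.
  have [+ _] := stretched_derive mu r k c t e0.
  by move=> /derivable1_diffP/differentiable_continuous.
have c2 : stretch mu e @ t --> stretch mu e t.
  have [+ _] := stretch_derive mu e t.
  by move=> /derivable1_diffP/differentiable_continuous.
apply: cvgB; first by apply: cvgM; [exact: cvg_cst|apply: cvgB => //; exact: cvg_cst].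
by apply: cvgM; [exact: cvg_cst|exact: (cvgM c2 c2)].
Qed.

(* The profile equals - K at zlow; the comparison function is constant below. *)
Definition zlow (B Z K : R) : R := - Z * (1 - expR (- (B * K))) / (1 + B * Z - expR (- (B * K))).

Lemma zlow_identities (B Z Q : R) : 1 + B * Z - Q != 0 ->
  let z := - Z * (1 - Q) / (1 + B * Z - Q) in
  (1 + B * Z) * z + Z = B * Z ^+ 2 * Q / (1 + B * Z - Q) /\
  z + Z = B * Z ^+ 2 / (1 + B * Z - Q).
Proof. by move=> D0 z; rewrite /z; split; field. Qed.

(** The bound by [- B^-1] is uniform in [K] because already the singularity - Z / (1 + B Z) lies
    above it. It decides which boundary values leave the profile inactive. *)
Lemma zlowP (B Z K : R) : 0 < B -> 0 < Z -> 0 < K ->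
  [/\ 0 < (1 + B * Z) * zlow B Z K + Z, - B^-1 < zlow B Z K &
      profile B Z (zlow B Z K) = - K].
Proof.
move=> B0 Z0 K0; have BZ : 0 < B * Z by rewrite mulr_gt0.
have Q1 : expR (- (B * K)) < 1 by rewrite -expR0 ltr_expR oppr_lt0 mulr_gt0.
have Q0 := expR_gt0 (- (B * K)).
have D0 : 0 < 1 + B * Z - expR (- (B * K)) by lra.
have [E1 E2] := zlow_identities (lt0r_neq0 D0).
have z1 : 0 < (1 + B * Z) * zlow B Z K + Z.
  by rewrite E1 divr_gt0 // !mulr_gt0 ?exprn_gt0.
split=> //.
  have H1 : 0 < B * ((1 + B * Z) * zlow B Z K + Z) by rewrite mulr_gt0.
  rewrite -(ltr_pM2l B0) mulrN divff ?gt_eqF //.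
  have H2 : 0 < (1 + B * Z) * (B * zlow B Z K + 1) by lra.
  by rewrite pmulr_rgt0 in H2; lra.
apply: (mulfI (lt0r_neq0 B0)); apply: expR_inj; rewrite expR_profile //.
rewrite mulrN E1 E2; move: Q0 D0; set Q := expR _; move: Q => Q Q0 D0.
by field; rewrite !gt_eqF.
Qed.

(** The ratio of [profile2] to [profile1] is at least [- ((2 + B * Z) / d)], and [al <= al ^+ 2]. So
    a pure second derivative of the comparison function costs at most a multiple of [profile1] times
    the square of the stretch, the shape of the term in [r]. *)
Lemma profile_jet_bound (B Z z d v q G al : R) : 0 < B -> 0 < Z -> 0 < d ->
  d <= (1 + B * Z) * z + Z -> d <= z + Z -> 1 <= al -> `|v| <= G -> `|q| <= G ->
  - (profile1 B Z z * al ^+ 2 * ((2 + B * Z) / d * G ^+ 2 + G)) <=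
  profile2 B Z z * (al * v) ^+ 2 + profile1 B Z z * (al * q).
Proof.
move=> B0 Z0 d0 z1 z2 al1 vG qG.
have z1' : 0 < (1 + B * Z) * z + Z by exact: lt_le_trans z1.
have z2' : 0 < z + Z by exact: lt_le_trans z2.
have p0 := profile1_gt0 B0 Z0 z1'.
rewrite /profile2; move: (profile1 B Z z) p0 => P1 p0.
set C := (1 + B * Z) / _ + _.
have C0 : 0 <= C.
  by rewrite addr_ge0 ?invr_ge0 ?divr_ge0 ?(ltW z1') ?(ltW z2') //; nra.
have CP : C <= (2 + B * Z) / d.
  have BZ : 0 < B * Z by rewrite mulr_gt0.
  have -> : (2 + B * Z) / d = (1 + B * Z) / d + d^-1 by field; rewrite gt_eqF.
  rewrite lerD // ?lef_pV2 ?posrE // ler_pM2l ?lef_pV2 ?posrE //; lra.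
have G0 : 0 <= G by exact: le_trans vG.
have v2 : v ^+ 2 <= G ^+ 2.
  by rewrite -[v ^+ 2]real_normK ?num_real // ler_sqr ?nnegrE.
have H1 : C * v ^+ 2 <= (2 + B * Z) / d * G ^+ 2 by rewrite ler_pM ?sqr_ge0.
have al2 : al <= al ^+ 2 by rewrite expr2 ler_peMl //; lra.
have H2 : al ^+ 2 * (C * v ^+ 2) <= al ^+ 2 * ((2 + B * Z) / d * G ^+ 2).
  by rewrite ler_wpM2l // sqr_ge0.
have H3 : - (al ^+ 2 * G) <= al * q.
  move: qG; rewrite ler_norml => /andP[qG _].
  apply: (@le_trans _ _ (al * - G)); last by rewrite ler_pM2l //; lra.
  by rewrite mulrN lerN2 ler_wpM2r.
set W := (2 + B * Z) / d * G ^+ 2 in H2 *; clearbody C W.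
have fin : - (al ^+ 2 * (W + G)) <= - (C * (al * v) ^+ 2) + al * q.
  by rewrite exprMn; clear - H2 H3; lra.
by have := ler_wpM2l (ltW p0) fin; clear => ?; lra.
Qed.

Lemma max_continuous_l (c : R) : continuous (fun a => Num.max a c).
Proof.
move=> x; apply/cvgrPdist_lt => e e0; apply/nearP; exists e => // y xy; have {}xy : `|x - y| < e by [].
have [xc|xc] := leP x c; have [yc|yc] := leP y c; rewrite ?subrr ?normr0 //.
- by move: xy; rewrite !ltr_norml; lra.
- by move: xy; rewrite !ltr_norml; lra.
Qed.

Lemma truncated_profile_derive (B Z zl b : R) (g : R -> R) (g1 t : R) :
  0 < B -> 0 < Z -> (forall z, zl < z -> 0 < (1 + B * Z) * z + Z) ->
  (\forall s \near t, zl < g s) -> is_derive t 1 g g1 ->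
  is_derive t 1 (fun s => b + profile B Z (Num.max (g s) zl)) (profile1 B Z (g t) * g1).
Proof.
move=> B0 Z0 dom zg dg.
have pd := profile_derive B0 Z0 (dom _ (nbhs_singleton zg)).
apply: (@near_eq_is_derive _ _ _ (fun s => b + (profile B Z \o g) s)).
  by near=> s; rewrite /= max_l // ltW //; near: s.
rewrite -[X in is_derive _ _ _ X]add0r.
apply: (@is_deriveD _ _ _ (cst b) (profile B Z \o g)).
Unshelve. all: end_near. Qed.

Lemma truncated_profile_line (B Z zl b : R) (g g1 : R -> R) (q : R) :
  0 < B -> 0 < Z -> (forall z, zl < z -> 0 < (1 + B * Z) * z + Z) ->
  (\forall s \near (0 : R), is_derive (s : R) 1 g (g1 s)) -> is_derive (0 : R) 1 g1 q ->
  zl < g 0 ->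
  exists2 w1 : R -> R, (\forall s \near (0 : R), is_derive (s : R) 1
      (fun s => b + profile B Z (Num.max (g s) zl)) (w1 s)) &
    is_derive (0 : R) 1 w1 (profile2 B Z (g 0) * g1 0 ^+ 2 + profile1 B Z (g 0) * q).
Proof.
move=> B0 Z0 dom dg dg1 zg0.
have dg0 : is_derive (0 : R) 1 g (g1 0) by exact: (nbhs_singleton dg).
have /nearP[r1 r10 H1] : \forall s \near (0 : R), zl < g s.
  have [dd _] := dg0.
  have cg : {for 0, continuous g} by exact/differentiable_continuous/derivable1_diffP.
  exact: (cvgr_gt _ cg).
exists (fun s => profile1 B Z (g s) * g1 s).
  have /nearP[r2 r20 H2] := dg.
  have [r [r0 rr1 rr2]] := pos_lt2 r10 r20.
  apply/nearP; exists r => // s sr; apply: truncated_profile_derive => //; last first.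
    by apply: H2; exact: lt_trans rr2.
  apply/nearP; exists (r1 - r) => [|s' ss']; first by rewrite subr_gt0.
  by apply: H1; have := ler_distD s 0 s'; lra.
have d1 := is_derive1_comp (profile1_derive B0 Z0 (dom _ zg0)) dg0.
have := @is_deriveM _ _ (profile1 B Z \o g) g1 0 1 _ _ d1 dg1.
by congr is_derive; rewrite /GRing.scale /= expr2; ring.
Qed.

Section Subsolution.
Variables (O : set 'rV[R]_n) (f h : R -> R) (u0 : 'rV[R]_n -> R)
  (u : 'rV[R]_n -> R -> R) (v : 'rV[R]_n -> R)
  (e T b mu B Z p K G r k : R).
Hypotheses (e0 : 0 < e) (mu0 : 0 < mu) (B0 : 0 < B) (Z0 : 0 < Z) (K0 : 0 < K).
Hypothesis Ep : expR (B * p) = 1 + B * Z.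
Hypothesis HF : forall y : R, - K <= y <= p ->
  mu * (1 - expR (- (B * y))) / B <= f (b + y) - f b.
Hypothesis He : 2 * (1 + B * Z) * e <= mu * Z.
Hypothesis Hk : 2 * (1 + B * Z) <= mu * k.
Let d := (1 + B * Z) * zlow B Z K + Z.
(** The bound of [profile_jet_bound] summed over the axes; the 1 added in [Hr] makes the final
    inequality strict. *)
Let N := n%:R * ((2 + B * Z) / d * G ^+ 2 + G).
Hypothesis G0 : 0 <= G.
Hypothesis Hr : N + 1 <= mu * r.

(** With this value, f (b + y) / e^2 + H / e = (f (b + y) - f b - e) / e^2: the noise at time 0
    cancels f b, and its later oscillation costs e. *)
Let H := - (e + f b) / e.

Let zlow_d (z : R) : zlow B Z K < z -> [/\ d <= (1 + B * Z) * z + Z, d <= z + Z & 0 < d].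
Proof.
move=> zz; have [d0 _ _] := zlowP B0 Z0 K0.
have BZ : 0 < B * Z by rewrite mulr_gt0.
have zl : zlow B Z K <= 0.
  rewrite /zlow mulNr mulNr oppr_le0 divr_ge0 ?mulr_ge0 ?(ltW Z0) //.
    by rewrite subr_ge0 -expR0 ler_expR oppr_le0 mulr_ge0 // ltW.
  have : expR (- (B * K)) <= 1 by rewrite -expR0 ler_expR oppr_le0 mulr_ge0 // ltW.
  by lra.
have : B * Z * zlow B Z K <= 0 by rewrite mulr_ge0_le0 // ltW.
have : (1 + B * Z) * zlow B Z K <= (1 + B * Z) * z by rewrite ler_pM2l ?ltW //; lra.
by split; rewrite /d //; lra.
Qed.

(** [S] stands for the Laplacian of the comparison function, and is 0 at the boundary. Divided by
    e^2, [profile_subsolution] settles reaction and noise; the term in [r] beats the bound on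
    [S]. *)
Lemma strict_inequality c (t S : R) : 0 <= t ->
  zlow B Z K < stretched mu e r k c t ->
  - K < profile B Z (stretched mu e r k c t) ->
  - (profile1 B Z (stretched mu e r k c t) * stretch mu e t ^+ 2 * N) <= S ->
  profile1 B Z (stretched mu e r k c t) * stretched1 mu e r k c t <
  S + (e ^+ 2)^-1 * f (b + profile B Z (stretched mu e r k c t)) + e^-1 * H.
Proof.
move=> t0; set z := stretched _ _ _ _ _ _ => zz yK HS.
have [z1 z2 d0] := zlow_d zz.
have z1' : 0 < (1 + B * Z) * z + Z by exact: lt_le_trans z1.
have p0 := profile1_gt0 B0 Z0 z1'.
have a1 := stretch_ge1 mu0 e0 t0.
have yp := profile_lt B0 Z0 z1' Ep.
have /HF HF' : - K <= profile B Z z <= p by rewrite !ltW.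
have sub := profile_subsolution B0 Z0 z1' mu0 (ltW e0) He Hk HF'.
have e2 : 0 < (e ^+ 2)^-1 by rewrite invr_gt0 exprn_gt0.
have sub2 : (e ^+ 2)^-1 * (profile1 B Z z * (mu * (z - k * e))) <=
    (e ^+ 2)^-1 * (f (b + profile B Z z) - f b - e) by rewrite ler_pM2l.
have eH : e^-1 * H = - (e ^+ 2)^-1 * (f b + e).
  by rewrite /H; field; rewrite gt_eqF.
have A0 : 0 < profile1 B Z z * stretch mu e t ^+ 2.
  by rewrite mulr_gt0 ?exprn_gt0 //; lra.
have : profile1 B Z z * stretch mu e t ^+ 2 * (N + 1) <=
    profile1 B Z z * stretch mu e t ^+ 2 * (mu * r) by rewrite ler_pM2l.
by rewrite eH /stretched1 -/z; lra.
Qed.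

Hypothesis hO : smooth_bounded_domain O.
Hypothesis cf : continuous f.
Hypothesis sol : classical_solution O f e h u0 u.
Hypothesis T0 : 0 <= T.
Hypothesis Hh : forall t : R, 0 < t <= T -> - e <= f b + e * h t.
Hypothesis Hu : forall x (t : R), closure O x -> 0 <= t <= T -> b - K < u x t.
Hypothesis cv : {within closure O, continuous v}.
Hypothesis jv : forall x, O x -> bounded_jet G v x.
Hypothesis vu : forall x, O x -> v x <= u0 x - b.
Hypothesis Ku : forall x, O x -> b - K + 1 <= u0 x.
Hypothesis vb : forall x, boundary O x ->
  (exists r c : R, 0 < r /\ forall y, closure O y -> `|x - y| < r -> v y = c) \/
  v x <= - B^-1.

Let w x t := b + profile B Z (Num.max (stretched mu e r k (v x) t) (zlow B Z K)).

(** Where the truncation is active, [w] equals [b - K], which lies below [u]; contacts occur only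
    where [w] is smooth. *)
Let touch x (t : R) : closure O x -> 0 <= t <= T -> w x t = u x t ->
  zlow B Z K < stretched mu e r k (v x) t /\
  - K < profile B Z (stretched mu e r k (v x) t).
Proof.
move=> cx tT wu; have [_ _ Ez] := zlowP B0 Z0 K0.
have : b - K < w x t by rewrite wu Hu.
rewrite /w ltrD2l.
have [zz|zz] := leP (stretched mu e r k (v x) t) (zlow B Z K); last by [].
by rewrite Ez ltxx.
Qed.

Lemma subsolution_jet x (t : R) : O x -> 0 < t <= T -> w x t = u x t ->
  strict_sub_jet w f e H x t.
Proof.
move=> Ox tT wu; have [t0 tT'] := andP tT.
have tT0 : 0 <= t <= T by rewrite ltW.
have [zz yK] := touch (subset_closure Ox) tT0 wu.
have [z1 z2 d0] := zlow_d zz.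
have z1' : 0 < (1 + B * Z) * stretched mu e r k (v x) t + Z by exact: lt_le_trans z1.
have dom (z : R) : zlow B Z K < z -> 0 < (1 + B * Z) * z + Z.
  by move=> /zlow_d[? _ ?]; exact: lt_le_trans d0 _.
have E : w x t = b + profile B Z (stretched mu e r k (v x) t).
  by rewrite /w max_l // ltW.
have line i : exists qi, - (profile1 B Z (stretched mu e r k (v x) t) * stretch mu e t ^+ 2 *
      ((2 + B * Z) / d * G ^+ 2 + G)) <= qi /\
    exists2 w1 : R -> R, (\forall s \near (0 : R), is_derive (s : R) 1
      (fun s : R => w (s *: 'e_i + x) t) (w1 s)) & is_derive (0 : R) 1 w1 qi.
  have [v1 [q [dv dv1 v1G qG]]] := jv Ox i.
  pose g s := stretched mu e r k (v (s *: 'e_i + x)) t.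
  have g0 : g 0 = stretched mu e r k (v x) t by rewrite /g scale0r add0r.
  exists (profile2 B Z (g 0) * (stretch mu e t * v1 0) ^+ 2 +
      profile1 B Z (g 0) * (stretch mu e t * q)).
  split.
    rewrite g0; apply: profile_jet_bound => //.
    by apply: stretch_ge1 => //; exact: ltW.
  apply: (@truncated_profile_line _ _ _ _ g (fun s => stretch mu e t * v1 s)) => //.
  - near=> s; rewrite /g /stretched.
    have : is_derive s 1 (fun s => v (s *: 'e_i + x)) (v1 s) by near: s.
    move=> dvs; apply: is_derive_eq; rewrite /GRing.scale /=; ring.
  - by rewrite g0.
have /choice[q Hq] := line.
exists (profile1 B Z (stretched mu e r k (v x) t) * stretched1 mu e r k (v x) t), q.
split.
  split; last by move=> i; have [] := Hq i.
  apply: truncated_profile_derive => //; last exact: stretched_derive.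
  have [dd _] := stretched_derive mu r k (v x) t e0.
  have cg : {for t, continuous (stretched mu e r k (v x))}.
    exact/differentiable_continuous/derivable1_diffP.
  exact: (cvgr_gt _ cg).
rewrite E; apply: strict_inequality => //; first exact: ltW.
rewrite /N mulrCA mulr_natl -mulNrn -[X in _ *+ X](card_ord n) -sumr_const.
by apply: ler_sum => i _; have [] := Hq i.
Unshelve. all: end_near. Qed.

Lemma subsolution_boundary x (t : R) : boundary O x -> 0 < t <= T -> w x t = u x t ->
  strict_sub_boundary O w f e H x t.
Proof.
move=> bx tT wu; have [t0 tT'] := andP tT.
have tT0 : 0 <= t <= T by rewrite ltW.
have [zz yK] := touch (proj1 bx) tT0 wu.
have [z1 z2 d0] := zlow_d zz.
have a1 := stretch_ge1 mu0 e0 (ltW t0).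
have k0 : 0 < k.
  have : 0 < mu * k by apply: lt_le_trans Hk; rewrite mulr_gt0 // addr_gt0 // mulr_gt0.
  by rewrite pmulr_rgt0.
have r0 : 0 <= r.
  have : 0 <= mu * r.
    apply: le_trans Hr; rewrite addr_ge0 // mulr_ge0 ?ler0n // addr_ge0 //.
    by rewrite mulr_ge0 ?sqr_ge0 // divr_ge0 ?(ltW d0) // addr_ge0 // mulr_ge0 // ltW.
  by rewrite pmulr_rge0.
(* If [v x <= - B^-1], stretching only lowers the value: it stays below [zlow], and there is no
   contact. *)
case: (vb bx) => [[r1 [c [r10 vc]]]|vB]; last first.
  have [_ zlB _] := zlowP B0 Z0 K0; exfalso.
  suff : stretched mu e r k (v x) t <= - B^-1 by lra.
  have Bi : 0 < B^-1 by rewrite invr_gt0.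
  rewrite /stretched; set al := stretch mu e t in a1 *.
  have H1 : al * v x <= - B^-1.
    apply: (@le_trans _ _ (al * - B^-1)); first by rewrite ler_wpM2l //; lra.
    by rewrite mulrN lerN2 ler_peMl // ltW.
  have H2 : 0 <= al * (r * e ^+ 2 * al).
    have al0 : 0 <= al := le_trans ler01 a1.
    by rewrite mulr_ge0 // mulr_ge0 // mulr_ge0 // sqr_ge0.
  have H3 : k * e <= al * (k * e) by rewrite ler_peMl // mulr_ge0 // ltW.
  by lra.
have vxc : v x = c by apply: vc; rewrite ?subrr ?normr0 //; exact: (proj1 bx).
have dom (z : R) : zlow B Z K < z -> 0 < (1 + B * Z) * z + Z.
  by move=> /zlow_d[? _ ?]; exact: lt_le_trans d0 _.
have E : w x t = b + profile B Z (stretched mu e r k (v x) t).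
  by rewrite /w max_l // ltW.
pose g := stretched mu e r k c.
have cg s : {for s, continuous g}.
  have [dd _] := stretched_derive mu r k c s e0.
  exact/differentiable_continuous/derivable1_diffP.
rewrite vxc -/(g t) in zz yK E.
have /nearP[r2 r20 H2] : \forall s \near t, zlow B Z K < g s by exact: (cvgr_gt _ (cg t)).
have [r' [r'0 rr1 rr2]] := pos_lt2 r10 r20.
exists r', (fun s => b + profile B Z (Num.max (g s) (zlow B Z K))),
  (fun s => profile1 B Z (g s) * stretched1 mu e r k c s); split => //.
- move=> y s cy xy _ _; rewrite /w vc //; exact: lt_trans rr1.
- move=> s ts; apply: truncated_profile_derive => //; last exact: stretched_derive.
  apply/nearP; exists (r2 - r') => [|s' ss']; first by rewrite subr_gt0.
  by apply: H2; apply: le_lt_trans (ler_distD s t s') _; rewrite -(subrKC r' r2) ltrD.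
- apply: cvgM; last exact: continuous_stretched1.
  have p1c : {for g t, continuous (profile1 B Z)}.
    have [dd _] := profile1_derive B0 Z0 (dom _ zz).
    exact/differentiable_continuous/derivable1_diffP.
  exact: (cvg_comp _ _ (cg t) p1c).
rewrite E -[X in _ < X + _]add0r; apply: strict_inequality => //; first exact: ltW.
rewrite oppr_le0 mulr_ge0 //.
  by rewrite mulr_ge0 ?sqr_ge0 // ltW // profile1_gt0 //; exact: dom.
rewrite mulr_ge0 ?ler0n // addr_ge0 //.
by rewrite mulr_ge0 ?sqr_ge0 // divr_ge0 ?(ltW d0) // addr_ge0 // mulr_ge0 // ltW.
Qed.

Lemma generation_lower x (t : R) : closure O x -> 0 <= t <= T ->
  zlow B Z K < stretched mu e r k (v x) t ->
  b + profile B Z (stretched mu e r k (v x) t) < u x t.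
Proof.
move=> cx tT zz; suff : w x t < u x t by rewrite /w max_l // ltW.
have r0 : 0 < r.
  have : 0 < mu * r.
    have [d0 _ _] := zlowP B0 Z0 K0.
    apply: lt_le_trans Hr; rewrite ltr_wpDl // mulr_ge0 ?ler0n // addr_ge0 //.
    by rewrite mulr_ge0 ?sqr_ge0 // divr_ge0 ?(ltW d0) // addr_ge0 // mulr_ge0 // ltW.
  by rewrite pmulr_rgt0.
have re : 0 < r * e ^+ 2 by rewrite mulr_gt0 ?exprn_gt0.
(* At time 0 the stretched value is [v - r * e ^+ 2], whence the second margin; the first is that of
   [Ku] where the truncation is active. *)
have m0 : 0 < Num.min 1 (r * e ^+ 2) by rewrite lt_min ltr01.
apply: (comparison (H := H) hO cf e0 sol T0 _ _ m0) => //.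
- move=> s sT; have := Hh sT; rewrite /H ler_pdivrMr // => ?; lra.
- apply/subspace_continuousP => -[y s] [/= cy _].
  have ws : within (closure O `*` `[0, T]%classic) (nbhs (y, s)) --> nbhs (y, s).
    exact: cvg_within.
  have c1 : v z.1 @[z --> within (closure O `*` `[0, T]%classic) (nbhs (y, s))] --> v y.
    apply/cvgrPdist_lt => eps eps0.
    have [r1 r10 Hr1] := (within_continuousP _ _).1 cv _ cy _ eps0.
    rewrite near_withinE.
    apply: (nearP (V := ('rV[R]_n * R)%type) (y, s) _).2; exists r1 => // z.
    by move=> /norm_pair_lt[yz _] [cz _]; exact: Hr1.
  have c2 : stretch mu e z.2 @[z --> within (closure O `*` `[0, T]%classic) (nbhs (y, s))]
      --> stretch mu e s.
    have [+ _] := stretch_derive mu e s.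
    move=> /derivable1_diffP/differentiable_continuous cs.
    apply: (@cvg_comp _ _ _ snd (stretch mu e) _ (nbhs s)); last exact: cs.
    exact: (cvg_trans (cvg_app snd ws) cvg_snd).
  have c3 : stretched mu e r k (v z.1) z.2
      @[z --> within (closure O `*` `[0, T]%classic) (nbhs (y, s))]
      --> stretched mu e r k (v y) s.
    apply: cvgD; last exact: cvg_cst.
    apply: cvgM => //; apply: cvgB; last exact: cvg_cst.
    by apply: cvgB => //; apply: cvgM => //; exact: cvg_cst.
  have [d0 _ _] := zlowP B0 Z0 K0.
  have P1 : 0 < 1 + B * Z by rewrite addr_gt0 // mulr_gt0.
  have dm : 0 < (1 + B * Z) * Num.max (stretched mu e r k (v y) s) (zlow B Z K) + Z.
    apply: lt_le_trans d0 _; rewrite lerD2r ler_pM2l // le_max lexx orbT //.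
  have [+ _] := profile_derive B0 Z0 dm.
  move=> /derivable1_diffP/differentiable_continuous pc.
  have c4 := cvg_comp _ _ c3 (@max_continuous_l (zlow B Z K) _).
  exact: (cvgD (cvg_cst b) (cvg_comp _ _ c4 pc)).
- move=> y Oy; rewrite /w.
  have [_ _ Ez] := zlowP B0 Z0 K0.
  have M1 : Num.min 1 (r * e ^+ 2) <= 1 by rewrite ge_min lexx.
  have M2 : Num.min 1 (r * e ^+ 2) <= r * e ^+ 2 by rewrite ge_min lexx orbT.
  have [zy|zy] := leP (stretched mu e r k (v y) 0) (zlow B Z K).
    by rewrite Ez; have := Ku Oy; lra.
  have [z1 z2 d0] := zlow_d zy.
  have := profile_le B0 Z0 (lt_le_trans d0 z1).
  rewrite {2}/stretched /stretch mulr0 expR0 => pl.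
  by have := vu Oy; lra.
- exact: subsolution_jet.
- exact: subsolution_boundary.
Qed.
End Subsolution.
End Generation.

Section LowerBarrier.
Context {R : realType} {n : nat}.
Implicit Types (x y : 'rV[R]_n) (O : set 'rV[R]_n).

(** The barrier rises at speed at most c K / e^2, while the reaction less the noise pushes it up
    faster. *)
Lemma lower_barrier O f e h u0 (u : 'rV[R]_n -> R -> R) (T A K c sigma : R) :
  smooth_bounded_domain O -> continuous f -> 0 < e ->
  classical_solution O f e h u0 u -> 0 <= T -> 0 <= K -> 0 <= c ->
  (forall v : R, A - K <= v <= A -> c * K + sigma < f v) ->
  (forall t : R, 0 < t <= T -> - sigma <= e * h t) ->
  (forall x, O x -> A - K + 1 <= u0 x) ->
  forall x (t : R), closure O x -> 0 <= t <= T ->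
    A - K * expR (- (c * (e ^+ 2)^-1) * t) < u x t.
Proof.
move=> hO cf e0 sol T0 K0 c0 Hf Hh H0.
pose om (t : R) := A - K * expR (- (c * (e ^+ 2)^-1) * t).
pose om1 (t : R) := c * (e ^+ 2)^-1 * K * expR (- (c * (e ^+ 2)^-1) * t).
have e2 : 0 < (e ^+ 2)^-1 by rewrite invr_gt0 exprn_gt0.
have dE (t : R) : is_derive t 1 (fun t => expR (- (c * (e ^+ 2)^-1) * t))
    (expR (- (c * (e ^+ 2)^-1) * t) * - (c * (e ^+ 2)^-1)).
  apply: (@is_derive1_comp _ (@expR R) (fun t => - (c * (e ^+ 2)^-1) * t)).
  by apply: is_derive_eq; rewrite /GRing.scale /= mulr1.
have dom (t : R) : is_derive t 1 om (om1 t).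
  have := dE t => ?; apply: is_derive_eq.
  by rewrite /GRing.scale /= /om1; ring.
have lt (t : R) : 0 <= t -> om1 t < (e ^+ 2)^-1 * f (om t) + e^-1 * (- sigma / e).
  move=> t0.
  have E0 := expR_gt0 (- (c * (e ^+ 2)^-1) * t).
  have E1 : expR (- (c * (e ^+ 2)^-1) * t) <= 1.
    by rewrite -expR0 ler_expR mulNr oppr_le0 !mulr_ge0 // ltW.
  have KE : K * expR (- (c * (e ^+ 2)^-1) * t) <= K by rewrite ler_piMr.
  have KE0 : 0 <= K * expR (- (c * (e ^+ 2)^-1) * t) by rewrite mulr_ge0 // ltW.
  have /Hf fl : A - K <= om t <= A by rewrite /om; lra.
  have -> : (e ^+ 2)^-1 * f (om t) + e^-1 * (- sigma / e) =
      (e ^+ 2)^-1 * (f (om t) - sigma) by field; rewrite gt_eqF.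
  have -> : om1 t = (e ^+ 2)^-1 * (c * (K * expR (- (c * (e ^+ 2)^-1) * t))).
    by rewrite /om1; ring.
  rewrite ltr_pM2l //; have := ler_wpM2l c0 KE; lra.
have com1 (t : R) : {for t, continuous om1}.
  apply: cvgM; first exact: cvg_cst.
  have [+ _] := dE t.
  by move=> /derivable1_diffP/differentiable_continuous.
apply: (comparison (w := fun _ => om) (H := - sigma / e) hO cf e0 sol T0 _ _ ltr01).
- by move=> t tT; rewrite ler_pdivrMr // mulrC; exact: Hh.
- apply: continuous_subspaceT => -[x t].
  have [+ _] := dom t; move=> /derivable1_diffP/differentiable_continuous co.
  by apply: (@cvg_comp _ _ _ snd om (nbhs (x, t)) (nbhs t)); [exact: cvg_snd|exact: co].
- by move=> x /H0; rewrite /om mulr0 expR0 mulr1.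
- move=> x t Ox /andP[t0 _] _; exists (om1 t), (fun=> 0); split.
    exact: jet_time.
  by rewrite big1 // add0r; apply: lt; exact: ltW.
- move=> x t bx /andP[t0 _] _; exists 1, om, om1; split => //.
  by apply: lt; exact: ltW.
Qed.

End LowerBarrier.

(** * Reaction term *)

Section Reaction.
Context {R : realType}.
Implicit Types (f : R -> R) (am a ap : R).

(** The derivatives are parameters so that reflection acts on them by explicit formulas. *)
Record reaction f (f1 f2 : R -> R) am a ap : Prop := Reaction {
  reaction_d1 : forall v, is_derive (v : R) 1 f (f1 v);
  reaction_d2 : forall v, is_derive (v : R) 1 f1 (f2 v);
  reaction_c2 : continuous f2;
  reaction_zeros : three_zeros f am a ap;
  reaction_am : f1 am < 0;
  reaction_a : 0 < f1 a;
  reaction_ap : f1 ap < 0 }.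

Lemma bistable_reaction f am a ap : bistable f am a ap ->
  reaction f (derive1 f) (derive1 (derive1 f)) am a ap.
Proof.
case=> df c2 z h1 h2 h3 _.
have d1 (v : R) : is_derive v 1 f (derive1 f v).
  by rewrite derive1E; apply: derivableP; have [] := df v.
have d2 (v : R) : is_derive v 1 (derive1 f) (derive1 (derive1 f) v).
  by rewrite (derive1E (derive1 f)); apply: derivableP; have [] := df v.
exact: (Reaction d1 d2 c2 z h1 h3 h2).
Qed.

Lemma is_derive_reflect (g : R -> R) (v q : R) : is_derive (- v) 1 g q ->
  is_derive v 1 (fun v => g (- v)) (- q).
Proof.
move=> dg; have := @is_derive1_comp _ g (fun v => - v) v q (- 1) dg.
by rewrite mulrN mulr1; apply; exact: is_deriveNid.
Qed.

Lemma reaction_opp f (f1 f2 : R -> R) am a ap : reaction f f1 f2 am a ap ->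
  reaction (fun v => - f (- v)) (fun v => f1 (- v)) (fun v => - f2 (- v))
    (- ap) (- a) (- am).
Proof.
case=> d1 d2 c2 [z1 z2 z3] h1 h2 h3; split; rewrite ?opprK //.
- move=> v; rewrite -[f1 _]opprK; apply: is_deriveN.
  exact: is_derive_reflect.
- by move=> v; exact: is_derive_reflect.
- move=> v; apply: continuousN; apply: continuous_comp; last exact: c2.
  exact: oppr_continuous.
- split; rewrite ?ltrN2 // => v; rewrite (_ : (- f (- v) = 0) <-> (f (- v) = 0)).
    rewrite z3; split.
      by case=> E; [apply: Or33|apply: Or32|apply: Or31]; rewrite -E opprK.
    by case=> ->; rewrite opprK; [apply: Or33|apply: Or32|apply: Or31].
  by split=> [/eqP|->]; rewrite ?oppr0 // oppr_eq0 => /eqP.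
Qed.

Lemma reaction_continuous f (f1 f2 : R -> R) am a ap : reaction f f1 f2 am a ap ->
  continuous f /\ continuous f1.
Proof.
move=> rf; split=> v; apply/differentiable_continuous/derivable1_diffP.
  by case: (reaction_d1 rf v).
by case: (reaction_d2 rf v).
Qed.

Lemma no_zero_gt0 (f : R -> R) (x y : R) : continuous f -> 0 < f x ->
  (forall z, Num.min x y <= z <= Num.max x y -> f z <> 0) -> 0 < f y.
Proof.
move=> cf fx nz; rewrite ltNge; apply/negP => fy.
have [xy|yx] := leP x y.
  have [|c] := @IVT _ f x y 0 xy (continuous_subspaceT cf).
    by rewrite ge_min le_max fy (ltW fx) orbT.
  by rewrite in_itv /= => cxy; apply: nz; rewrite min_l // max_r.
have [|c] := @IVT _ f y x 0 (ltW yx) (continuous_subspaceT cf).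
  by rewrite ge_min le_max fy (ltW fx) orbT.
by rewrite in_itv /= => cxy; apply: nz; rewrite min_r ?max_l ?(ltW yx).
Qed.

Lemma sign_near_zero (f : R -> R) (z m : R) : is_derive z 1 f m -> f z = 0 -> m != 0 ->
  exists2 r, 0 < r & forall h, h != 0 -> `|h| < r -> 0 < m * h * f (h + z).
Proof.
move=> df fz m0; have m1 : 0 < `|m| by rewrite normr_gt0.
have [r r0 H] := is_derive_cvg df m1; exists r => // h h0 hr.
have := H h h0 hr; rewrite fz subr0 => Hh.
have -> : m * h * f (h + z) = h ^+ 2 * (m * (h^-1 * f (h + z))) by field.
rewrite mulr_gt0 ?exprn_even_gt0 //.
have [mp|mn] := ltP 0 m.
  rewrite mulr_gt0 //; move: Hh; rewrite (gtr0_norm mp) ltr_norml; lra.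
have {}mn : m < 0 by rewrite lt_neqAle m0.
rewrite nmulr_rgt0 //; move: Hh; rewrite (ltr0_norm mn) ltr_norml; lra.
Qed.

(** The negative slope at [am] makes [f] positive just to the left, and there is no zero farther
    left at which it could change sign. *)
Lemma reaction_gt0_left f (f1 f2 : R -> R) am a ap (v : R) : reaction f f1 f2 am a ap ->
  v < am -> 0 < f v.
Proof.
move=> rf vam; have [z1 z2 z3] := reaction_zeros rf.
have fam : f am = 0 by apply/z3; apply: Or31.
have m0 : f1 am != 0 by rewrite lt_eqF // (reaction_am rf).
have [r r0 H] := sign_near_zero (reaction_d1 rf am) fam m0.
have [s [s0 sr _]] := pos_lt2 r0 ltr01.
have ns : - s != 0 by rewrite oppr_eq0 gt_eqF.
have := H (- s) ns; rewrite normrN gtr0_norm // => /(_ sr).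
rewrite pmulr_rgt0; last by rewrite nmulr_rgt0 ?oppr_lt0 // (reaction_am rf).
move=> fs; apply: (no_zero_gt0 _ fs); first by have [] := reaction_continuous rf.
move=> z /andP[_]; rewrite le_max => zz /z3 z0.
have : z < am by case/orP: zz => ?; lra.
by clear - z0 z1 z2; case: z0 => -> ?; lra.
Qed.

Lemma reaction_gt0_right f (f1 f2 : R -> R) am a ap (v : R) : reaction f f1 f2 am a ap ->
  a < v < ap -> 0 < f v.
Proof.
move=> rf vap; have [z1 z2 z3] := reaction_zeros rf.
have fa : f a = 0 by apply/z3; apply: Or32.
have m0 : f1 a != 0 by rewrite gt_eqF // (reaction_a rf).
have [r r0 H] := sign_near_zero (reaction_d1 rf a) fa m0.
have ap0 : 0 < ap - a by lra.
have [s [s0 sr sa]] := pos_lt2 r0 ap0.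
have ns : s != 0 by rewrite gt_eqF.
have := H s ns; rewrite gtr0_norm // => /(_ sr).
rewrite pmulr_rgt0; last by rewrite mulr_gt0 // (reaction_a rf).
move=> fs; apply: (no_zero_gt0 _ fs); first by have [] := reaction_continuous rf.
move=> z /andP[]; rewrite le_max ge_min => zz1 zz2 /z3 z0.
have : a < z < ap.
  by clear - zz1 zz2 vap s0 sa; apply/andP; split; [case/orP: zz1|case/orP: zz2] => ?; lra.
by clear - z0 z1 z2; case: z0 => -> /andP[? ?]; lra.
Qed.

End Reaction.

Section ReactionBounds.
Context {R : realType}.

(** With q = exp (- x / 2) the left side is (1 - q) (1 + q), where 1 - q <= x / 2 and q <= 1 / (1 +
    x / 2). *)
Lemma one_sub_expRN_le (x : R) : 0 <= x ->
  1 - expR (- x) <= x * (1 + x / 4) / (1 + x / 2).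
Proof.
move=> x0; have -> : - x = - (x / 2) + - (x / 2) by lra.
rewrite expRD; set q := expR (- (x / 2)).
have q1 : 1 - x / 2 <= q by have := expR_ge1Dx (- (x / 2)); rewrite -/q; lra.
have q2 : q * (1 + x / 2) <= 1.
  have := expR_ge1Dx (x / 2); rewrite -(ler_pM2l (expR_gt0 (- (x / 2)))) -/q.
  by rewrite -[X in _ <= X -> _]expRD addNr expR0.
have q0 : 0 < q := expR_gt0 _.
have p0 : 0 < 1 + x / 2 by lra.
rewrite ler_pdivlMr //; clearbody q.
have : (1 - q) * ((1 + q) * (1 + x / 2)) <= x / 2 * ((1 + q) * (1 + x / 2)).
  by rewrite ler_wpM2r //; [rewrite mulr_ge0 //; lra|lra].
have : x / 2 * (q * (1 + x / 2)) <= x / 2 * 1 by rewrite ler_wpM2l //; lra.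
lra.
Qed.

(** The square of exp (x / 2) >= 1 + x / 2. *)
Lemma expR_ge_quadratic (x : R) : 0 <= x -> 1 + x + x ^+ 2 / 4 <= expR x.
Proof.
move=> x0; have -> : 1 + x + x ^+ 2 / 4 = (1 + x / 2) * (1 + x / 2).
  by rewrite expr2; lra.
have E : expR x = expR (x / 2) * expR (x / 2) by rewrite -expRD; congr expR; lra.
by rewrite E; apply: ler_pM; rewrite ?expR_ge1Dx //; lra.
Qed.

Lemma MVT_any (g dg : R -> R) (x y : R) : (forall z, is_derive (z : R) 1 g (dg z)) ->
  exists2 c, `|c - x| <= `|y - x| & g y - g x = dg c * (y - x).
Proof.
move=> D.
have cg (a b : R) : {within `[a, b]%classic, continuous g}.
  apply: continuous_subspaceT => z; apply/differentiable_continuous/derivable1_diffP.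
  by case: (D z).
have [xy|yx] := leP x y.
  have [c] := MVT_segment xy (fun z _ => D z) (cg x y).
  rewrite in_itv /= => cxy E; exists c => //.
  by rewrite !ger0_norm ?subr_ge0 //; lra.
have [c] := MVT_segment (ltW yx) (fun z _ => D z) (cg y x).
rewrite in_itv /= => cxy E; exists c; last by lra.
rewrite -(normrN (c - x)) -(normrN (y - x)) !ger0_norm; lra.
Qed.

Lemma taylor_lower (g g1 g2 : R -> R) (C L b y : R) :
  (forall z, is_derive (z : R) 1 g (g1 z)) -> (forall z, is_derive (z : R) 1 g1 (g2 z)) ->
  (forall z, `|z - b| <= `|y| -> `|g2 z| <= C) ->
  g1 b * y - C * y ^+ 2 <= g (b + y) - g b.
Proof.
move=> D1 D2 HC.
have [c] := MVT_any b (b + y) D1; rewrite (_ : b + y - b = y) => [cb ->|]; last by ring.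
have [c' c'b E] := MVT_any b c D2.
have H : `|g1 c - g1 b| <= C * `|y|.
  rewrite E normrM ler_pM ?normr_ge0 //; apply: HC; exact: le_trans cb.
have : `|(g1 c - g1 b) * y| <= C * y ^+ 2.
  by rewrite normrM -[y ^+ 2]real_normK ?num_real // expr2 mulrA ler_wpM2r.
by rewrite ler_norml mulrBl => /andP[? _]; lra.
Qed.

Lemma continuous_segment_bounded (g : R -> R) (x y : R) : continuous g ->
  exists2 C, 0 < C & forall z, x <= z <= y -> `|g z| <= C.
Proof.
move=> cg; have [xy|yx] := leP x y; last first.
  by exists 1 => // z /andP[? ?]; lra.
have cn : continuous (fun z => `|g z|).
  by move=> z; apply: continuous_comp; [exact: cg|exact: norm_continuous].
have [c _ Hc] := EVT_max xy (continuous_subspaceT cn).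
exists (`|g c| + 1); first by rewrite ltr_wpDl.
by move=> z zxy; have := Hc z; rewrite in_itv /= => /(_ zxy); lra.
Qed.

Lemma continuous_segment_gt0 (g : R -> R) (x y : R) : continuous g ->
  (forall z, x <= z <= y -> 0 < g z) ->
  exists2 m, 0 < m & forall z, x <= z <= y -> m <= g z.
Proof.
move=> cg gp; have [xy|yx] := leP x y; last first.
  by exists 1 => // z /andP[? ?]; lra.
have [c + Hc] := EVT_min xy (continuous_subspaceT cg).
rewrite in_itv /= => /gp gc; exists (g c) => // z zxy; exact: Hc.
Qed.

(* For y <= 0 and for small y > 0 this is a second order comparison, as the
   right-hand side is mu (y - B y ^ 2 / 2 + ...); elsewhere it is at most mu / B. *)
Lemma reaction_exp_lower (f f1 f2 : R -> R) (am a ap p K : R) :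
  reaction f f1 f2 am a ap -> 0 < p < ap - a -> 0 < K ->
  exists rho B0, [/\ 0 < rho, 0 < B0 & forall B b, B0 <= B -> `|b - a| < rho ->
    [/\ f1 a / 2 <= f1 b, f1 b <= 2 * f1 a & forall y, - K <= y <= p ->
    f1 b * (1 - expR (- (B * y))) / B <= f (b + y) - f b]].
Proof.
move=> rf /andP[p0 pa] K0; have [cf cf1] := reaction_continuous rf.
have c2 := reaction_c2 rf; have m0 := reaction_a rf; set m := f1 a in m0 *.
have fa : f a = 0 by have [_ _ z3] := reaction_zeros rf; apply/z3; apply: Or32.
have [C C0 HC] := continuous_segment_bounded (a - 1 - K - p) (a + 1 + K + p) c2.
(* Up to [y0] the Taylor remainder satisfies C y <= m / 8 <= mu / 4; beyond it, positivity of [f]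
   takes over. *)
pose y0 := m / (8 * C).
have y00 : 0 < y0 by rewrite divr_gt0 // mulr_gt0.
(* Room for [b] to differ from [a] while [b + y] stays below [ap]. *)
pose dl := (ap - a - p) / 2; have dl0 : 0 < dl by rewrite divr_gt0 // subr_gt0.
have [m1 m10 Hm1] := @continuous_segment_gt0 f (a + y0 / 2) (a + p + dl) cf
  (fun z hz => reaction_gt0_right rf (v := z) ltac:(rewrite /dl in hz; lra)).
have m2 : 0 < m / 2 by rewrite divr_gt0.
have m12 : 0 < m1 / 2 by rewrite divr_gt0.
have [r1 r10 H1] := continuous_forP (cf1 a) m2.
have [r2 r20 H2] := continuous_forP (cf a) m12.
have y02 : 0 < y0 / 2 by rewrite divr_gt0.
have : all (fun a => 0 < a) [:: r1; r2; y0 / 2; dl; 1] by rewrite /= r10 r20 y02 dl0 ltr01.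
move=> /pos_lt_seq[rho rho0 /and5P[rho1 rho2 rho3 rho4 /andP[rho5 _]]].
(* The first summand gives C <= mu B / 8 for the second order comparison, the second gives mu / B <=
   m1 / 2 for large y. *)
pose B0 := 16 * C / m + 4 * m / m1.
have B01 : 0 < 16 * C / m by rewrite divr_gt0 // mulr_gt0.
have B02 : 0 < 4 * m / m1 by rewrite divr_gt0 // mulr_gt0.
exists rho, B0; split=> //; first by rewrite addr_gt0.
move=> B b BB bb.
have Bgt0 : 0 < B by apply: lt_le_trans BB; rewrite addr_gt0.
have Bm : 16 * C <= B * m by rewrite -ler_pdivrMr //; rewrite /B0 in BB; lra.
have Bm1 : 4 * m <= B * m1 by rewrite -ler_pdivrMr //; rewrite /B0 in BB; lra.
have [mu1 mu2] : m / 2 <= f1 b /\ f1 b <= 2 * m.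
  have := H1 b; rewrite distrC => /(_ (lt_trans bb rho1)).
  by rewrite ltr_norml -/m; clear; lra.
split=> // y yK; set mu := f1 b in mu1 mu2 *.
have T : mu * y - C * y ^+ 2 <= f (b + y) - f b.
  apply: taylor_lower => //; [exact: reaction_d1 rf|exact: reaction_d2 rf|].
  move=> z zb; apply: HC; move: bb; rewrite ltr_norml => {}bb.
  have : `|y| <= K + p by rewrite ler_norml; clear - yK p0 K0; lra.
  by move: zb bb; rewrite ler_norml; clear - rho5; lra.
have [y_neg|y_pos] := leP y 0.
  apply: le_trans T; rewrite ler_pdivrMr //.
  have By : 0 <= - (B * y) by rewrite oppr_ge0 mulr_ge0_le0 // ltW.
  have := expR_ge_quadratic By; rewrite sqrrN => E.
  have {}E := ler_wpM2l (_ : 0 <= mu) E.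
  have E1 : mu * (1 + - (B * y) + (B * y) ^+ 2 / 4) <= mu * expR (- (B * y)).
    by apply: E; clear - mu1 m2; lra.
  have E2 : C * B * y ^+ 2 <= mu * (B * y) ^+ 2 / 4.
    have -> : mu * (B * y) ^+ 2 / 4 = mu * B / 4 * (B * y ^+ 2) by rewrite exprMn; ring.
    rewrite -mulrA ler_wpM2r //; first by rewrite mulr_ge0 ?sqr_ge0 // ltW.
    have : m / 2 * B <= mu * B by rewrite ler_pM2r.
    by clear - Bm C0; lra.
  by clear - E1 E2; lra.
have [y_small|y_large] := leP y y0.
  apply: le_trans T.
  have By : 0 <= B * y by rewrite mulr_ge0 // ltW.
  have := one_sub_expRN_le By; have d0 : 0 < 1 + B * y / 2 by clear - By; lra.
  rewrite ler_pdivlMr // => E.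
  have muE : mu * ((1 - expR (- (B * y))) * (1 + B * y / 2)) <=
      mu * (B * y * (1 + B * y / 4)) by rewrite ler_wpM2l //; clear - mu1 m2; lra.
  rewrite ler_pdivrMr // -(ler_pM2r d0) -(mulrA mu).
  apply: le_trans muE _.
  have Cy : C * y <= mu / 4.
    have : C * y <= C * y0 by rewrite ler_pM2l.
    have -> : C * y0 = m / 8 by rewrite /y0; field; rewrite gt_eqF.
    by clear - mu1; lra.
  have Cy2 : C * y * (B * y / 2) <= mu / 4 * (B * y / 2) by rewrite ler_wpM2r //; clear - By; lra.
  have Cy3 : C * y <= mu * B / 8 * y.
    rewrite ler_pM2r //; have : m / 2 * B <= mu * B by rewrite ler_pM2r.
    by clear - Bm C0; lra.
  have Cy4 : C * y * (1 + B * y / 2) <= mu * (B * y) / 4 by clear - Cy2 Cy3; lra.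
  have {}Cy4 := ler_wpM2r By Cy4.
  by rewrite expr2; clear - Cy4; lra.
apply: (@le_trans _ _ (mu / B)).
  rewrite ler_pM2r ?invr_gt0 // ler_piMr //;
    have := expR_gt0 (- (B * y)); clear - mu1 m2; lra.
have F1 : m1 <= f (b + y).
  by apply: Hm1; move: bb; rewrite ltr_norml; clear - y_large yK rho3 rho4; lra.
have F2 : f b <= m1 / 2.
  have := H2 b; rewrite distrC => /(_ (lt_trans bb rho2)).
  by rewrite fa ltr_norml; clear; lra.
rewrite ler_pdivrMr //.
have : B * (m1 / 2) <= B * (f (b + y) - f b) by rewrite ler_pM2l //; clear - F1 F2; lra.
by clear - Bm1 mu2; lra.
Qed.

End ReactionBounds.

(** * The lower bounds at the final time *)

Section HalfGeneration.
Context {R : realType} {n : nat}.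
Implicit Types (x y : 'rV[R]_n) (O : set 'rV[R]_n).

(* Replaces u0 - b in the lower comparison function; at the boundary of O it
   must be locally constant, or so negative that the profile is inactive. *)
Definition test_function O (u0 : 'rV[R]_n -> R) (b G dl c : R) (v : 'rV[R]_n -> R) : Prop :=
  [/\ {within closure O, continuous v},
      forall x, O x -> bounded_jet G v x,
      forall x, O x -> v x <= u0 x - b,
      forall x, boundary O x ->
        (exists r c0 : R, 0 < r /\ forall y, closure O y -> `|x - y| < r -> v y = c0) \/
        v x <= - dl &
      forall x m, O x -> 0 <= m <= c -> b + m <= u0 x -> m / 3 <= v x].

(** The constants are uniform in [b] near [a], because [b] will be the unstable zero a^e, which
    moves with e. *)
Definition has_test_functions O (u0 : 'rV[R]_n -> R) (a : R) : Prop :=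
  exists rho G dl c, [/\ 0 < rho, 0 <= G, 0 < dl, 0 < c &
    forall b, `|b - a| < rho -> exists v, test_function O u0 b G dl c v].

(** The exponential is e to the power c / mu, and [mu <= 2 * m] bounds the exponent below
    independently of e. *)
Lemma exp_decay_le (e mu c K eta m : R) : 0 < e < 1 -> 0 < mu <= 2 * m -> 0 < c ->
  0 < K -> 0 < eta -> e <= expR (- `|2 * m / c * ln (K / eta)|) ->
  K * expR (- (c * (e ^+ 2)^-1) * (mu^-1 * e ^+ 2 * `|ln e|)) <= eta.
Proof.
move=> /andP[e0 e1] /andP[mu0 mum] c0 K0 eta0 He.
have le : ln e < 0 by rewrite ln_lt0 // e0.
have -> : - (c * (e ^+ 2)^-1) * (mu^-1 * e ^+ 2 * `|ln e|) = c / mu * ln e.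
  by rewrite ltr0_norm //; field; rewrite !gt_eqF.
have : expR (ln e) <= expR (- `|2 * m / c * ln (K / eta)|) by rewrite lnK.
rewrite ler_expR => H.
have m0 : 0 < m by lra.
have H1 : c / mu * ln e <= c / (2 * m) * ln e.
  by rewrite ler_wnM2r ?(ltW le) // ler_pM2l // lef_pV2 ?posrE //; lra.
have c2 : 0 < c / (2 * m) by rewrite divr_gt0 // mulr_gt0.
have H2 : c / (2 * m) * ln e <= - ln (K / eta).
  have : c / (2 * m) * ln e <= c / (2 * m) * - `|2 * m / c * ln (K / eta)|.
    by rewrite ler_pM2l.
  have : c / (2 * m) * (2 * m / c * ln (K / eta)) <= c / (2 * m) * `|2 * m / c * ln (K / eta)|.
    by rewrite ler_pM2l // ler_norm.
  have -> : c / (2 * m) * (2 * m / c * ln (K / eta)) = ln (K / eta).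
    by field; rewrite !gt_eqF.
  lra.
have Ke : 0 < K / eta by rewrite divr_gt0.
have : expR (c / mu * ln e) <= expR (- ln (K / eta)) by rewrite ler_expR; lra.
rewrite expRN lnK // -(ler_pM2l K0) => /le_trans; apply.
by rewrite invf_div mulrC divfK // gt_eqF.
Qed.

Lemma stretch_final (e mu : R) : 0 < e < 1 -> 0 < mu ->
  stretch mu e (mu^-1 * e ^+ 2 * `|ln e|) = e^-1.
Proof.
move=> /andP[e0 e1] mu0; rewrite /stretch.
have le : ln e < 0 by rewrite ln_lt0 // e0.
have -> : mu * (e ^+ 2)^-1 * (mu^-1 * e ^+ 2 * `|ln e|) = - ln e.
  by rewrite ltr0_norm //; field; rewrite !gt_eqF.
by rewrite expRN lnK.
Qed.

Lemma zlow_le0 (B Z K : R) : 0 < B -> 0 < Z -> 0 < K -> zlow B Z K <= 0.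
Proof.
move=> B0 Z0 K0; have BZ : 0 < B * Z by rewrite mulr_gt0.
have E : expR (- (B * K)) <= 1 by rewrite -expR0 ler_expR oppr_le0 mulr_ge0 // ltW.
rewrite /zlow mulNr mulNr oppr_le0 divr_ge0 ?mulr_ge0 ?(ltW Z0) ?subr_ge0 //.
by lra.
Qed.

(** All constants precede [e], [b] and [u]. The noise enters only through [- e <= f b + e * h t], a
    condition that the reflected problem satisfies too. *)
Lemma half_generation O f (f1 f2 : R -> R) am a ap (u0 : 'rV[R]_n -> R) (eta M : R) :
  smooth_bounded_domain O -> reaction f f1 f2 am a ap ->
  0 < eta -> eta < ap - a -> (forall x, O x -> - M <= u0 x) ->
  has_test_functions O u0 a ->
  exists e0 M0 rho, [/\ 0 < e0, 0 < M0, 0 < rho &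
    forall e b h (u : 'rV[R]_n -> R -> R), 0 < e < e0 -> `|b - a| < rho ->
    let T := (f1 b)^-1 * e ^+ 2 * `|ln e| in
    (forall t, 0 < t <= T -> - e <= f b + e * h t) ->
    classical_solution O f e h u0 u ->
    forall x, O x -> am - eta <= u x T /\
      (b + M0 * e <= u0 x -> ap - eta <= u x T)].
Proof.
move=> hO rf eta0 etap HM [rho1 [G [dl [c1 [rho10 G0 dl0 c10 HV]]]]].
have [cf cf1] := reaction_continuous rf.
have m0 := reaction_a rf; set m := f1 a in m0.
have [zz1 zz2 z3] := reaction_zeros rf.
have fa : f a = 0 by apply/z3; apply: Or32.
(* The first barrier aims at [A]; the other half of [eta] covers its exponential tail at the final
   time. Its depth [K1] lets it start below [u0] with margin 1. *)
pose A := am - eta / 2.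
pose K1 := `|A| + `|M| + 1.
have K10 : 0 < K1 by rewrite /K1; have := normr_ge0 A; have := normr_ge0 M; lra.
have AK : A - K1 + 1 <= - M.
  by rewrite /K1; have := ler_norm A; have := ler_norm M; lra.
have [s s0 Hs] := @continuous_segment_gt0 _ f (A - K1) A cf
  (fun z hz => reaction_gt0_left rf (v := z) ltac:(rewrite /A in hz; lra)).
(* The supremum of the profile. Final losses: [eta / 2] here, [eta / 4] for not reaching the
   supremum, [eta / 4] for [b] instead of [a]. *)
pose p := ap - a - eta / 2.
have p0 : 0 < p by rewrite /p; lra.
pose K := a + 1 - (A - K1).
have K0 : 0 < K by rewrite /K /A; lra.
have pap : 0 < p < ap - a by rewrite p0 /p; lra.
have [rho2 [B0 [rho20 B00 HB]]] := reaction_exp_lower rf pap K0.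
(* The summand [dl^-1] turns the boundary condition [v x <= - dl] of the test function into
   [v x <= - B^-1]. *)
pose B := B0 + dl^-1.
have Bgt0 : 0 < B by rewrite addr_gt0 // invr_gt0.
have Bdl : B^-1 <= dl by rewrite -[dl]invrK lef_pV2 ?posrE ?invr_gt0 // /B; lra.
pose Z := (expR (B * p) - 1) / B.
have Bp : 0 < B * p by rewrite mulr_gt0.
have Z0 : 0 < Z by rewrite divr_gt0 // subr_gt0 expR_gt1.
have Ep : expR (B * p) = 1 + B * Z by rewrite /Z; field; rewrite gt_eqF.
have P0 : 0 < 1 + B * Z by rewrite -Ep expR_gt0.
pose k := 4 * (1 + B * Z) / m.
have k0 : 0 < k by rewrite divr_gt0 // mulr_gt0.
pose N := n%:R * ((2 + B * Z) / ((1 + B * Z) * zlow B Z K + Z) * G ^+ 2 + G).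
have N0 : 0 <= N.
  have [d0 _ _] := zlowP Bgt0 Z0 K0.
  have BZ : 0 < B * Z by rewrite mulr_gt0.
  by rewrite mulr_ge0 ?ler0n // addr_ge0 // mulr_ge0 ?sqr_ge0 // divr_ge0 ?(ltW d0) //; clear - BZ; lra.
pose r := 2 * (N + 1) / m.
have r0 : 0 < r by rewrite divr_gt0 // mulr_gt0 //; clear - N0; lra.
have E1 : expR (B * (p - eta / 4)) < 1 + B * Z.
  by rewrite -Ep ltr_expR ltr_pM2l //; clear - eta0; lra.
(* By [ge_profile], the profile is at least [p - eta / 4] from [th] on; [M0] makes the final
   stretched value, at least [M0 / 3 - r - k], reach [th]. *)
pose th := B * Z ^+ 2 / (1 + B * Z - expR (B * (p - eta / 4))).
have th0 : 0 < th by rewrite divr_gt0 ?subr_gt0 // mulr_gt0 ?exprn_gt0.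
pose M0 := 3 * (r + k + th).
have M00 : 0 < M0 by rewrite mulr_gt0 // !addr_gt0.
have s4 : 0 < s / 4 by rewrite divr_gt0.
have [rho3 rho30 H3] := continuous_forP (cf a) s4.
have eta4 : 0 < eta / 4 by rewrite divr_gt0.
have : all (fun a => 0 < a) [:: rho1; rho2; rho3; eta / 4; 1].
  by rewrite /= rho10 rho20 rho30 eta4 ltr01.
move=> /pos_lt_seq[rho rho0 /and5P[rhol1 rhol2 rhol3 rhol4 /andP[rhol5 _]]].
(* Out of the reaction, at least [s], the barrier's speed uses [s / 4] and the noise [s / 2]. *)
pose c := s / (4 * K1).
have c0 : 0 < c by rewrite divr_gt0 // mulr_gt0.
have cK1 : c * K1 = s / 4 by rewrite /c; field; rewrite gt_eqF.
pose e5 := expR (- `|2 * m / c * ln (K1 / (eta / 2))|).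
have e50 : 0 < e5 := expR_gt0 _.
have mZ : 0 < m * Z / (4 * (1 + B * Z)) by apply: divr_gt0; apply: mulr_gt0.
have cM : 0 < c1 / M0 by rewrite divr_gt0.
(* In order: sign of [ln e], size of the noise, decay of the barrier's tail, gap of the profile, and
   [M0 * e <= c1] for the test function. *)
have : all (fun a => 0 < a) [:: 1; s / 4; e5; m * Z / (4 * (1 + B * Z)); c1 / M0].
  by rewrite /= ltr01 s4 e50 mZ cM.
move=> /pos_lt_seq[e0 e00 /and5P[e01 e02 e03 e04 /andP[e05 _]]].
exists e0, M0, rho; split => // e b h u /andP[egt0 ee0] bb T Hh sol x Ox.
have [mu1 mu2 HF] := HB B b ltac:(by rewrite /B lerDl invr_ge0 ltW) (lt_trans bb rhol2).
set mu := f1 b in mu1 mu2 HF T Hh *.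
have mu0 : 0 < mu by apply: lt_le_trans mu1; rewrite divr_gt0.
have e1 : 0 < e < 1 by rewrite egt0 (lt_trans ee0 e01).
have T0 : 0 <= T by rewrite !mulr_ge0 ?invr_ge0 ?sqr_ge0 // ltW.
have fb : `|f b| < s / 4.
  by have := H3 b; rewrite fa sub0r normrN distrC => /(_ (lt_trans bb rhol3)).
have low y (t : R) : closure O y -> 0 <= t <= T ->
    A - K1 * expR (- (c * (e ^+ 2)^-1) * t) < u y t.
  apply: (lower_barrier (sigma := s / 2) hO cf egt0 sol T0 (ltW K10) (ltW c0)).
  - by move=> z /Hs; rewrite cK1; clear - s0; lra.
  - move=> t' /Hh; move: fb; rewrite ltr_norml; clear - ee0 e02; lra.
  - by move=> y' /HM; apply: le_trans.
have cx : closure O x by exact: subset_closure.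
have TT : 0 <= T <= T by rewrite T0 lexx.
split.
  have := low x T cx TT.
  have := @exp_decay_le e mu c K1 (eta / 2) m e1 ltac:(by rewrite mu0 mu2) c0 K10
    ltac:(by rewrite divr_gt0) ltac:(by apply: ltW; exact: lt_trans e03).
  by rewrite -/T /A; clear; lra.
move=> bx.
have [v [cv jv vu vb vm]] := HV b (lt_trans bb rhol1).
have bn : a - 1 < b < a + 1.
  by move: (lt_trans bb rhol5); rewrite ltr_norml; clear; lra.
have bK : b - K < A - K1 by rewrite /K; clear - bn; lra.
have z_final : stretched mu e r k (v x) T = v x / e - r - k + k * e.
  rewrite /stretched stretch_final //; field; by rewrite gt_eqF.
have vx : M0 / 3 <= v x / e.
  rewrite ler_pdivlMr // mulrAC; apply: vm => //.
  rewrite mulr_ge0 ?(ltW M00) ?(ltW egt0) //= mulrC -ler_pdivlMr //.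
  by apply: ltW; exact: lt_trans e05.
have zth : th <= stretched mu e r k (v x) T.
  rewrite z_final; have : 0 <= k * e by rewrite mulr_ge0 // ltW.
  by move: vx; rewrite /M0; clear; lra.
have zl : zlow B Z K < stretched mu e r k (v x) T.
  by apply: lt_le_trans zth; apply: le_lt_trans th0; exact: zlow_le0.
have gen := @generation_lower _ _ O f h u0 u v e T b mu B Z p K G r k egt0 mu0 Bgt0 Z0 K0
  Ep HF.
have {}gen : b + profile B Z (stretched mu e r k (v x) T) < u x T.
  apply: gen => //.
  - have : 4 * (1 + B * Z) * e <= m * Z.
      rewrite mulrC -ler_pdivlMr ?mulr_gt0 //; apply: ltW; exact: lt_trans e04.
    have : m / 2 * Z <= mu * Z by rewrite ler_pM2r.
    by clear; lra.
  - have : m / 2 * k <= mu * k by rewrite ler_pM2r.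
    have -> : m / 2 * k = 2 * (1 + B * Z) by rewrite /k; field; rewrite gt_eqF.
    by [].
  - have : m / 2 * r <= mu * r by rewrite ler_pM2r.
    have -> : m / 2 * r = N + 1 by rewrite /r; field; rewrite gt_eqF.
    by [].
  - move=> y t cy tT; apply: lt_trans bK _; apply: le_lt_trans (low y t cy tT).
    have : expR (- (c * (e ^+ 2)^-1) * t) <= 1.
      rewrite -expR0 ler_expR mulNr oppr_le0; case/andP: tT => t0 _.
      by rewrite mulr_ge0 // mulr_ge0 ?(ltW c0) // invr_ge0 sqr_ge0.
    by rewrite -(ler_pM2l K10); clear; lra.
  - by move=> y /HM; move: bK AK; clear; lra.
  - move=> y /vb[|vy]; [by left|right].
    by apply: le_trans vy _; rewrite lerN2.
have [d0 _ _] := zlowP Bgt0 Z0 K0.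
have zd : 0 < (1 + B * Z) * stretched mu e r k (v x) T + Z.
  by rewrite addr_gt0 // mulr_gt0 //; exact: lt_le_trans zth.
have := @ge_profile _ B Z _ (p - eta / 4) Bgt0 Z0 zd E1.
have -> : B * Z ^+ 2 / (1 + B * Z - expR (B * (p - eta / 4))) = th by [].
have zth' : th <= stretched mu e r k (v x) T + Z by move: zth Z0; clear; lra.
move=> /(_ zth').
have : a - eta / 4 < b.
  by move: (lt_trans bb rhol4); rewrite ltr_norml; clear; lra.
by move: gen; rewrite /p; clear; lra.
Qed.

End HalfGeneration.

(** * Noise *)

Section SmallNoise.
Context {R : realType}.

(** With l = - ln e the product is C l exp (- dl l), at most 4 C / (dl^2 l) since exp x >= x^2 /
    4. *)
Lemma powR_ln_small (C dl : R) : 0 <= C -> 0 < dl -> exists e1, [/\ 0 < e1, e1 < 1 &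
  forall e, 0 < e < e1 -> C * (e `^ dl * `|ln e|) <= 1].
Proof.
move=> C0 dl0; pose L := 4 * C / dl ^+ 2 + 1.
have dl2 : 0 < dl ^+ 2 by rewrite exprn_gt0.
have L0 : 0 < L by rewrite ltr_wpDl // divr_ge0 ?mulr_ge0 // ltW.
exists (expR (- L)); split; first exact: expR_gt0.
  by rewrite -expR0 ltr_expR oppr_lt0.
move=> e /andP[e0 eL].
have le : ln e < - L by rewrite -ltr_expR lnK.
have -> : e `^ dl = expR (dl * ln e) by rewrite /powR gt_eqF.
have ln0 : ln e < 0 by lra.
rewrite ltr0_norm //; set l := - ln e.
have lL : L < l by rewrite /l; lra.
have -> : dl * ln e = - (dl * l) by rewrite /l mulrN opprK.
have dll : 0 <= dl * l by rewrite mulr_ge0 // ltW // (lt_trans L0).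
have E := expR_ge_quadratic dll.
have Cl : 4 * C <= l * dl ^+ 2.
  by rewrite -ler_pdivrMr //; move: lL; rewrite /L; clear; lra.
rewrite expRN; have -> : C * ((expR (dl * l))^-1 * l) = C * l / expR (dl * l) by ring.
rewrite ler_pdivrMr ?expR_gt0 // mul1r; apply: le_trans E.
have l0 : 0 <= l by rewrite ltW // (lt_trans L0).
have := ler_wpM2r l0 Cl; have -> : (dl * l) ^+ 2 = l * dl ^+ 2 * l by ring.
by move: dll; clear; lra.
Qed.

Lemma powRN_sqr (e g : R) : 0 < e -> e `^ (- g) * e ^+ 2 = e `^ (2 - g).
Proof.
move=> e0; rewrite -powR_mulrn ?(ltW e0) // -powRD; last by rewrite (gt_eqF e0) implybT.
by rewrite addrC.
Qed.

(** [K] will bound 1 / mu, which depends on e. *)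
Definition small_oscillation (x : R -> R -> R) : Prop := forall K : R, 0 < K ->
  exists e1, 0 < e1 /\ forall e t, 0 < e < e1 -> 0 < t <= K * (e ^+ 2 * `|ln e|) ->
    `|x e t - x e 0| <= 1.

(* The time derivative of the noise is of order e ^ (- g). *)
Lemma small_oscillationP (x : R -> R -> R) (C g : R) : 0 <= C -> 0 < g < 2 ->
  (forall e t, 0 < e < 1 -> 0 < t <= 1 -> `|x e t - x e 0| <= C * e `^ (- g) * t) ->
  small_oscillation x.
Proof.
move=> C0 /andP[g0 g2] H K K0.
have CK : 0 <= C * K by rewrite mulr_ge0 // ltW.
have g2' : 0 < 2 - g by lra.
have [e1 [e10 e11 H1]] := powR_ln_small CK g2'.
have [e2 [e20 e21 H2]] := powR_ln_small (ltW K0) (ltr0n R 2).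
have [e3 [e30 e31 e32]] := pos_lt2 e10 e20.
exists e3; split=> // e t /andP[e0 ee] /andP[t0 tK].
have e1e : 0 < e < 1 by rewrite e0 (lt_trans ee) // (lt_trans e31).
have t1 : t <= 1.
  apply: le_trans tK _; have := H2 e; rewrite e0 (lt_trans ee e32) => /(_ isT).
  by rewrite powR_mulrn // ltW.
apply: le_trans (H e t e1e _) _; first by rewrite t0.
have := H1 e; rewrite e0 (lt_trans ee e31) => /(_ isT); apply: le_trans.
rewrite -(powRN_sqr g e0).
have -> : C * K * (e `^ (- g) * e ^+ 2 * `|ln e|) =
    C * e `^ (- g) * (K * (e ^+ 2 * `|ln e|)) by ring.
by rewrite ler_wpM2l // mulr_ge0 // powR_ge0.
Qed.

Lemma C1_halfline_lipschitz (g : R -> R) (M t : R) : C1_halfline g ->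
  (forall s, 0 < s -> `|derive1 g s| <= M) -> 0 < t -> `|g t - g 0| <= M * t.
Proof.
move=> [cg dg _] HM t0.
have D (s : R) : s \in `]0, t[%R -> is_derive s 1 g (derive1 g s).
  rewrite in_itv /= => /andP[s0 _]; rewrite derive1E; apply: derivableP; exact: dg.
have cgt : {within `[0, t]%classic, continuous g}.
  apply: continuous_subspaceW cg => s; rewrite /= !in_itv /= => /andP[-> _] //.
have [c + ->] := MVT t0 D cgt; rewrite in_itv /= subr0 => /andP[c0 _].
by rewrite normrM (gtr0_norm t0) ler_pM2r // HM.
Qed.

Lemma continuous_glue (g : R -> R) : {within `[0, +oo[%classic, continuous g} ->
  {within `[0, +oo[%classic, continuous (fun t => g (- t))} -> continuous g.
Proof.
move=> /within_continuousP c1 /within_continuousP c2 x.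
apply/cvgrPdist_lt => e e0; apply/nearP.
have pos (z : R) : 0 <= z -> `[0, +oo[%classic z by rewrite /= in_itv /= andbT.
have [x0|x0|->] := ltgtP x 0.
- have nx : 0 <= - x by lra.
  have [r r0 H] := c2 _ (pos _ nx) _ e0.
  have nx0 : 0 < - x by lra.
  have [s [s0 sr sx]] := pos_lt2 r0 nx0.
  exists s => // y xy; have {}xy : `|x - y| < s by [].
  have := H (- y); rewrite !opprK; apply.
    by apply: pos; move: xy; rewrite ltr_norml; lra.
  by rewrite -normrN opprD opprK; exact: lt_trans sr.
- have [r r0 H] := c1 _ (pos _ (ltW x0)) _ e0.
  have [s [s0 sr sx]] := pos_lt2 r0 x0.
  exists s => // y xy; have {}xy : `|x - y| < s by [].
  apply: H; last exact: lt_trans sr.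
  by apply: pos; move: xy; rewrite ltr_norml; lra.
- have [r1 r10 H1] := c1 _ (pos _ (lexx 0)) _ e0.
  have [r2 r20 H2] := c2 _ (pos _ (lexx 0)) _ e0.
  have [s [s0 s1 s2]] := pos_lt2 r10 r20.
  exists s => // y y_s; have : `|0 - y| < s by []; rewrite sub0r normrN => ys.
  have [y0|y0] := leP 0 y.
    by apply: H1; [exact: pos|rewrite sub0r normrN; exact: lt_trans s1].
  have := H2 (- y); rewrite oppr0 opprK; apply; first by apply: pos; lra.
  by rewrite add0r; exact: lt_trans s2.
Qed.

Lemma derive1_zero_outside (g : R -> R) (r : R) : (forall x, r < `|x| -> g x = 0) ->
  forall x, r < `|x| -> derive1 g x = 0.
Proof.
move=> g0 x xr; rewrite derive1E -(derive_cst (0 : R) x 1).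
apply: near_eq_derive; apply/nearP; exists (`|x| - r); first by rewrite subr_gt0.
by move=> y xy; apply: g0; have := lerB_dist x y; have {}xy : `|x - y| < `|x| - r by []; lra.
Qed.

Lemma compact_support_bounded (g : R -> R) : continuous g ->
  (forall x, 1 < `|x| -> g x = 0) -> exists2 D, 0 < D & forall x, `|g x| <= D.
Proof.
move=> cg g0; have [D D0 HD] := continuous_segment_bounded (- 1) 1 cg.
exists D => // x; have [x1|x1] := leP `|x| 1; last by rewrite g0 // normr0 ltW.
by apply: HD; rewrite -ler_norml.
Qed.

End SmallNoise.

Section Mollified.
Context {R : realType}.
Local Notation mu := (@lebesgue_measure R).
Variables (rho W : R -> R) (D1 D2 B0 : R).
Hypothesis mol : mollifier rho.
Hypothesis cW : continuous W.
Hypothesis HD1 : forall x, `|derive1 rho x| <= D1.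
Hypothesis HD2 : forall x, `|derive1 (derive1 rho) x| <= D2.
Hypothesis HW : forall x, - 3 <= x <= 3 -> `|W x| <= B0.

(** For times between -1 and 2 and [1 <= l] the kernel vanishes outside this interval. It is thus a
    fixed domain for differentiating under the integral on a neighbourhood of each time in [0, 1],
    including 0. *)
Let I3 : set R := `[- 3, 3]%classic.

Let integrable_I3 (g : R -> R) : continuous g -> mu.-integrable I3 (EFin \o g).
Proof.
move=> cg; apply: continuous_compact_integrable; first exact: segment_compact.
exact: continuous_subspaceT.
Qed.

Let d_rho (x : R) : is_derive x 1 rho (derive1 rho x).
Proof. by rewrite derive1E; apply: derivableP; have := @mollifier_smooth _ _ mol 0%N x; by rewrite derive1n0. Qed.

Let d_rho1 (x : R) : is_derive x 1 (derive1 rho) (derive1 (derive1 rho) x).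
Proof. by rewrite (derive1E (derive1 rho)); apply: derivableP; have := @mollifier_smooth _ _ mol 1%N x; by rewrite derive1n1. Qed.

Let c_rho : continuous rho.
Proof.
move=> x; apply/differentiable_continuous/derivable1_diffP; by case: (d_rho x).
Qed.

Let c_rho1 : continuous (derive1 rho).
Proof.
move=> x; apply/differentiable_continuous/derivable1_diffP; by case: (d_rho1 x).
Qed.

Let c_kernel (k : R -> R) (l x : R) : continuous k ->
  continuous (fun y => l * k (l * (x - y)) * W y).
Proof.
move=> ck y; apply: cvgM; last exact: cW.
apply: cvgM; first exact: cvg_cst.
apply: (@cvg_comp _ _ _ (fun y => l * (x - y)) k); last exact: ck.
by apply: cvgM; [exact: cvg_cst|apply: cvgB; [exact: cvg_cst|exact: cvg_id]].
Qed.

Lemma derive1_mollified (l t : R) : 1 <= l -> 0 <= t <= 1 ->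
  derive1 (fun t => (\int[mu]_(s in setT) (l * rho (l * (t - s)) * W s))%R) t =
  (\int[mu]_(s in I3) (l * (l * derive1 rho (l * (t - s))) * W s))%R.
Proof.
move=> l1 t01.
have l0 : 0 < l by lra.
have restrict (x : R) : - 1 < x < 2 ->
    (\int[mu]_(s in setT) (l * rho (l * (x - s)) * W s))%R =
    (\int[mu]_(s in I3) (l * rho (l * (x - s)) * W s))%R.
  move=> x12; rewrite [RHS]Rintegral_mkcond; apply: eq_Rintegral => s _.
  rewrite patchE; case: ifPn => // /negP; rewrite inE /I3 /= in_itv /= => s3.
  rewrite (mollifier_support mol) ?mulr0 ?mul0r // normrM gtr0_norm //.
  have : 1 < `|x - s|.
    rewrite ltNge; apply/negP; rewrite ler_norml => xs; apply: s3.
    by apply/andP; split; lra.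
  by move=> xs; apply: lt_le_trans xs _; rewrite ler_peMl.
rewrite derive1E.
rewrite (@near_eq_derive _ _ _ _
  (fun x => (\int[mu]_(s in I3) (l * rho (l * (x - s)) * W s))%R)); last first.
  apply/nearP; exists 1 => // x; rewrite ltr_norml => xt; apply: restrict; lra.
rewrite -derive1E.
have dk (x s : R) : is_derive x 1 (fun x => l * rho (l * (x - s)) * W s)
    (l * (l * derive1 rho (l * (x - s))) * W s).
  have d1 : is_derive x 1 (fun x => rho (l * (x - s))) (derive1 rho (l * (x - s)) * l).
    apply: (@is_derive1_comp _ rho (fun x => l * (x - s))); first exact: d_rho.
    by apply: is_derive_eq; rewrite /GRing.scale /=; ring.
  by apply: is_derive_eq; rewrite /GRing.scale /=; ring.
have D10 : 0 <= D1 by apply: le_trans (HD1 0); exact: normr_ge0.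
have B00 : 0 <= B0 by apply: le_trans (normr_ge0 (W 0)) (HW _); lra.
have E := @differentiation_under_integral R _ _ mu (fun x s => l * rho (l * (x - s)) * W s)
  I3 (measurable_itv _) t (- 1) 2 _ _ _ (fun=> l * (l * D1) * B0).
rewrite {}E.
- apply: eq_Rintegral => s _; rewrite /partial1of2 derive1E.
  by have [_ ->] := dk t s.
- by rewrite /= in_itv /=; lra.
- by move=> x _; apply: integrable_I3; exact: c_kernel.
- by move=> x s _ _; have [] := dk x s.
- by move=> _; rewrite !mulr_ge0 // ltW.
- by apply: integrable_I3 => x; exact: cvg_cst.
- move=> x s _; rewrite /I3 /= in_itv /= => s3; rewrite /partial1of2 derive1E.
  have [_ ->] := dk x s.
  by rewrite !normrM !(gtr0_norm l0) ler_pM ?mulr_ge0 ?(ltW l0) // ?ler_pM2l ?HD1 ?HW.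
Qed.

(** Both derivatives fall on the kernel; each adds a factor [l] to the normalising one. The 6 is the
    length of [I3]. *)
Lemma mollified_lipschitz (F : R -> R) (l t : R) : 1 <= l -> 0 < t <= 1 ->
  F = (fun t => (\int[mu]_(s in setT) (l * rho (l * (t - s)) * W s))%R) ->
  `|derive1 F t - derive1 F 0| <= 6 * D2 * B0 * (l * l * l) * t.
Proof.
move=> l1 /andP[t0 t1] ->; have l0 : 0 < l by lra.
rewrite !derive1_mollified ?lexx ?ler01 // ?t1 ?(ltW t0) //.
have D20 : 0 <= D2 by apply: le_trans (HD2 0); exact: normr_ge0.
have ck (x : R) : continuous (fun s => l * (l * derive1 rho (l * (x - s))) * W s).
  apply: (@c_kernel (fun y => l * derive1 rho y) l x) => y.
  by apply: cvgM; [exact: cvg_cst|exact: c_rho1].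
have mI : measurable (I3 : set (measurableTypeR R)) by exact: measurable_itv.
rewrite -RintegralB //; [|exact: (integrable_I3 (ck t))|exact: (integrable_I3 (ck 0))].
have cB : continuous (fun s => l * (l * derive1 rho (l * (t - s))) * W s -
    l * (l * derive1 rho (l * (0 - s))) * W s).
  by move=> s; apply: cvgB; exact: ck.
have H := le_normr_Rintegral mI (integrable_I3 cB).
apply: (le_trans H).
pose c := l * (l * (D2 * (l * t))) * B0.
apply: (@le_trans _ _ (\int[mu]_(s in I3) c)%R).
  apply: le_Rintegral => //.
  - by apply: integrable_I3 => s; apply: cvg_norm; exact: cB.
  - by apply: integrable_I3 => s; exact: cvg_cst.
  - move=> s; rewrite /I3 /= in_itv /= => s3.
    rewrite -mulrBl -!mulrBr !normrM !(gtr0_norm l0) /c.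
    have [z _ ->] := MVT_any (l * (0 - s)) (l * (t - s)) d_rho1.
    have -> : l * (t - s) - l * (0 - s) = l * t by ring.
    rewrite normrM (gtr0_norm (mulr_gt0 l0 t0)).
    rewrite ler_pM ?mulr_ge0 ?(ltW l0) ?(ltW t0) // ?HW //.
    by rewrite !ler_pM2l // ler_pM2r ?mulr_gt0.
rewrite Rintegral_cst //.
have -> : fine (mu I3) = 6.
  rewrite /I3 lebesgue_measure_itv /= lte_fin; have -> : (- 3 < 3 :> R) by lra.
  by rewrite /=; lra.
by rewrite le_eqVlt; apply/orP; left; apply/eqP; rewrite /c; ring.
Qed.

End Mollified.

Section Noise.
Context {R : realType}.

Lemma powR_cube (e g : R) : 0 < e -> e `^ (- g) * e `^ (- g) * e `^ (- g) = e `^ (- (3 * g)).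
Proof.
move=> e0; rewrite -!powRD ?(gt_eqF e0) ?implybT //.
by congr (_ `^ _); ring.
Qed.

Lemma MN1_small_oscillation d (T : measurableType d) (P : probability T R)
    (xi : R -> R -> T -> R) : MN1 P xi ->
  {ae P, forall w, small_oscillation (fun e t => xi e t w)}.
Proof.
move=> [X [g1 [p [M [g1P mp xiE]]]]].
have := mixing_path mp; apply: filterS => w [C1 [Xb dXb]].
have M0 : 0 <= M by apply: le_trans (normr_ge0 _) (Xb 0 _).
apply: (small_oscillationP (C := M) (g := 3 * g1)) => //; first lra.
move=> e t /andP[e0 e1] /andP[t0 t1]; rewrite !xiE ?(ltW t0) //= mulr0 -mulrBr.
have p0 (a : R) : 0 < e `^ a by rewrite powR_gt0.
rewrite normrM (gtr0_norm (p0 _)).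
have H := C1_halfline_lipschitz C1 dXb (mulr_gt0 (p0 (- (2 * g1))) t0).
apply: le_trans (ler_wpM2l (ltW (p0 _)) H) _.
have -> : e `^ (- (3 * g1)) = e `^ (- g1) * e `^ (- (2 * g1)).
  by rewrite -powRD ?(gt_eqF e0) ?implybT //; congr (_ `^ _); ring.
by rewrite le_eqVlt; apply/orP; left; apply/eqP; ring.
Qed.

(* As 3 * g2 < 2, boundedness of the Brownian path near 0 suffices. *)
Lemma MN2_small_oscillation d (T : measurableType d) (P : probability T R)
    (xi : R -> R -> T -> R) : MN2 P xi ->
  {ae P, forall w, small_oscillation (fun e t => xi e t w)}.
Proof.
move=> [W [rho [g2 [g2P [b1 b2 _] mol xiE]]]].
move: (brownian_continuous b1) (brownian_continuous b2).
apply: filterS2 => w c1 c2.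
have cW : continuous (fun t => W t w) by exact: continuous_glue.
have rho_d k : continuous (derive1n k rho).
  move=> x; apply/differentiable_continuous/derivable1_diffP.
  exact: (@mollifier_smooth _ _ mol k x).
have s0 := mollifier_support mol.
have s1 := derive1_zero_outside s0.
have s2 := derive1_zero_outside s1.
have [D1 D10 HD1] := compact_support_bounded (rho_d 1%N) s1.
have [D2 D20 HD2] := compact_support_bounded (rho_d 2%N) s2.
have [B0 B00 HB] := continuous_segment_bounded (- 3) 3 cW.
apply: (small_oscillationP (C := 6 * D2 * B0) (g := 3 * g2)).
- by rewrite !mulr_ge0 // ltW.
- lra.
move=> e t /andP[e0 e1] t01; have [t0 t1] := andP t01.
rewrite !xiE ?(ltW t0) //.
have l1 : 1 <= e `^ (- g2).
  by rewrite -(powRr0 e) ger_powR ?e0 ?ltW //; lra.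
rewrite -powR_cube //.
exact: (@mollified_lipschitz _ rho (fun t => W t w) D1 D2 B0 mol cW HD1 HD2 HB).
Qed.

End Noise.

(** * Initial datum and reflection *)

Section TestFunctions.
Context {R : realType} {n : nat}.
Implicit Types (x y : 'rV[R]_n) (O : set 'rV[R]_n).

Lemma is_derive_pospow (k : nat) (x : R) :
  is_derive x 1 (fun s : R => Num.max s 0 ^+ k.+2) (k.+2%:R * Num.max x 0 ^+ k.+1).
Proof.
have [x0|x0|->] := ltgtP x 0.
- rewrite expr0n mulr0.
  apply: (@near_eq_is_derive _ _ _ (cst 0)).
  apply/nearP; exists (- x) => [|y]; first lra.
  move=> xy; have {}xy : `|x - y| < - x by [].
  by rewrite /= max_r ?expr0n //; move: xy; rewrite ltr_norml; lra.
- apply: (@near_eq_is_derive _ _ _ (fun s : R => s ^+ k.+2)).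
    apply/nearP; exists x => // y xy; have {}xy : `|x - y| < x by [].
    by rewrite /= max_l //; move: xy; rewrite ltr_norml; lra.
  apply: DeriveDef; first exact: exprn_derivable.
  by rewrite exp_derive /GRing.scale /= mulr1.
- rewrite expr0n mulr0.
  have C : h^-1 *: (((fun s : R => Num.max s 0 ^+ k.+2) \o shift 0) (h *: 1) -
      Num.max 0 0 ^+ k.+2) @[h --> (0 : R)^'] --> (0 : R).
    apply/cvgrPdist_lt => e e0; rewrite near_withinE; apply/nearP.
    have [r [r0 re r1]] := pos_lt2 e0 ltr01.
    exists r => // h hr' h0.
    have hr : `|h| < r by have : `|0 - h| < r by []; rewrite sub0r normrN.
    rewrite sub0r normrN /= addr0 maxxx expr0n /= subr0 /GRing.scale /= mulr1.
    have [hn|hp] := leP h 0; first by rewrite expr0n mulr0 normr0.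
    have -> : h^-1 * h ^+ k.+2 = h * h ^+ k by rewrite exprS mulKf // exprS.
    rewrite gtr0_norm ?mulr_gt0 ?exprn_gt0 //.
    have {}hr : h < r by exact: (le_lt_trans (ler_norm h) hr).
    apply: (@le_lt_trans _ _ h); last exact: lt_trans re.
    by rewrite ler_piMr ?(ltW hp) // exprn_ile1 ?(ltW hp) // ltW // (lt_trans hr).
  by apply: DeriveDef; [apply/cvg_ex; exists 0|exact: cvg_lim].
Qed.

Lemma low_boundary_tests O (U0 : 'rV[R]_n -> R) (a c G : R) : 0 < c -> 0 <= G ->
  {within closure O, continuous U0} -> (forall x, O x -> bounded_jet G U0 x) ->
  (forall x, boundary O x -> U0 x <= a - 2 * c) -> has_test_functions O U0 a.
Proof.
move=> c0 G0 cU jU bU; exists c, G, c, 1; split=> // b ba.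
exists (fun x => U0 x - b); split=> //.
- by move=> x; apply: cvgB; [exact: cU|exact: cvg_cst].
- move=> x Ox i; have [v1 [q [dv dq v1G qG]]] := jU x Ox i.
  exists v1, q; split=> //; near=> s.
  have : is_derive s 1 (fun s => U0 (s *: 'e_i + x)) (v1 s) by near: s.
  by move=> ds; apply: is_derive_eq; rewrite subr0.
- by move=> x /bU; right; move: ba; rewrite ltr_norml; lra.
- by move=> x m Ox /andP[m0 _] bm; lra.
Unshelve. all: end_near. Qed.

(** The cube of a positive part is C^2. The cap is tangent to [z - b] at [b] and constant from
    [b + c] on. *)
Definition cap (c b : R) (z : R) : R := c / 3 * (1 - Num.max (1 - (z - b) / c) 0 ^+ 3).

(** With P = max (1 - (z - b) / c, 0), at most [Q] here, the first two derivatives of the cap are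
    P^2 and - 2 P / c where they are used. *)
Lemma cap_line (c b M : R) (l l1 : R -> R) (q : R) : 0 < c ->
  (\forall s \near (0 : R), is_derive (s : R) 1 l (l1 s)) -> is_derive (0 : R) 1 l1 q ->
  `|l 0| <= M -> `|l1 0| <= M -> `|q| <= M ->
  let Q := 1 + (M + `|b|) / c in
  exists (v1 : R -> R) (q' : R), [/\
    (\forall s \near (0 : R), is_derive (s : R) 1 (fun s => cap c b (l s)) (v1 s)),
    is_derive (0 : R) 1 v1 q', `|v1 0| <= Q ^+ 2 * M + 2 * Q * M ^+ 2 / c &
    `|q'| <= Q ^+ 2 * M + 2 * Q * M ^+ 2 / c].
Proof.
move=> c0 dl dl1 lM l1M qM Q.
pose g s := 1 - (l s - b) / c.
have dg (s : R) : is_derive s 1 l (l1 s) -> is_derive s 1 g (- (l1 s / c)).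
  move=> dls; apply: is_derive_eq; rewrite /GRing.scale /=; ring.
have M0 : 0 <= M by exact: le_trans (normr_ge0 _) lM.
have Q0 : 0 <= Q by rewrite addr_ge0 // divr_ge0 ?addr_ge0 // ltW.
have PQ : 0 <= Num.max (g 0) 0 <= Q.
  rewrite le_max lexx orbT /= ge_max Q0 andbT /g /Q lerD2l -mulNr ler_pM2r ?invr_gt0 //.
  have := ler_norm b; have : - l 0 <= `|l 0| by rewrite -normrN ler_norm.
  by lra.
pose v1 s := Num.max (g s) 0 ^+ 2 * l1 s.
exists v1, (2 * Num.max (g 0) 0 * - (l1 0 / c) * l1 0 + Num.max (g 0) 0 ^+ 2 * q).
have P2 : Num.max (g 0) 0 ^+ 2 <= Q ^+ 2 by rewrite ler_sqr ?nnegrE //; case/andP: PQ.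
have E1 : `|Num.max (g 0) 0 ^+ 2 * l1 0| <= Q ^+ 2 * M.
  by rewrite normrM ger0_norm ?sqr_ge0 // ler_pM ?sqr_ge0.
have E2 : `|Num.max (g 0) 0 ^+ 2 * q| <= Q ^+ 2 * M.
  by rewrite normrM ger0_norm ?sqr_ge0 // ler_pM ?sqr_ge0.
have E3 : `|2 * Num.max (g 0) 0 * - (l1 0 / c) * l1 0| <= 2 * Q * M ^+ 2 / c.
  have -> : 2 * Num.max (g 0) 0 * - (l1 0 / c) * l1 0 =
      - (2 * Num.max (g 0) 0 * (l1 0 ^+ 2 / c)) by ring.
  have [P0 PQ'] := andP PQ.
  rewrite normrN ger0_norm; last by rewrite mulr_ge0 ?divr_ge0 ?sqr_ge0 ?(ltW c0) // mulr_ge0.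
  rewrite -[leRHS]mulrA; apply: ler_pM.
  - by rewrite mulr_ge0.
  - by rewrite divr_ge0 ?sqr_ge0 // ltW.
  - by rewrite ler_pM2l.
  - rewrite ler_pM2r ?invr_gt0 // -[leLHS]real_normK ?num_real //.
    by rewrite ler_sqr ?nnegrE.
have E4 : 0 <= 2 * Q * M ^+ 2 / c by exact: le_trans E3.
split.
- near=> s; have ds : is_derive s 1 l (l1 s) by near: s.
  have d3 := @is_derive1_comp _ _ _ _ _ _ (is_derive_pospow 1 (g s)) (dg s ds).
  have -> : v1 s = c / 3 * (0 - 3%:R * Num.max (g s) 0 ^+ 2 * - (l1 s / c)).
    by rewrite /v1; field; rewrite gt_eqF.
  by apply: (@is_deriveZ _ _ _ (fun s => 1 - Num.max (1 - (l s - b) / c) 0 ^+ 3)).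
- have d2 := @is_derive1_comp _ _ _ _ _ _ (is_derive_pospow 0 (g 0)) (dg 0 (nbhs_singleton dl)).
  have := @is_deriveM _ _ ((fun s => Num.max s 0 ^+ 2) \o g) l1 0 1 _ _ d2 dl1.
  by congr is_derive; rewrite /GRing.scale /= expr1; ring.
- by rewrite /v1; lra.
- by apply: le_trans (ler_normD _ _) _; lra.
Unshelve. all: end_near. Qed.

(** In t = 1 - (z - b) / c, for positive t, this is t^3 - 3 t + 2 = (t - 1)^2 (t + 2) >= 0. *)
Lemma cap_le (c b z : R) : 0 < c -> cap c b z <= z - b.
Proof.
move=> c0; rewrite /cap; set t := 1 - (z - b) / c.
have -> : z - b = c * (1 - t) by rewrite /t; field; rewrite gt_eqF.
rewrite mulrAC ler_pdivrMr // -mulrA ler_pM2l //.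
have [t0|t0] := leP t 0; first by rewrite expr0n /=; lra.
have : 0 <= (t - 1) ^+ 2 * (t + 2) by rewrite mulr_ge0 ?sqr_ge0 //; lra.
have -> : (t - 1) ^+ 2 * (t + 2) = t ^+ 3 - 3 * t + 2 by ring.
lra.
Qed.

(** The positive part P is at most 1 - m / c, and P^3 <= P on [0, 1]. *)
Lemma cap_ge (c b z m : R) : 0 < c -> 0 <= m <= c -> b + m <= z -> m / 3 <= cap c b z.
Proof.
move=> c0 /andP[m0 mc] bz; rewrite /cap; set t := 1 - (z - b) / c.
have tm : t <= 1 - m / c by rewrite /t lerD2l lerN2 ler_pM2r ?invr_gt0 //; lra.
have m1 : m / c <= 1 by rewrite ler_pdivrMr // mul1r.
have mc0 : 0 <= m / c by rewrite divr_ge0 // ltW.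
have P1 : 0 <= Num.max t 0 <= 1 - m / c.
  by rewrite le_max lexx orbT ge_max tm /=; lra.
move: P1; set P := Num.max t 0 => /andP[P0 P1].
have P3 : P ^+ 3 <= P.
  by rewrite exprS ler_piMr // exprn_ile1 //; lra.
have -> : m / 3 = c / 3 * (1 - (1 - m / c)) by field; rewrite gt_eqF.
by rewrite ler_pM2l ?divr_gt0 // lerD2l lerN2; lra.
Qed.

Lemma high_boundary_tests O (U0 : 'rV[R]_n -> R) (a c M : R) : 0 < c -> 0 <= M ->
  {within closure O, continuous U0} -> (forall x, O x -> `|U0 x| <= M) ->
  (forall x, O x -> bounded_jet M U0 x) ->
  (forall x, boundary O x -> a + 2 * c <= U0 x) -> has_test_functions O U0 a.
Proof.
move=> c0 M0 cU UM jU bU.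
pose Q := 1 + (M + (`|a| + c)) / c.
have Q0 : 0 <= Q by rewrite addr_ge0 // divr_ge0 ?addr_ge0 // ltW.
pose G := Q ^+ 2 * M + 2 * Q * M ^+ 2 / c.
have G0 : 0 <= G.
  by rewrite addr_ge0 // ?divr_ge0 ?mulr_ge0 ?sqr_ge0 // ltW.
(* For [b] within [c / 2] of [a], and where [U0] differs by less than [c / 2] from a boundary value,
   [U0] exceeds [b + c]: the cap is constant near the boundary. *)
exists (c / 2), G, 1, c; split=> //; first by rewrite divr_gt0.
move=> b ba; have c2 : 0 < c / 2 by rewrite divr_gt0.
have bc : `|b| <= `|a| + c by have := lerB_dist b a; lra.
exists (fun x => cap c b (U0 x)); split=> //.
- have cc : continuous (cap c b).
    move=> z; apply: cvgM; first exact: cvg_cst.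
    apply: cvgB; first exact: cvg_cst.
    have c1 : (fun z => 1 - (z - b) / c) @ z --> 1 - (z - b) / c.
      apply: cvgB; first exact: cvg_cst.
      by apply: cvgM; [apply: cvgB; [exact: cvg_id|exact: cvg_cst]|exact: cvg_cst].
    have c2' := cvg_comp _ _ c1 (@max_continuous_l R 0 _).
    exact: (cvg_comp _ _ c2' (@exprn_continuous R 3 _)).
  apply/subspace_continuousP => x cx.
  exact: (cvg_comp _ _ ((subspace_continuousP _ _).1 cU x cx) (cc _)).
- move=> x Ox i; have [v1 [q [dv dq v1G qG]]] := jU x Ox i.
  have [|w1 [q' [dw dq' w1b q'b]]] := @cap_line c b M _ v1 q c0 dv dq _ v1G qG.
    by rewrite scale0r add0r UM.
  have QQ : 1 + (M + `|b|) / c <= Q.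
    by rewrite lerD2l ler_pM2r ?invr_gt0 // lerD2l.
  have GG : (1 + (M + `|b|) / c) ^+ 2 * M + 2 * (1 + (M + `|b|) / c) * M ^+ 2 / c <= G.
    have Q1 : 0 <= 1 + (M + `|b|) / c by rewrite addr_ge0 // divr_ge0 ?addr_ge0 // ltW.
    rewrite lerD //; first by rewrite ler_wpM2r // ler_sqr ?nnegrE.
    rewrite ler_wpM2r ?invr_ge0 ?(ltW c0) // ler_wpM2r ?sqr_ge0 //.
    by rewrite ler_wpM2l.
  by exists w1, q'; split=> //; apply: le_trans GG.
- by move=> x _; exact: cap_le.
- move=> x bx; left.
  have [r r0 H] := (within_continuousP _ _).1 cU x (proj1 bx) _ c2.
  exists r, (c / 3); split=> // y cy /(H y cy).
  rewrite ltr_norml => /andP[_ Uy].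
  rewrite /cap max_r ?expr0n ?subr0 ?mulr1 //=.
  rewrite subr_le0 ler_pdivlMr // mul1r; have := bU x bx.
  by move: ba; rewrite ltr_norml; lra.
- by move=> x m _; exact: cap_ge.
Qed.

End TestFunctions.

(** * Reflection of the problem *)

Section Negation.
Context {R : realType} {n : nat}.
Implicit Types (x y : 'rV[R]_n) (O : set 'rV[R]_n) (g : 'rV[R]_n -> R).

Lemma pder_opp O g (k : nat) : open O ->
  (forall (s : seq 'I_n) i y, (size s < k)%N -> O y -> derivable (pder s g) y 'e_i) ->
  forall (s : seq 'I_n) x, (size s <= k)%N -> O x ->
  pder s (fun y => - g y) x = - pder s g x.
Proof.
move=> oO H; elim=> [//|i s IH] x sk Ox /=.
rewrite -deriveN; last exact: H.
apply: near_eq_derive; apply: filterS (open_nbhs_nbhs (conj oO Ox)) => y Oy.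
by rewrite IH // ltnW.
Qed.

Lemma derivable_pder_opp O g (k : nat) : open O ->
  (forall (s : seq 'I_n) i y, (size s < k)%N -> O y -> derivable (pder s g) y 'e_i) ->
  forall (s : seq 'I_n) i x, (size s < k)%N -> O x ->
  derivable (pder s (fun y => - g y)) x 'e_i.
Proof.
move=> oO H s i x sk Ox.
apply: (@near_eq_derivable _ _ _ (fun y => - pder s g y)).
  apply: filterS (open_nbhs_nbhs (conj oO Ox)) => y Oy.
  by rewrite (pder_opp oO H) // ltnW.
by apply: derivableN; exact: H.
Qed.

Lemma near_eq_continuous {V W : normedModType R} (p q : V -> W) (z : V) :
  (\forall y \near z, q y = p y) -> {for z, continuous p} -> {for z, continuous q}.
Proof.
move=> pq cp; rewrite /prop_for /continuous_at (nbhs_singleton pq).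
apply: cvg_trans cp; apply: near_eq_cvg.
by apply: filterS pq => y ->.
Qed.

Lemma near_space_time O x (t : R) : open O -> O x -> 0 < t ->
  \forall z \near (x, t), O z.1 /\ 0 < z.2.
Proof.
move=> oO Ox t0.
have /nearP[r r0 H] : \forall y \near x, O y by exact: open_nbhs_nbhs.
have [s [s0 sr st]] := pos_lt2 r0 t0.
apply: (nearP (V := ('rV[R]_n * R)%type) (x, t) _).2; exists s => // z.
move=> /norm_pair_lt[/= xz tz]; split; first by apply: H; exact: lt_trans sr.
by move: tz; rewrite ltr_norml; lra.
Qed.

Lemma classical_solution_opp O f e h u0 (u : 'rV[R]_n -> R -> R) : open O ->
  classical_solution O f e h u0 u ->
  classical_solution O (fun v => - f (- v)) e (fun t => - h t)
    (fun x => - u0 x) (fun x t => - u x t).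
Proof.
move=> oO sol.
have dS t : 0 < t -> forall (s : seq 'I_n) i y, (size s < 2)%N -> O y ->
    derivable (pder s (u ^~ t)) y 'e_i.
  by move=> t0 s i y s2 Oy; exact: (sol_space_derivable sol).
have d1 t x : 0 < t -> O x -> derive1 (fun t => - u x t) t = - derive1 (u x) t.
  by move=> t0 Ox; rewrite (derive1N (sol_time_derivable sol t0 Ox)).
split.
- by move=> z; apply: continuousN => ?; exact: (sol_continuous sol).
- move=> t s i x t0 s2 Ox; exact: (derivable_pder_opp oO (dS t t0)).
- move=> t s x t0 s2 Ox.
  apply: (@near_eq_continuous _ _ (fun z => - pder s (u ^~ z.2) z.1)).
    apply: filterS (near_space_time oO Ox t0) => z [Oz z0].
    exact: (pder_opp oO (dS z.2 z0)).
  by apply: cvgN; exact: (sol_space_C2 sol).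
- by move=> t x t0 Ox; apply: derivableN; exact: (sol_time_derivable sol).
- move=> t x t0 Ox.
  apply: (@near_eq_continuous _ _ (fun z => - derive1 (u z.1) z.2)).
    by apply: filterS (near_space_time oO Ox t0) => z [Oz z0]; exact: d1.
  by apply: cvgN; exact: (sol_time_C1 sol).
- move=> t x t0 Ox; rewrite d1 // (sol_equation sol) // opprK.
  have -> : laplacian (fun y => - u y t) x = - laplacian (u ^~ t) x.
    rewrite /laplacian -sumrN; apply: eq_bigr => i _.
    exact: (pder_opp oO (dS t t0) (s := [:: i; i])).
  by rewrite !opprD !mulrN.
- have [Du [cDu DuE DuN]] := sol_neumann sol.
  exists (fun z => - Du z); split.
  + by move=> z; apply: continuousN => ?; exact: cDu.
  + move=> t x t0 Ox; rewrite DuE //; apply/rowP => i; rewrite !mxE.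
    by rewrite (pder_opp oO (dS t t0) (s := [:: i])).
  + move=> t x v t0 nv.
    have -> : dot (- Du (x, t)) v = - dot (Du (x, t)) v.
      by rewrite /dot -sumrN; apply: eq_bigr => i _; rewrite mxE mulNr.
    by rewrite DuN // oppr0.
- by move=> x Ox; rewrite (sol_initial sol).
Qed.

End Negation.

Section Datum.
Context {R : realType} {n : nat}.
Implicit Types (x y : 'rV[R]_n) (O : set 'rV[R]_n).

Lemma compact_within_bounded {V : normedModType R} (K : set V) (g : V -> R) :
  compact K -> {within K, continuous g} -> exists2 M, 0 <= M & forall z, K z -> `|g z| <= M.
Proof.
move=> cK cg; have [K0|K0] := pselect (K !=set0); last first.
  by exists 0 => // z Kz; exfalso; apply: K0; exists z.
have cn : {within K, continuous (fun z => `|g z|)} by move=> z; apply: cvg_norm; exact: cg.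
have [c _ Hc] := compact_EVT_max K0 cK cn.
by exists `|g c| => // z Kz; apply: Hc; rewrite inE.
Qed.

Lemma bounded_jet_opp (G : R) (v : 'rV[R]_n -> R) x :
  bounded_jet G v x -> bounded_jet G (fun x => - v x) x.
Proof.
move=> jv i; have [v1 [q [dv dq v1G qG]]] := jv i.
exists (fun s => - v1 s), (- q); rewrite !normrN; split=> //.
- near=> s; have ds : is_derive s 1 (fun s => v (s *: 'e_i + x)) (v1 s) by near: s.
  exact: is_deriveN.
- exact: is_deriveN.
Unshelve. all: end_near. Qed.

Lemma Ck_closure_bounded O (u0 : 'rV[R]_n -> R) : open O -> bounded_set O ->
  Ck_closure 2 O u0 -> {within closure O, continuous u0} /\
  exists M, [/\ 0 <= M, forall x, O x -> `|u0 x| <= M &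
    forall x, O x -> bounded_jet M u0 x].
Proof.
move=> oO bO [C2 [g [g0 Hg]]].
have cO := compact_bounded_closure bO.
have B (s : seq 'I_n) : (size s <= 2)%N -> exists M, 0 <= M /\
    forall x, O x -> `|pder s u0 x| <= M.
  move=> s2; have [cg gE] := Hg s s2.
  have [M M0 HM] := compact_within_bounded cO cg.
  by exists M; split=> // x Ox; rewrite -gE //; apply: HM; exact: subset_closure.
split.
  have [cg _] := Hg [::] isT; apply/within_continuousP => x cx e e0.
  have [r r0 H] := (within_continuousP _ _).1 cg x cx e e0.
  by exists r => // y cy xy; rewrite -!g0 //; exact: H.
have [M0 [M00 H0]] := B [::] isT.
have /choice[M1 H1] i := B [:: i] isT.
have /choice[M2 H2] i := B [:: i; i] isT.
have S1 : 0 <= \sum_i M1 i by apply: sumr_ge0 => i _; case: (H1 i).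
have S2 : 0 <= \sum_i M2 i by apply: sumr_ge0 => i _; case: (H2 i).
have le_sum (F : 'I_n -> R) i : (forall j, 0 <= F j) -> F i <= \sum_j F j.
  by move=> F0; rewrite (bigD1 i) //= lerDl; apply: sumr_ge0.
exists (M0 + (\sum_i M1 i + \sum_i M2 i)); split.
- by rewrite !addr_ge0.
- by move=> x Ox; apply: le_trans (H0 x Ox) _; rewrite lerDl addr_ge0.
move=> x Ox i.
have [|d1 d2] := @line_jet _ _ u0 O x i oO Ox.
  by move=> s j y s2 Oy; have [_ ] := C2 s (ltnW s2) y Oy; apply.
exists (fun s => pder [:: i] u0 (s *: 'e_i + x)), (pder [:: i; i] u0 x); split=> //.
- rewrite scale0r add0r; apply: le_trans ((H1 i).2 x Ox) _.
  have := le_sum M1 i (fun j => (H1 j).1); lra.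
- apply: le_trans ((H2 i).2 x Ox) _.
  have := le_sum M2 i (fun j => (H2 j).1); lra.
Qed.

(** A boundary point of [O] in the closure of [O0] would lie on the boundary of [O0], a level set
    inside the open set [O]. So [u0] exceeds [a] on the compact boundary of [O], with a uniform
    gap. *)
Lemma datum_boundary O (a alpha : R) (u0 : 'rV[R]_n -> R) (O0 : set 'rV[R]_n) :
  open O -> bounded_set O -> {within closure O, continuous u0} ->
  initial_datum O a alpha u0 O0 ->
  exists2 c, 0 < c & forall x, boundary O x -> a + 2 * c <= u0 x.
Proof.
move=> oO bO cu [_ _ [_ oO0 O0O] bO0 _ _ _ out].
have gt x : boundary O x -> a < u0 x.
  move=> bx; have [cx nOx] := boundary_open oO bx.
  apply: out => // cx0; apply: nOx.
  have [/O0O//|nO0x] := pselect (O0 x).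
  have : boundary O0 x by split => //; move: nO0x; have /interior_id -> := oO0.
  by rewrite bO0 => -[].
have [B0|B0] := pselect (boundary O !=set0); last first.
  by exists 1 => // x bx; exfalso; apply: B0; exists x.
have cB : compact (boundary O).
  rewrite /boundary; have /interior_id -> := oO; rewrite setDE.
  by apply: compact_closedI; [exact: compact_bounded_closure|exact: open_closedC].
have cuB : {within boundary O, continuous u0}.
  by apply: continuous_subspaceW cu => x [].
have [z] := compact_EVT_min B0 cB cuB; rewrite inE => /gt az Hz.
exists ((u0 z - a) / 2); first lra.
by move=> x bx; have := Hz x; rewrite inE => /(_ bx); lra.
Qed.

Lemma near0_rightP (Q : R -> Prop) : (\forall e \near (0 : R)^'+, Q e) ->
  exists2 r : R, 0 < r & forall e, 0 < e < r -> Q e.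
Proof.
rewrite /at_right near_withinE => /nearP[r r0 H]; exists r => // e /andP[e0 er].
by apply: H => //; rewrite sub0r normrN gtr0_norm.
Qed.

End Datum.

Lemma MN_small_oscillation (R : realType) d (T : measurableType d) (P : probability T R)
    (xi : R -> R -> T -> R) : MN1 P xi \/ MN2 P xi ->
  {ae P, forall w, small_oscillation (fun e t => xi e t w)}.
Proof. by case; [exact: MN1_small_oscillation|exact: MN2_small_oscillation]. Qed.

Lemma derive1_feps (R : realType) (f xi0 : R -> R) (e v q : R) : is_derive v 1 f q ->
  derive1 (feps f xi0 e) v = q.
Proof.
move=> df; rewrite derive1E.
have -> : feps f xi0 e = f + cst (e * xi0 e) by [].
by rewrite derive_val addr0.
Qed.

Theorem theorem4p1 (R : realType) (n : nat) (hn : (2 <= n)%N)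
  (O : set 'rV[R]_n) (hO : smooth_bounded_domain O)
  (f : R -> R) (am a ap : R) (hf : bistable f am a ap)
  (alpha : R) (halpha : 0 < alpha < 1)
  (u0 : 'rV[R]_n -> R) (O0 : set 'rV[R]_n)
  (hu0 : initial_datum O a alpha u0 O0)
  (d : measure_display) (T : measurableType d) (P : probability T R)
  (xi : R -> R -> T -> R) (hxi : MN1 P xi \/ MN2 P xi)
  (eta : R) (heta : 0 < eta < Num.min (a - am) (ap - a)) :
  {ae P, forall w : T,
    forall aem ae aep : R -> R,
    zero_branches f am a ap (fun e => xi e 0 w) aem ae aep ->
    exists eps0 M0 : R, [/\ 0 < eps0, 0 < M0 &
      forall eps, 0 < eps < eps0 ->
      forall u : 'rV[R]_n -> R -> R,
      classical_solution O f eps (fun t => xi eps t w) u0 u ->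
      let mu := derive1 (feps f (fun e => xi e 0 w) eps) (ae eps) in
      let t := mu^-1 * eps ^+ 2 * `|ln eps| in
      (forall x, O x -> am - eta <= u x t <= ap + eta) /\
      (forall x, O x -> M0 * eps <= `|u0 x - ae eps| ->
        (ae eps + M0 * eps <= u0 x -> ap - eta <= u x t) /\
        (u0 x <= ae eps - M0 * eps -> u x t <= am + eta))]}.
Proof.
have rf := bistable_reaction hf.
have rf' := reaction_opp rf.
have [_ oO _ bO _] := hO.
have [cu [M [M0 uM jM]]] := Ck_closure_bounded oO bO (datum_C2 hu0).
have [c c0 bc] := datum_boundary oO bO cu hu0.
have test := high_boundary_tests c0 M0 cu uM jM bc.
have test' : has_test_functions O (fun x => - u0 x) (- a).
  apply: (low_boundary_tests c0 M0).
  - by move=> x; apply: continuousN => ?; exact: cu.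
  - by move=> x /jM; exact: bounded_jet_opp.
  - by move=> x /bc; lra.
have [eta0 eta1 eta2] : [/\ 0 < eta, eta < a - am & eta < ap - a].
  by move: heta; rewrite lt_min => /and3P[].
have uM1 x : O x -> - M <= u0 x by move=> /uM; rewrite ler_norml => /andP[].
have uM2 x : O x -> - M <= - u0 x by move=> /uM; rewrite ler_norml => /andP[_ ?]; lra.
have eta1' : eta < - am - - a by lra.
have [e1 [M1 [rho1 [e10 M10 rho10 H1]]]] := half_generation hO rf eta0 eta2 uM1 test.
have [e2 [M2 [rho2 [e20 M20 rho20 H2]]]] := half_generation hO rf' eta0 eta1' uM2 test'.
have m0 := reaction_a rf; set f1 := derive1 f in rf rf' m0 H1 H2.
have [cf cf1] := reaction_continuous rf.
have m2 : 0 < f1 a / 2 by rewrite divr_gt0.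
have [rho3 rho30 H3] := continuous_forP (cf1 a) m2.
have := MN_small_oscillation hxi; apply: filterS => w osc aem ae aep [zb [_ ca _]].
have [e3 e30 zb'] := near0_rightP zb.
have : all (fun a => 0 < a) [:: rho1; rho2; rho3] by rewrite /= rho10 rho20 rho30.
move=> /pos_lt_seq[rho rho0 /and4P[rl1 rl2 rl3 _]].
have [e4 e40 ca'] := near0_rightP ((cvgrPdist_lt _ _).1 ca rho rho0).
(* As [mu] will be at least [f1 a / 2], the factor [2 / f1 a] covers the final time. *)
have [e5 [e50 H5]] := osc _ (divr_gt0 (ltr0n R 2) m0).
have : all (fun a => 0 < a) [:: e1; e2; e3; e4; e5] by rewrite /= e10 e20 e30 e40 e50.
move=> /pos_lt_seq[eps0 eps00 /and5P[el1 el2 el3 el4 /andP[el5 _]]].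
exists eps0, (Num.max M1 M2); split=> //; first by rewrite lt_max M10.
move=> eps /andP[eps_gt0 eps_lt] u sol.
pose mu := derive1 (feps f (fun e => xi e 0 w) eps) (ae eps).
pose t := mu^-1 * eps ^+ 2 * `|ln eps|; rewrite -/mu -/t.
have [_ _ fb _] := zb' eps ltac:(by rewrite eps_gt0 (lt_trans eps_lt)).
have ba : `|ae eps - a| < rho.
  by rewrite distrC; apply: ca'; rewrite eps_gt0 (lt_trans eps_lt).
have muE : mu = f1 (ae eps) by apply: derive1_feps; exact: reaction_d1 rf _.
have mu2 : f1 a / 2 <= f1 (ae eps).
  have := H3 (ae eps); rewrite distrC => /(_ (lt_trans ba rl3)).
  by rewrite ltr_norml => /andP[_]; clear; lra.
have mu0 : 0 < f1 (ae eps) by exact: lt_le_trans mu2.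
have tE : t = (f1 (ae eps))^-1 * eps ^+ 2 * `|ln eps| by rewrite /t muE.
have noise s : 0 < s <= t -> `|xi eps s w - xi eps 0 w| <= 1.
  move=> /andP[s0 st]; apply: H5; first by rewrite eps_gt0 (lt_trans eps_lt).
  rewrite s0 /=; apply: le_trans st _; rewrite tE -mulrA ler_wpM2r //.
    by rewrite mulr_ge0 ?sqr_ge0.
  by rewrite -[2 / f1 a]invrK invf_div lef_pV2 ?posrE.
(* Since [ae eps] is a zero of [feps], the right side is [eps] times the oscillation of the noise
   since time 0. *)
have noise1 s : 0 < s <= t -> - eps <= f (ae eps) + eps * xi eps s w.
  move=> /noise; rewrite ler_norml => /andP[N1 N2].
  have : eps * - 1 <= eps * (xi eps s w - xi eps 0 w) by rewrite ler_pM2l.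
  by move: fb; rewrite /feps; clear; lra.
have noise2 s : 0 < s <= t -> - eps <= - f (- - ae eps) + eps * - xi eps s w.
  move=> /noise; rewrite ler_norml => /andP[N1 N2].
  have : eps * (xi eps s w - xi eps 0 w) <= eps * 1 by rewrite ler_pM2l.
  by move: fb; rewrite /feps opprK; clear; lra.
have ee1 : 0 < eps < e1 by rewrite eps_gt0 (lt_trans eps_lt).
have ee2 : 0 < eps < e2 by rewrite eps_gt0 (lt_trans eps_lt).
have ba2 : `|- ae eps - - a| < rho2 by rewrite -opprD normrN; exact: lt_trans rl2.
rewrite tE in noise1 noise2.
have L1 := H1 eps _ _ u ee1 (lt_trans ba rl1) noise1 sol.
have L2 := H2 eps (- ae eps) (fun s => - xi eps s w) _ ee2 ba2.
rewrite opprK in L2 noise2.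
have {}L2 := L2 _ noise2 (classical_solution_opp oO sol).
rewrite -tE in L1 L2.
have max1 : M1 * eps <= Num.max M1 M2 * eps by rewrite ler_pM2r // le_max lexx.
have max2 : M2 * eps <= Num.max M1 M2 * eps by rewrite ler_pM2r // le_max lexx orbT.
split=> x Ox; have [a1 a2] := L1 x Ox; have [b1 b2] := L2 x Ox.
  by apply/andP; split; lra.
move=> _; split=> h.
  by apply: a2; lra.
have : - am - eta <= - u x t by apply: b2; lra.
by lra.
Qed.
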